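(* (i) Let $f\in\mathcal{H}$ be nonzero. There exist a constant $\gamma\in\mathbb{R}$ and a measurable function $\psi:\sigma(f)\to[0,1]$ such that $f(z)=k_{\Gamma(f)}(z)e^{h(z)}$ for $z\in\mathbb{C}^+$, where $h\in\mathcal{H}$ is given by $h(z)=\gamma+\int_{\sigma(f)}\frac{1+zt}{t-z}\cdot\frac{\psi(t)}{1+t^2}\,dt$. (ii) Conversely, let $\sigma\subset\mathbb{R}$ be closed, $O\subset(\mathbb{R}\cup\{\infty\})\setminus\sigma$ open, and $\varphi:\sigma\to[0,1]$ measurable such that $\varphi$ is not equal to $1$ almost everywhere on any open interval. Define $v(z)=\int_{\sigma}\frac{1+zt}{t-z}\cdot\frac{\varphi(t)}{1+t^2}\,dt$ for $z\in\mathbb{C}^+$. Then $k_O e^{v}\in\mathcal{H}$, and $\Gamma(e^{v})=\varnothing$, i.e. $e^{v(t)}>0$ for every $t\in\Omega(e^v)$.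
   Context: $\mathbb{C}^+=\{z:\Im z>0\}$, $\mathcal{H}$ is the set of analytic maps $\mathbb{C}^+\to\overline{\mathbb{C}^+}$. For $f\in\mathcal{H}$ with Nevanlinna representation $f(z)=\alpha z+\beta+\int_{\mathbb{R}}\frac{1+zt}{t-z}\,d\rho(t)$ ($\alpha\ge0,\beta\in\mathbb{R}$, $\rho$ finite positive Borel), $\sigma(f)$ is the closed support of $\rho$ with $\infty$ added if $\alpha>0$ or the support is unbounded (integrals over $\sigma(f)$ are over $\sigma(f)\cap\mathbb{R}$); $\Omega(f)=(\mathbb{R}\cup\{\infty\})\setminus\sigma(f)$ (where $f$ extends analytically and is real-valued); $\Gamma(f)=\{x\in\Omega(f):f(x)<0\}$. Intervals in $\mathbb{R}\cup\{\infty\}$: for $b>a$, $(b,a)=(b,\infty)\cup\{\infty\}\cup(-\infty,a)$. For a proper open interval $J$, $p_J$ is the unique conformal automorphism of $\mathbb{C}^+$ negative exactly on $J$ with $|p_J(i)|=1$ (e.g. $p_{(b,a)}(z)=\frac{|i-b|}{|i-a|}\frac{z-a}{z-b}$ for finite $b<a$, $p_{(-\infty,a)}(z)=\frac{z-a}{|i-a|}$, $p_J=-1/p_{J'}$ if $J$ is the complement of $\overline{J'}$); $p_\varnothing=1$, $p_{\mathbb{R}\cup\{\infty\}}=-1$. For an open $O$ with connected components $J_n$, the Kreĭn product is $k_O=\prod_n p_{J_n}$. *)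

(* Defs.v *)
From HB Require Import structures.
From mathcomp Require Import all_boot all_order all_algebra.
From mathcomp Require Import all_classical all_reals all_analysis.
From mathcomp Require Import complex.

Set Implicit Arguments.
Unset Strict Implicit.
Unset Printing Implicit Defensive.

Import Order.TTheory GRing.Theory Num.Theory.
Import numFieldNormedType.Exports.

Local Open Scope classical_set_scope.
Local Open Scope ring_scope.

Definition cre {R : realType} (z : R[i]) : R := complex.Re z.
Definition cim {R : realType} (z : R[i]) : R := complex.Im z.
Definition rC {R : realType} (x : R) : R[i] := Complex x 0.
Definition iC {R : realType} : R[i] := Complex 0 1.
Definition cmod {R : realType} (z : R[i]) : R :=
  Num.sqrt (cre z ^+ 2 + cim z ^+ 2).
Definition cexp {R : realType} (z : R[i]) : R[i] :=
  Complex (expR (cre z) * cos (cim z)) (expR (cre z) * sin (cim z)).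

Definition UHP {R : realType} (z : R[i]) : Prop := 0 < cim z.

Definition cdifferentiable_at {R : realType} (f : R[i] -> R[i]) (z : R[i]) :=
  exists d : R[i], forall e : R, 0 < e -> exists2 del : R, 0 < del &
    forall w : R[i], 0 < cmod (w - z) < del ->
      cmod ((f w - f z) / (w - z) - d) < e.

Definition analytic_UHP {R : realType} (f : R[i] -> R[i]) :=
  forall z, UHP z -> cdifferentiable_at f z.

Definition nevanlinna {R : realType} (f : R[i] -> R[i]) :=
  analytic_UHP f /\ forall z, UHP z -> 0 <= cim (f z).

Definition cintegral {R : realType} (mu : {measure set (measurableTypeR R) -> \bar R})
    (D : set R) (g : R -> R[i]) : R[i] :=
  Complex (\int[mu]_(t in D) cre (g t)) (\int[mu]_(t in D) cim (g t)).

Definition nkernel {R : realType} (z : R[i]) (t : R) : R[i] :=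
  (1 + z * rC t) / (rC t - z).

Definition nev_rep {R : realType} (f : R[i] -> R[i]) (alpha beta : R)
    (rho : {finite_measure set (measurableTypeR R) -> \bar R}) :=
  0 <= alpha /\
  forall z, UHP z ->
    f z = rC alpha * z + rC beta + cintegral rho setT (nkernel z).

(* The extended real line R ∪ {∞}: option R, None = ∞                 *)

Definition msupport {R : realType}
    (rho : {finite_measure set (measurableTypeR R) -> \bar R}) : set R :=
  [set t | forall e : R, 0 < e -> (0%E < rho `](t - e)%R, (t + e)%R[%classic)%E].

Definition sigmaf {R : realType} (alpha : R)
    (rho : {finite_measure set (measurableTypeR R) -> \bar R}) : set (option R) :=
  fun x => match x with
  | Some t => msupport rho t
  | None => 0 < alpha \/ ~ (exists M : R, forall t, msupport rho t -> `|t| <= M)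
  end.

Definition Omegaf {R : realType} (alpha : R)
    (rho : {finite_measure set (measurableTypeR R) -> \bar R}) : set (option R) :=
  ~` sigmaf alpha rho.

(* c is the (boundary) value at x of f, i.e. the limit of f(z) as z -> x
   within C^+; for x in Omega(f) this is the value of the analytic
   continuation of f at x. *)
Definition bvalue {R : realType} (f : R[i] -> R[i]) (x : option R) (c : R) :=
  match x with
  | Some t => forall e : R, 0 < e -> exists2 del : R, 0 < del &
      forall z, UHP z -> cmod (z - rC t) < del -> cmod (f z - rC c) < e
  | None => forall e : R, 0 < e -> exists M : R,
      forall z, UHP z -> M < cmod z -> cmod (f z - rC c) < e
  end.

Definition Gammaf {R : realType} (f : R[i] -> R[i]) (alpha : R)
    (rho : {finite_measure set (measurableTypeR R) -> \bar R}) : set (option R) :=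
  [set x | Omegaf alpha rho x /\ exists2 c : R, c < 0 & bvalue f x c].

Definition ext_open {R : realType} (O : set (option R)) :=
  (forall t : R, O (Some t) -> exists2 e : R, 0 < e &
      forall s : R, `|s - t| < e -> O (Some s)) /\
  (O None -> exists M : R, forall s : R, M < `|s| -> O (Some s)).

(* open arcs of R ∪ {∞}, running increasingly from l to r (through ∞
   if necessary); an arc with equal finite endpoints a is the whole
   line minus {a}, the arc (∞, ∞) is R. *)
Definition arc {R : realType} (l r : option R) : set (option R) :=
  fun x => match l, r with
  | Some a, Some b =>
      if a < b then exists2 t, x = Some t & a < t < b
      else x = None \/ exists2 t, x = Some t & (a < t \/ t < b)
  | None, Some b => exists2 t, x = Some t & t < b
  | Some a, None => exists2 t, x = Some t & a < t
  | None, None => exists t, x = Some t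
  end.

(* descriptors of connected components: None = the whole of R ∪ {∞},
   Some (l, r) = the arc from l to r *)
Definition arcdesc (R : realType) := option (option R * option R).

Definition component {R : realType} (O : set (option R)) (J : arcdesc R) : Prop :=
  match J with
  | None => O = setT
  | Some (l, r) => ~ O l /\ ~ O r /\ arc l r `<=` O
  end.

(* p_J : the conformal automorphism of C^+ negative exactly on J with
   |p_J(i)| = 1.  Convention for the two degenerate "arcs" (whole line
   minus one point), for which no such automorphism exists: -1, the
   value for the whole of R ∪ {∞}. *)
Definition pJ {R : realType} (J : arcdesc R) (z : R[i]) : R[i] :=
  match J with
  | None => -1
  | Some (Some a, Some b) =>
      if a < b then
        rC (cmod (iC - rC a) / cmod (iC - rC b)) * (z - rC b) / (z - rC a)
      else if b < a then (* (a, oo) ∪ {oo} ∪ (-oo, b) *)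
        - rC (cmod (iC - rC a) / cmod (iC - rC b)) * (z - rC b) / (z - rC a)
      else -1
  | Some (None, Some b) => (* (-oo, b) *) (z - rC b) / rC (cmod (iC - rC b))
  | Some (Some a, None) => (* (a, oo) *) - rC (cmod (iC - rC a)) / (z - rC a)
  | Some (None, None) => -1
  end.

(* the Krein product prod_n p_{J_n}(z) over the components of O converges
   (unconditionally, i.e. along the net of finite sets of components) to w *)
Definition krein_to {R : realType} (O : set (option R)) (z w : R[i]) : Prop :=
  forall e : R, 0 < e -> exists2 s0 : seq (arcdesc R),
    (forall J, J \in s0 -> component O J) &
    forall s : seq (arcdesc R), uniq s -> (forall J, J \in s -> component O J) ->
      {subset s0 <= s} -> cmod (\prod_(J <- s) pJ J z - w) < e.

Definition krein_cvg {R : realType} (O : set (option R)) (z : R[i]) : Prop :=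
  exists w, krein_to O z w.

Definition kO {R : realType} (O : set (option R)) (z : R[i]) : R[i] :=
  xget 0 [set w | krein_to O z w].

(* Main.v *)
(* The Krein product is an exponential: z - a = |i - a| exp(int_(-oo,a) n(z,t) dt/(1+t^2))
   with n(z,t) = (1+zt)/(t-z), and the integral over the whole line is i pi, so p_J(z) is
   the exponential of the integral over J and k_O(z) that of the integral over O.

   Every nonzero f in H is |f(i)| exp(int n(z,t) xi(t) dt/(1+t^2)) with 0 <= xi <= 1.  If
   rho is finitely supported, f is a quotient of products of linear factors with real
   roots, so xi is an integer step function, and 0 <= arg f <= pi forces its values to be
   0 or 1.  In general discretize rho and take a weak limit of the densities xi along an
   ultrafilter; the limit of the measures xi dt/(1+t^2) is dominated by dt/(1+t^2), hence
   has a density by Radon-Nikodym.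

   Off the support of rho, f extends to a real Lipschitz function with Im f(x+iy) = O(y).
   Where it is negative (positive), pi - arg f (arg f) is the Poisson integral of 1 - xi
   (of xi) and is O(y), so xi = 1 (xi = 0) almost everywhere there.  Zeros are isolated
   because f is strictly increasing on gaps.  Hence xi is the indicator of Gamma(f) off
   sigma(f), which is (i), and for (ii) a negative value of e^v would force phi = 1 almost
   everywhere on an interval. *)

(* The weight dt/(1+t^2) makes the reference measure finite, and z in C^+ makes n(z, .) bounded; so
   the integrals can be handled as integrals of bounded measurable functions on a finite measure
   space. The base point is i because n(i, t) = i: every exponent is purely imaginary there, the
   constant factor is |f(i)|, and this quantity passes to limits. The obstacle in the approximation
   is that the densities xi of the discretized functions need not converge pointwise. An ultrafilter
   gives limits of their integrals against all bounded functions at once, and domination by one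
   finite measure makes the limit functional countably additive. The other obstacle is to read xi
   off from boundary behaviour. The bound O(y) holds uniformly over a whole interval, because the
   continuation of f across a gap is Lipschitz; an interval of length h then carries mass O(h^2),
   and about 1/h of them cover a fixed interval, so the total mass is O(h) for every h and
   vanishes. *)
Require Import Defs.
From HB Require Import structures.
From mathcomp Require Import all_boot all_order all_algebra.
From mathcomp Require Import all_classical all_reals all_analysis.
From mathcomp Require Import measurable_realfun.
From mathcomp Require Import complex.
From mathcomp Require Import ring lra.
Set Implicit Arguments.
Unset Strict Implicit.
Unset Printing Implicit Defensive.
Import Order.TTheory GRing.Theory Num.Theory.
Import numFieldNormedType.Exports.
Local Open Scope classical_set_scope.
Local Open Scope ring_scope.

(** * Real and imaginary parts, modulus, and the upper half-plane *)

Section ComplexModulus.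
Variable R : realType.
Implicit Types (x y : R) (z w : R[i]).

Lemma complex_eqP z w : cre z = cre w -> cim z = cim w -> z = w.
Proof. by case: z => a b; case: w => c d; rewrite /cre /cim /= => -> ->. Qed.

Lemma creD z w : cre (z + w) = cre z + cre w. Proof. by case: z; case: w. Qed.
Lemma cimD z w : cim (z + w) = cim z + cim w. Proof. by case: z; case: w. Qed.
Lemma creN z : cre (- z) = - cre z. Proof. by case: z. Qed.
Lemma cimN z : cim (- z) = - cim z. Proof. by case: z. Qed.
Lemma creB z w : cre (z - w) = cre z - cre w. Proof. by rewrite creD creN. Qed.
Lemma cimB z w : cim (z - w) = cim z - cim w. Proof. by rewrite cimD cimN. Qed.
Lemma creM z w : cre (z * w) = cre z * cre w - cim z * cim w.
Proof. by case: z; case: w. Qed.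
Lemma cimM z w : cim (z * w) = cre z * cim w + cim z * cre w.
Proof. by case: z; case: w. Qed.
Lemma creV z : cre z^-1 = cre z / (cre z ^+ 2 + cim z ^+ 2).
Proof. by case: z. Qed.
Lemma cimV z : cim z^-1 = - (cim z / (cre z ^+ 2 + cim z ^+ 2)).
Proof. by case: z. Qed.
Lemma cre_rC x : cre (rC x) = x. Proof. by []. Qed.
Lemma cim_rC x : cim (rC x) = 0. Proof. by []. Qed.
Lemma cre1 : cre (1 : R[i]) = 1. Proof. by []. Qed.
Lemma cim1 : cim (1 : R[i]) = 0. Proof. by []. Qed.
Lemma cre0 : cre (0 : R[i]) = 0. Proof. by []. Qed.
Lemma cim0 : cim (0 : R[i]) = 0. Proof. by []. Qed.
Lemma cre_rCM x z : cre (rC x * z) = x * cre z.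
Proof. by rewrite creM cre_rC cim_rC mul0r subr0. Qed.
Lemma cim_rCM x z : cim (rC x * z) = x * cim z.
Proof. by rewrite cimM cre_rC cim_rC mul0r addr0. Qed.

Lemma rCE x : rC x = real_complex R x. Proof. by []. Qed.
Lemma rCD x y : rC (x + y) = rC x + rC y. Proof. by rewrite !rCE rmorphD. Qed.
Lemma rCN x : rC (- x) = - rC x. Proof. by rewrite !rCE rmorphN. Qed.
Lemma rCB x y : rC (x - y) = rC x - rC y. Proof. by rewrite !rCE rmorphB. Qed.
Lemma rCM x y : rC (x * y) = rC x * rC y. Proof. by rewrite !rCE rmorphM. Qed.
Lemma rCV x : rC x^-1 = (rC x)^-1. Proof. by rewrite !rCE fmorphV. Qed.
Lemma rC1 : rC 1 = 1 :> R[i]. Proof. by []. Qed.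
Lemma rC0 : rC 0 = 0 :> R[i]. Proof. by []. Qed.
Lemma rC_eq0 x : (rC x == 0) = (x == 0).
Proof. by rewrite rCE fmorph_eq0. Qed.

Lemma cmodE z : cmod z = ComplexField.Normc.normc z. Proof. by case: z. Qed.
Lemma cmod_ge0 z : 0 <= cmod z. Proof. exact: sqrtr_ge0. Qed.
Lemma cmodM z w : cmod (z * w) = cmod z * cmod w.
Proof. by rewrite !cmodE ComplexField.Normc.normcM. Qed.
Lemma cmodV z : cmod z^-1 = (cmod z)^-1.
Proof. by rewrite !cmodE ComplexField.Normc.normcV. Qed.
Lemma cmodN z : cmod (- z) = cmod z.
Proof. by rewrite /cmod creN cimN !sqrrN. Qed.
Lemma cmodBC z w : cmod (z - w) = cmod (w - z).
Proof. by rewrite -cmodN opprB. Qed.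
Lemma cmod0 : cmod (0 : R[i]) = 0.
Proof. by rewrite cmodE ComplexField.Normc.normc0. Qed.
Lemma cmod1 : cmod (1 : R[i]) = 1.
Proof. by rewrite cmodE ComplexField.Normc.normc1. Qed.
Lemma cmod_rC x : cmod (rC x) = `|x|.
Proof. by rewrite /cmod cre_rC cim_rC expr0n addr0 sqrtr_sqr. Qed.
Lemma cmodX z n : cmod (z ^+ n) = cmod z ^+ n.
Proof. by elim: n => [|n IH]; rewrite ?cmod1 // !exprS cmodM IH. Qed.
Lemma cmod_eq0 z : (cmod z == 0) = (z == 0).
Proof.
apply/eqP/eqP => [|->]; last exact: cmod0.
by rewrite cmodE => /ComplexField.Normc.eq0_normc.
Qed.
Lemma cmod_gt0 z : (0 < cmod z) = (z != 0).
Proof. by rewrite lt_neqAle cmod_ge0 andbT eq_sym cmod_eq0. Qed.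
Lemma cmodD z w : cmod (z + w) <= cmod z + cmod w.
Proof.
rewrite !cmodE -(lecR (R := R)) rmorphD /=.
by have := ler_normD z w; rewrite !normc_def; case: z; case: w.
Qed.
Lemma sqr_cmod z : cmod z ^+ 2 = cre z ^+ 2 + cim z ^+ 2.
Proof. by rewrite sqr_sqrtr // addr_ge0 ?sqr_ge0. Qed.
Lemma cre_le_cmod z : `|cre z| <= cmod z.
Proof. by rewrite -sqrtr_sqr ler_wsqrtr // lerDl sqr_ge0. Qed.
Lemma cim_le_cmod z : `|cim z| <= cmod z.
Proof. by rewrite -sqrtr_sqr ler_wsqrtr // lerDr sqr_ge0. Qed.
Lemma cmod_le_reim z : cmod z <= `|cre z| + `|cim z|.
Proof.
rewrite -[X in _ <= X]ger0_norm ?addr_ge0// -sqrtr_sqr ler_wsqrtr //.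
rewrite sqrrD !real_normK ?num_real// -addrA lerD2l lerDr.
by rewrite mulrn_wge0 ?mulr_ge0.
Qed.
Lemma cmod_triangle u z w : cmod (z - w) <= cmod (z - u) + cmod (u - w).
Proof. by apply: le_trans (cmodD _ _); rewrite subrKA. Qed.

Lemma UHP_neq_real z x : UHP z -> rC x - z != 0.
Proof.
rewrite /UHP => hz; apply: contraTneq hz => h.
have : cim (rC x - z) = 0 by rewrite h.
by rewrite cimB cim_rC sub0r => /eqP; rewrite oppr_eq0 => /eqP->; rewrite ltxx.
Qed.

Lemma cim_le_dist z x : `|cim z| <= cmod (rC x - z).
Proof. by have := cim_le_cmod (rC x - z); rewrite cimB cim_rC sub0r normrN. Qed.

Lemma UHP_near z w : UHP z -> cmod (w - z) < cim z -> UHP w.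
Proof.
rewrite /UHP => hz h.
have := le_lt_trans (cim_le_cmod (w - z)) h; rewrite cimB ltr_norml; lra.
Qed.

Lemma UHP_near2 z w : UHP z -> cmod (w - z) < cim z / 2 -> cim z / 2 < cim w.
Proof.
rewrite /UHP => hz h.
have := le_lt_trans (cim_le_cmod (w - z)) h; rewrite cimB ltr_norml; lra.
Qed.

End ComplexModulus.

Definition creimE (R : realType) :=
  (@creM R, @cimM R, @creD R, @cimD R, @creN R, @cimN R, @creV R, @cimV R,
   @cre_rC R, @cim_rC R, @cre1 R, @cim1 R, @cre0 R, @cim0 R).

(** * The complex exponential *)

Section Cexp.
Variable R : realType.
Implicit Types (z w : R[i]).

Lemma cexpD z w : cexp (z + w) = cexp z * cexp w.
Proof.
apply: complex_eqP; rewrite /cexp /cre /cim /=; case: z => a b; case: w => c d /=.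
- by rewrite expRD cosD; ring.
- by rewrite expRD sinD; ring.
Qed.

Lemma cexp0 : cexp (0 : R[i]) = 1.
Proof. by rewrite /cexp /cre /cim /= expR0 cos0 sin0 !mul1r. Qed.

Lemma cexpN z : cexp (- z) = (cexp z)^-1.
Proof.
have h : cexp (- z) * cexp z = 1 by rewrite -cexpD addNr cexp0.
have n0 : cexp z != 0.
  by apply: contra_eq_neq h => ->; rewrite mulr0 eq_sym oner_neq0.
by apply: (mulIf n0); rewrite h mulVf.
Qed.

Lemma cmod_cexp z : cmod (cexp z) = expR (cre z).
Proof.
rewrite /cmod /cexp /cre /cim /= !exprMn -mulrDr cos2Dsin2 mulr1 sqrtr_sqr.
by rewrite ger0_norm ?expR_ge0.
Qed.

Lemma cexp_neq0 z : cexp z != 0.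
Proof. by rewrite -cmod_gt0 cmod_cexp expR_gt0. Qed.

Lemma cexp_rC (x : R) : cexp (rC x) = rC (expR x).
Proof. by rewrite /cexp /rC /cre /cim /= cos0 sin0 mulr1 mulr0. Qed.

Lemma cexp_ipi : cexp (Complex 0 pi : R[i]) = -1.
Proof.
rewrite /cexp /cre /cim /= expR0 cospi sinpi !mul1r.
by apply: complex_eqP; rewrite ?creN ?cimN ?cre1 ?cim1 /cre /cim /= ?oppr0.
Qed.

Lemma cim_cexp_ge0 z : 0 <= cim z <= pi -> 0 <= cim (cexp z).
Proof.
move=> h; rewrite /cexp {1}/cim /= mulr_ge0 ?expR_ge0 // sin_ge0_pi //.
Qed.

End Cexp.

(** * Elementary estimates for sine, cosine and the exponential *)

Section RealTrig.
Variable R : realType.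
Implicit Types x y : R.

Lemma sin_mvt y : 0 <= y -> exists2 c : R, 0 <= c <= y & sin y = cos c * y.
Proof.
move=> y0.
have [|c] := @MVT_segment R sin cos 0 y y0 (fun x _ => is_derive_sin x).
  by apply: continuous_subspaceT => t; exact: continuous_sin.
by rewrite in_itv /= => hc; rewrite sin0 !subr0 => ->; exists c.
Qed.

Lemma abs_sin_le y : `|sin y| <= `|y|.
Proof.
wlog y0 : y / 0 <= y => [h|].
  have [/h//|/ltW yle] := leP 0 y.
  by rewrite -normrN -sinN -(normrN y); apply: h; rewrite oppr_ge0.
have [c _ ->] := sin_mvt y0.
by rewrite normrM ler_piMl // ler_norml cos_geN1 cos_le1.
Qed.

Lemma one_sub_cos_le y : 0 <= 1 - cos y <= y ^+ 2.
Proof.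
have -> : 1 - cos y = 2 * sin (y / 2) ^+ 2.
  rewrite {1}(_ : y = (y / 2) *+ 2); last by rewrite -mulr_natr divfK ?pnatr_eq0.
  by rewrite cos_mulr2n cos2sin2; ring.
have : `|sin (y / 2)| ^+ 2 <= `|y / 2| ^+ 2 by rewrite lerXn2r ?nnegrE// abs_sin_le.
rewrite !real_normK ?num_real// => h.
have := sqr_ge0 (sin (y/2)); have := sqr_ge0 y; move: h.
by rewrite expr_div_n; lra.
Qed.

Lemma sin_sub_le y : `|y| <= 1 -> `|sin y - y| <= y ^+ 2.
Proof.
wlog y0 : y / 0 <= y => [h|].
  have [/h//|/ltW yle] := leP 0 y => y1.
  have := h (- y); rewrite oppr_ge0 => /(_ yle); rewrite normrN => /(_ y1).
  by rewrite sinN -opprD normrN sqrrN.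
rewrite (ger0_norm y0) => y1.
have [c /andP[c0 cy] ->] := sin_mvt y0.
have -> : cos c * y - y = - ((1 - cos c) * y) by ring.
rewrite normrN normrM (ger0_norm y0).
have /andP[h1 h2] := one_sub_cos_le c.
rewrite (ger0_norm h1).
have h3 : c ^+ 2 <= y ^+ 2 by rewrite lerXn2r.
apply: le_trans (_ : y ^+ 2 * y <= _); first by rewrite ler_wpM2r // (le_trans h2).
by rewrite ler_piMr // sqr_ge0.
Qed.

(** The upper bound comes from e^(-x) >= 1 - x, that is e^x (1 - x) <= 1, together with 1/(1 - x) <=
    1 + x + 2 x^2 for x <= 1/2. *)
Lemma expR_sub_le x : `|x| <= 1 / 2 -> `|expR x - 1 - x| <= 2 * x ^+ 2.
Proof.
rewrite ler_norml => /andP[x1 x2].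
have h1 := expR_ge1Dx x; have h2 := expR_ge1Dx (- x).
have h3 : expR x * expR (- x) = 1 by rewrite -expRD subrr expR0.
have h4 : expR x * (1 - x) <= 1 by rewrite -[leRHS]h3 ler_wpM2l ?expR_ge0.
rewrite ger0_norm; last lra.
have h5 : 1 <= (1 + x + 2 * x ^+ 2) * (1 - x).
  have -> : (1 + x + 2 * x ^+ 2) * (1 - x) = 1 + x ^+ 2 * (1 - 2 * x) by ring.
  by rewrite lerDl mulr_ge0 ?sqr_ge0 //; lra.
have h6 : expR x * (1 - x) <= (1 + x + 2 * x ^+ 2) * (1 - x) by apply: le_trans h5.
by rewrite ler_pM2r in h6; lra.
Qed.

(** This is th <= tan th, written as imaginary part over real part so that it applies to a value of
    [f] directly. The mean value theorem gives sin th = th cos c with 0 <= c <= th, and the cosine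
    decreases on [0, pi]. *)
Lemma angle_le_pos (r th : R) : 0 < r -> 0 <= th <= pi ->
  0 < r * cos th -> th <= r * sin th / (r * cos th).
Proof.
move=> r0 /andP[th0 thpi] c0.
have c1 : 0 < cos th by rewrite pmulr_rgt0 in c0.
rewrite ler_pdivlMr // mulrCA ler_pM2l //.
have [c /andP[h1 h2] ->] := sin_mvt th0.
rewrite mulrC ler_wpM2r //.
have [->//|cth] := eqVneq c th.
apply/ltW; rewrite ltr_cos ?in_itv /=.
- by rewrite lt_neqAle cth.
- by rewrite h1 (le_trans h2).
- by rewrite th0.
Qed.

Lemma angle_le_neg (r th : R) : 0 < r -> 0 <= th <= pi ->
  r * cos th < 0 -> pi - th <= r * sin th / - (r * cos th).
Proof.
move=> r0 /andP[th0 thpi] c0.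
have hs : sin (pi - th) = sin th by rewrite sinB sinpi cospi; ring.
have hc : cos (pi - th) = - cos th by rewrite cosB sinpi cospi; ring.
have := @angle_le_pos r (pi - th) r0; rewrite hs hc mulrN; apply; lra.
Qed.
End RealTrig.

(** * Second-order expansion of the complex exponential *)

Section CexpDiff.
Variable R : realType.
Implicit Types w : R[i].
(** The five error terms below add up to 8 [cmod w ^+ 2]; only the quadratic order matters later. *)
Lemma cexp_expand w : cmod w <= 1 / 2 ->
    cmod (cexp w - 1 - w) <= 10 * cmod w ^+ 2.
Proof.
move=> hw.
have hx := cre_le_cmod w; have hy := cim_le_cmod w.
set x := cre w in hx *; set y := cim w in hy *; set m := cmod w in hw hx hy *.
have m0 : 0 <= m by exact: cmod_ge0.
have x2 : x ^+ 2 <= m ^+ 2.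
  by rewrite -(real_normK (num_real x)) lerXn2r ?nnegrE.
have y2 : y ^+ 2 <= m ^+ 2.
  by rewrite -(real_normK (num_real y)) lerXn2r ?nnegrE.
have xy : `|x| * `|y| <= m ^+ 2 by rewrite expr2 ler_pM.
have ex := expR_sub_le (le_trans hx hw).
have sy : `|sin y - y| <= y ^+ 2 by apply: sin_sub_le; lra.
have cy := one_sub_cos_le y.
apply: le_trans (cmod_le_reim _) _.
rewrite !creB !cimB cre1 cim1 subr0 -/x -/y.
rewrite [cre (cexp w)]/(expR x * cos y) [cim (cexp w)]/(expR x * sin y).
have -> : expR x * cos y - 1 - x = (expR x - 1 - x) * cos y - (1 + x) * (1 - cos y).
  by ring.
have -> : expR x * sin y - y = (expR x - 1 - x) * sin y + x * sin y + (sin y - y).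
  by ring.
have l1 : `|(expR x - 1 - x) * cos y| <= 2 * m ^+ 2.
  rewrite normrM; apply: le_trans (_ : `|expR x - 1 - x| * 1 <= _).
    by rewrite ler_wpM2l // ler_norml cos_geN1 cos_le1.
  lra.
have l2 : `|(1 + x) * (1 - cos y)| <= 2 * m ^+ 2.
  rewrite normrM ler_pM //; first by rewrite (le_trans (ler_normD _ _)) // normr1; lra.
  by case/andP: cy => c1 c2; rewrite ger0_norm //; lra.
have l3 : `|(expR x - 1 - x) * sin y| <= 2 * m ^+ 2.
  rewrite normrM; apply: le_trans (_ : `|expR x - 1 - x| * 1 <= _).
    by rewrite ler_wpM2l // ler_norml sin_geN1 sin_le1.
  lra.
have l4 : `|x * sin y| <= m ^+ 2.
  by rewrite normrM (le_trans _ xy) // ler_wpM2l // abs_sin_le.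
have := ler_normB ((expR x - 1 - x) * cos y) ((1 + x) * (1 - cos y)).
have := ler_normD ((expR x - 1 - x) * sin y + x * sin y) (sin y - y).
have := ler_normD ((expR x - 1 - x) * sin y) (x * sin y).
have := sqr_ge0 m.
lra.
Qed.
End CexpDiff.

(** * Bounded measurable functions on a finite measure space *)

Section BoundedMeasurable.
Context d (T : measurableType d) (R : realType).
Implicit Types f g : T -> R.

(** A class closed under sums and products whose members are integrable for every finite measure, so
    linearity of the integral carries no further integrability conditions. *)
Definition bmf f := measurable_fun setT f /\ exists M, forall x, `|f x| <= M.

Lemma bmf_cst c : bmf (fun=> c).
Proof. by split; [exact: measurable_cst | exists `|c|]. Qed.

Lemma bmfD f g : bmf f -> bmf g -> bmf (fun x => f x + g x).
Proof.
move=> [mf [M fM]] [mg [N gN]]; split; first exact: measurable_funD.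
by exists (M + N) => x; rewrite (le_trans (ler_normD _ _)) // lerD.
Qed.

Lemma bmfM f g : bmf f -> bmf g -> bmf (fun x => f x * g x).
Proof.
move=> [mf [M fM]] [mg [N gN]]; split; first exact: measurable_funM.
by exists (M * N) => x; rewrite normrM ler_pM.
Qed.

Lemma bmfN f : bmf f -> bmf (fun x => - f x).
Proof.
move=> hf; have := bmfM (bmf_cst (-1)) hf.
by under [X in bmf X]eq_fun do rewrite mulN1r.
Qed.

Lemma bmfB f g : bmf f -> bmf g -> bmf (fun x => f x - g x).
Proof. by move=> hf /bmfN; exact: bmfD. Qed.

Lemma bmf_indic (A : set T) : measurable A -> bmf (\1_A : T -> R).
Proof.
move=> mA; split; first exact: measurable_indic.
by exists 1 => x; rewrite indicE; case: (_ \in _); rewrite ?normr1 ?normr0.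
Qed.

Lemma bmf_restrict f (A : set T) (M : R) : measurable A -> measurable_fun A f ->
  (forall t, A t -> `|f t| <= M) -> bmf (f \_ A).
Proof.
move=> mA mf fM; split; first by apply/(measurable_restrictT f mA).
exists `|M| => x; rewrite patchE; case: ifPn => [|_]; last by rewrite normr0.
by rewrite inE => /fM h; rewrite (le_trans h) // ler_norm.
Qed.

Lemma bmf01 f : measurable_fun setT f -> (forall t, 0 <= f t <= 1) -> bmf f.
Proof.
move=> mf f01; split => //; exists 1 => t.
by case/andP: (f01 t) => f0 f1; rewrite ger0_norm.
Qed.

Variable mu : {finite_measure set T -> \bar R}.

Lemma bmf_integrable f (D : set T) : measurable D -> bmf f ->
  mu.-integrable D (EFin \o f).
Proof.
move=> mD [mf [M fM]]; apply: measurable_bounded_integrable => //.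
- by rewrite -ge0_fin_numE // fin_num_measure.
- exact: measurable_funTS.
- exists M; split; first by rewrite num_real.
  by move=> N MN t _ /=; exact: le_trans (fM t) (ltW MN).
Qed.

Lemma bmf_integralD f g : bmf f -> bmf g ->
  \int[mu]_t (f t + g t) = \int[mu]_t f t + \int[mu]_t g t.
Proof. by move=> hf hg; apply: RintegralD => //; exact: bmf_integrable. Qed.

Lemma bmf_integralB f g : bmf f -> bmf g ->
  \int[mu]_t (f t - g t) = \int[mu]_t f t - \int[mu]_t g t.
Proof. by move=> hf hg; apply: RintegralB => //; exact: bmf_integrable. Qed.

Lemma bmf_integralZ c f : bmf f -> \int[mu]_t (c * f t) = c * \int[mu]_t f t.
Proof. by move=> hf; apply: RintegralZl => //; exact: bmf_integrable. Qed.

Lemma bmf_le_integral f g : bmf f -> bmf g -> (forall t, f t <= g t) ->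
  \int[mu]_t f t <= \int[mu]_t g t.
Proof. by move=> hf hg h; apply: le_Rintegral => //; exact: bmf_integrable. Qed.

Lemma integral_cstT c : \int[mu]_(t in setT) c = c * fine (mu setT).
Proof. exact: Rintegral_cst. Qed.

Lemma mass_ge0 : 0 <= fine (mu setT). Proof. exact: fine_ge0. Qed.

Lemma bmf_integral_norm f M : bmf f -> (forall t, `|f t| <= M) ->
  `|\int[mu]_t f t| <= M * fine (mu setT).
Proof.
move=> hf fM; rewrite -integral_cstT.
apply: le_trans (le_normr_Rintegral _ _) _ => //; first exact: bmf_integrable.
apply: bmf_le_integral => //; last exact: bmf_cst.
case: hf => mf hM; split; first exact: measurableT_comp.
by case: hM => N hN; exists N => x; rewrite normr_id.
Qed.

End BoundedMeasurable.

(** * Complex-valued bounded integrands and the Nevanlinna kernel *)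

Section ComplexBounded.
Context {R : realType}.
Local Notation T := (measurableTypeR R).
Implicit Types (g h : T -> R[i]) (z w : R[i]).

Definition cbmf g := bmf (fun t => cre (g t)) /\ bmf (fun t => cim (g t)).

Lemma cbmf_cst c : cbmf (fun=> c). Proof. by split; exact: bmf_cst. Qed.

Lemma cbmfD g h : cbmf g -> cbmf h -> cbmf (fun t => g t + h t).
Proof.
move=> [g1 g2] [h1 h2]; split.
  by under [X in bmf X]eq_fun do rewrite creD; exact: bmfD.
by under [X in bmf X]eq_fun do rewrite cimD; exact: bmfD.
Qed.

Lemma cbmfM g h : cbmf g -> cbmf h -> cbmf (fun t => g t * h t).
Proof.
move=> [g1 g2] [h1 h2]; split.
  by under [X in bmf X]eq_fun do rewrite creM; apply: bmfB; exact: bmfM.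
by under [X in bmf X]eq_fun do rewrite cimM; apply: bmfD; exact: bmfM.
Qed.

Lemma cbmfN g : cbmf g -> cbmf (fun t => - g t).
Proof.
move=> hg; have := cbmfM (cbmf_cst (-1)) hg.
by under [X in cbmf X]eq_fun do rewrite mulN1r.
Qed.

Lemma cbmf_rC (f : T -> R) : bmf f -> cbmf (fun t => rC (f t)).
Proof. by move=> hf; split => //; exact: bmf_cst. Qed.

Lemma cbmf_resolvent z : UHP z -> cbmf (fun t => (rC t - z)^-1).
Proof.
move=> hz.
have q0 (t : R) : 0 < (t - cre z) ^+ 2 + cim z ^+ 2.
  by rewrite ltr_wpDl ?sqr_ge0 // exprn_gt0.
have cq : continuous (fun t : R => (t - cre z) ^+ 2 + cim z ^+ 2).
  move=> t; apply: cvgD; last exact: cvg_cst.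
  by rewrite expr2; apply: cvgM; apply: cvgB => //; exact: cvg_cst.
have cV : continuous (fun t : R => ((t - cre z) ^+ 2 + cim z ^+ 2)^-1).
  by move=> t; apply: cvgV; [rewrite gt_eqF | exact: cq].
have bd t : cmod (rC t - z)^-1 <= (cim z)^-1.
  rewrite cmodV lef_pV2 ?posrE ?cmod_gt0 ?UHP_neq_real //.
  by apply: le_trans (ler_norm _) _; exact: cim_le_dist.
split; split.
- under [X in measurable_fun _ X]eq_fun => t.
    rewrite creV creB cimB cre_rC cim_rC sub0r sqrrN; over.
  apply: continuous_measurable_fun => t; apply: cvgM; last exact: cV.
  by apply: cvgB => //; exact: cvg_cst.
- by exists (cim z)^-1 => t; apply: le_trans (bd t); exact: cre_le_cmod.
- under [X in measurable_fun _ X]eq_fun => t.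
    rewrite cimV creB cimB cre_rC cim_rC sub0r sqrrN mulNr opprK; over.
  apply: continuous_measurable_fun => t; apply: cvgM; last exact: cV.
  exact: cvg_cst.
- by exists (cim z)^-1 => t; apply: le_trans (bd t); exact: cim_le_cmod.
Qed.

(** Isolates the dependence on [t] in the resolvent 1/(t - z), which is bounded by 1/Im z. *)
Lemma nkernelE z t : UHP z -> nkernel z t = z + (1 + z ^+ 2) * (rC t - z)^-1.
Proof. by move=> hz; rewrite /nkernel; field; exact: UHP_neq_real. Qed.

Lemma cbmf_nkernel z : UHP z -> cbmf (nkernel z).
Proof.
move=> hz; rewrite (_ : nkernel z = fun t => z + (1 + z ^+ 2) * (rC t - z)^-1).
  by apply: cbmfD; [|apply: cbmfM]; try exact: cbmf_cst; exact: cbmf_resolvent.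
by apply/funext => t; exact: nkernelE.
Qed.

(** Divided by 1 + t^2 this is pi times the Poisson kernel; hence potentials over dt/(1+t^2) have
    Poisson integrals as imaginary parts. *)
Lemma cim_nkernel z t : UHP z ->
  cim (nkernel z t) = cim z * (1 + t ^+ 2) / ((t - cre z) ^+ 2 + cim z ^+ 2).
Proof.
move=> hz; rewrite /nkernel !creimE; field.
by apply: lt0r_neq0; rewrite ltr_wpDl ?sqr_ge0 // exprn_gt0.
Qed.

Lemma cim_nkernel_gt0 z t : UHP z -> 0 < cim (nkernel z t).
Proof.
move=> hz; rewrite cim_nkernel // divr_gt0 ?mulr_gt0 //.
  by rewrite ltr_wpDr ?sqr_ge0.
by rewrite ltr_wpDl ?sqr_ge0 // exprn_gt0.
Qed.

Lemma nkernel_i t : nkernel iC t = iC :> R[i].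
Proof.
have hi : UHP (iC : R[i]) by rewrite /UHP /cim /=.
have i2 : iC ^+ 2 = -1 :> R[i].
  by apply: complex_eqP; rewrite expr2 !creimE /cre /cim /=; ring.
by rewrite nkernelE // i2 subrr mul0r addr0.
Qed.

Variable mu : {finite_measure set T -> \bar R}.

Lemma cintegralD g h : cbmf g -> cbmf h ->
  cintegral mu setT (fun t => g t + h t) =
  cintegral mu setT g + cintegral mu setT h.
Proof.
move=> [g1 g2] [h1 h2]; apply: complex_eqP; rewrite ?creD ?cimD /cre /cim /=.
  rewrite -bmf_integralD //; apply: eq_Rintegral => t _; exact: creD.
rewrite -bmf_integralD //; apply: eq_Rintegral => t _; exact: cimD.
Qed.

Lemma cre_cintegral (nu : {measure set T -> \bar R}) D g :
  cre (cintegral nu D g) = \int[nu]_(t in D) cre (g t).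
Proof. by []. Qed.

Lemma cim_cintegral (nu : {measure set T -> \bar R}) D g :
  cim (cintegral nu D g) = \int[nu]_(t in D) cim (g t).
Proof. by []. Qed.

Lemma cintegralZ (c : R[i]) g : cbmf g ->
  cintegral mu setT (fun t => c * g t) = c * cintegral mu setT g.
Proof.
move=> [g1 g2]; apply: complex_eqP.
  rewrite creM !cre_cintegral cim_cintegral.
  rewrite -!bmf_integralZ // -bmf_integralB; try by apply: bmfM => //; exact: bmf_cst.
  by apply: eq_Rintegral => t _; exact: creM.
rewrite cimM cre_cintegral !cim_cintegral.
rewrite -!bmf_integralZ // -bmf_integralD; try by apply: bmfM => //; exact: bmf_cst.
by apply: eq_Rintegral => t _; exact: cimM.
Qed.

Lemma cintegralB g h : cbmf g -> cbmf h ->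
  cintegral mu setT (fun t => g t - h t) =
  cintegral mu setT g - cintegral mu setT h.
Proof.
move=> hg hh; rewrite cintegralD //; last exact: cbmfN.
congr (_ + _); rewrite -mulN1r -cintegralZ //.
by congr cintegral; apply/funext => t; rewrite mulN1r.
Qed.

(** The factor 2 is the price of estimating real and imaginary parts separately. *)
Lemma cmod_cintegral g M : cbmf g -> (forall t, cmod (g t) <= M) ->
  cmod (cintegral mu setT g) <= 2 * M * fine (mu setT).
Proof.
move=> [g1 g2] gM; apply: le_trans (cmod_le_reim _) _.
rewrite -mulrA mulr_natl mulr2n lerD //; apply: bmf_integral_norm => // t.
  exact: le_trans (cre_le_cmod _) (gM t).
exact: le_trans (cim_le_cmod _) (gM t).
Qed.

Lemma eq_cintegral (nu : {measure set T -> \bar R}) (D : set R) g h :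
  (forall t, D t -> g t = h t) -> cintegral nu D g = cintegral nu D h.
Proof.
by move=> gh; congr Complex; apply: eq_Rintegral => t; rewrite inE => /gh ->.
Qed.

End ComplexBounded.

(** * Complex differentiability with a quadratic remainder *)

Section QuadraticDifferentiability.
Variable R : realType.
Implicit Types (f g : R[i] -> R[i]) (z w d : R[i]).

(** An explicit quadratic remainder is easy to integrate in [t] and survives composition with the
    exponential. *)
Definition qdiff f z := exists d, exists2 e : R, 0 < e & exists2 K : R, 0 <= K &
  forall w, cmod (w - z) < e ->
    cmod (f w - f z - (w - z) * d) <= K * cmod (w - z) ^+ 2.

Lemma qdiff_cdifferentiable f z : qdiff f z -> cdifferentiable_at f z.
Proof.
move=> [d [e0 e00 [K K0 hK]]]; exists d => e e_gt0.
exists (Num.min e0 (e / (K + 1))); first by rewrite lt_min e00 divr_gt0 //; lra.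
move=> w /andP[wz0]; rewrite lt_min => /andP[we we2].
have wzn : w - z != 0 by rewrite -cmod_gt0.
have -> : (f w - f z) / (w - z) - d = (f w - f z - (w - z) * d) / (w - z).
  by field.
rewrite cmodM cmodV ltr_pdivrMr //.
apply: le_lt_trans (hK w we) _.
rewrite expr2 mulrA ltr_pM2r //.
apply: le_lt_trans (_ : (K + 1) * cmod (w - z) - cmod (w - z) < _); first by lra.
by move: we2; rewrite ltr_pdivlMr 1?mulrC; lra.
Qed.

Lemma qdiff_ext f g z : UHP z -> (forall w, UHP w -> f w = g w) ->
  qdiff f z -> qdiff g z.
Proof.
move=> hz fg [d [e0 e00 [K K0 hK]]]; exists d, (Num.min e0 (cim z)).
  by rewrite lt_min e00.
exists K => // w; rewrite lt_min => /andP[h1 h2].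
by rewrite -!fg ?hK //; exact: UHP_near h2.
Qed.

Lemma qdiff_shift c f z : qdiff f z -> qdiff (fun w => c + f w) z.
Proof.
move=> [d [e0 e00 [K K0 hK]]]; exists d, e0 => //; exists K => // w hw.
have -> : c + f w - (c + f z) - (w - z) * d = f w - f z - (w - z) * d by ring.
exact: hK.
Qed.

Lemma qdiff_cexp f z : qdiff f z -> qdiff (fun w => cexp (f w)) z.
Proof.
move=> [d [e0 e00 [K K0 hK]]].
set L := cmod d + K; have L0 : 0 <= L by rewrite addr_ge0 // cmod_ge0.
exists (d * cexp (f z)).
(* [L] is a Lipschitz constant of [f] at [z] on this disc, where K m^2 <= K m because m < 1; the
   last radius forces [cmod u <= 1 / 2], the range of [cexp_expand]. *)
exists (Num.min e0 (Num.min 1 (1 / (2 * (L + 1))))).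
  by rewrite !lt_min e00 ltr01 divr_gt0 //; lra.
exists (cmod (cexp (f z)) * (10 * L ^+ 2 + K)).
  by rewrite mulr_ge0 ?cmod_ge0 // addr_ge0 // mulr_ge0 // sqr_ge0.
move=> w; rewrite !lt_min => /and3P[h1 h2 h3].
set u := f w - f z; set h := w - z in h1 h2 h3 *; set m := cmod h in h1 h2 h3 *.
have m0 : 0 <= m by exact: cmod_ge0.
have hu1 : cmod (u - h * d) <= K * m ^+ 2 by exact: hK.
have hu : cmod u <= L * m.
  have -> : u = h * d + (u - h * d) by ring.
  apply: le_trans (cmodD _ _) _; rewrite cmodM -/m.
  have : K * m ^+ 2 <= K * m by rewrite ler_wpM2l // expr2 ler_piMl // ltW.
  have -> : L * m = m * cmod d + K * m by rewrite /L; ring.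
  by lra.
have hu2 : cmod u <= 1 / 2.
  apply: le_trans hu _; move: h3; rewrite ltr_pdivlMr; last lra.
  have : 0 <= L * m by rewrite mulr_ge0.
  have -> : m * (2 * (L + 1)) = 2 * (L * m) + 2 * m by ring.
  by lra.
have -> : cexp (f w) - cexp (f z) - h * (d * cexp (f z)) =
    cexp (f z) * ((cexp u - 1 - u) + (u - h * d)).
  have -> : cexp (f w) = cexp (f z) * cexp u by rewrite -cexpD /u addrC subrK.
  by ring.
rewrite cmodM -mulrA ler_wpM2l ?cmod_ge0 //.
apply: le_trans (cmodD _ _) _; rewrite [leRHS]mulrDl lerD //.
apply: le_trans (cexp_expand hu2) _.
by rewrite -mulrA ler_pM2l // -exprMn lerXn2r // nnegrE ?cmod_ge0 ?mulr_ge0.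
Qed.

End QuadraticDifferentiability.

(** * Potentials of bounded densities *)

Section NevanlinnaPotential.
Context {R : realType}.
Local Notation T := (measurableTypeR R).
Implicit Types (xi : T -> R) (z w : R[i]).

Lemma cbmf_bound (g : T -> R[i]) : cbmf g -> exists2 M, 0 <= M & forall t, cmod (g t) <= M.
Proof.
move=> [[_ [M hM]] [_ [N hN]]]; exists (M + N).
  by have := hM 0; have := hN 0; have := normr_ge0 (cre (g 0)); have := normr_ge0 (cim (g 0)); lra.
by move=> t; apply: le_trans (cmod_le_reim _) _; rewrite lerD.
Qed.

Variable mu : {finite_measure set T -> \bar R}.

Definition npot xi z : R[i] := cintegral mu setT (fun t => nkernel z t * rC (xi t)).

Lemma cbmf_npot xi z : bmf xi -> UHP z -> cbmf (fun t => nkernel z t * rC (xi t)).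
Proof. by move=> hx hz; apply: cbmfM; [exact: cbmf_nkernel | exact: cbmf_rC]. Qed.

(** The kernel has derivative (1+t^2)/(t-z)^2 in z, and the remainder of its expansion is exactly
    (w-z)^2 (1+t^2)/((t-z)^2 (t-w)), so differentiation under the integral sign needs one uniform
    bound on this quotient. *)
Lemma npot_qdiff xi z : bmf xi -> UHP z -> qdiff (npot xi) z.
Proof.
move=> hx hz.
(* This is (t-i)(t+i)/(t-z)^2; each factor (t -+ i)/(t-z) equals 1 + (z -+ i)/(t-z), which shows
   boundedness although 1 + t^2 is unbounded. *)
pose S (t : T) : R[i] := (1 + (z - iC) * (rC t - z)^-1) * (1 + (z + iC) * (rC t - z)^-1).
have i2 : iC ^+ 2 = -1 :> R[i].
  by apply: complex_eqP; rewrite expr2 !creimE /cre /cim /=; ring.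
have SE t : S t = (1 + rC t ^+ 2) / (rC t - z) ^+ 2.
  have tz := UHP_neq_real t hz.
  have -> : S t = (rC t ^+ 2 - iC ^+ 2) / (rC t - z) ^+ 2 by rewrite /S; field.
  by rewrite i2 opprK addrC.
have cS : cbmf S.
  have hr := cbmf_resolvent hz.
  by apply: cbmfM; apply: cbmfD; try exact: cbmf_cst; apply: cbmfM => //; exact: cbmf_cst.
pose G (t : T) := S t * rC (xi t).
have cG : cbmf G by apply: cbmfM => //; exact: cbmf_rC.
have [M M0 hM] := cbmf_bound cG.
have y0 : 0 < cim z by [].
(* On the disc of radius Im z / 2 one has Im w > Im z / 2, hence 1/|t-w| <= 2/Im z. *)
exists (cintegral mu setT G), (cim z / 2); first by rewrite divr_gt0.
exists (2 * (M * (2 / cim z)) * fine (mu setT)).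
  by rewrite !mulr_ge0 ?mass_ge0 // invr_ge0 ltW.
move=> w hw; have wy := UHP_near2 hz hw.
have hwu : UHP w by rewrite /UHP; lra.
pose Q (t : T) := G t * (rC t - w)^-1.
have cQ : cbmf Q by apply: cbmfM => //; exact: cbmf_resolvent.
have -> : npot xi w - npot xi z - (w - z) * cintegral mu setT G =
   (w - z) ^+ 2 * cintegral mu setT Q.
  rewrite /npot -cintegralB; try exact: cbmf_npot.
  rewrite -!cintegralZ // -cintegralB; [|by apply: cbmfD; [|apply: cbmfN]; exact: cbmf_npot|by apply: cbmfM => //; exact: cbmf_cst].
  apply: eq_cintegral => t _; rewrite /Q /G SE /nkernel; field.
  by rewrite !UHP_neq_real.
rewrite cmodM cmodX mulrC ler_wpM2r ?sqr_ge0 //.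
apply: cmod_cintegral => // t; rewrite cmodM ler_pM ?cmod_ge0 //.
rewrite cmodV -[2 / cim z]invf_div lef_pV2 ?posrE ?divr_gt0 ?cmod_gt0 ?UHP_neq_real //.
by apply: le_trans (cim_le_dist w t); rewrite ger0_norm; lra.
Qed.

Lemma npotD xi1 xi2 z : bmf xi1 -> bmf xi2 -> UHP z ->
  npot (fun t => xi1 t + xi2 t) z = npot xi1 z + npot xi2 z.
Proof.
move=> h1 h2 hz; rewrite /npot -cintegralD; try exact: cbmf_npot.
by apply: eq_cintegral => t _; rewrite rCD mulrDr.
Qed.

Lemma npotB xi1 xi2 z : bmf xi1 -> bmf xi2 -> UHP z ->
  npot (fun t => xi1 t - xi2 t) z = npot xi1 z - npot xi2 z.
Proof.
move=> h1 h2 hz; rewrite /npot -cintegralB; try exact: cbmf_npot.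
by apply: eq_cintegral => t _; rewrite rCB mulrBr.
Qed.

Lemma npotZ c xi z : bmf xi -> UHP z ->
  npot (fun t => c * xi t) z = rC c * npot xi z.
Proof.
move=> h1 hz; rewrite /npot -cintegralZ; try exact: cbmf_npot.
by apply: eq_cintegral => t _; rewrite rCM mulrCA.
Qed.

Lemma cim_npot_le xi1 xi2 z : bmf xi1 -> bmf xi2 -> UHP z ->
  (forall t, xi1 t <= xi2 t) -> cim (npot xi1 z) <= cim (npot xi2 z).
Proof.
move=> h1 h2 hz le12.
apply: bmf_le_integral; [by case: (cbmf_npot h1 hz)|by case: (cbmf_npot h2 hz)|].
move=> t; rewrite !(mulrC (nkernel z t)) !cim_rCM ler_wpM2r //.
exact/ltW/cim_nkernel_gt0.
Qed.

Lemma npot_i xi : bmf xi -> cre (npot xi iC) = 0.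
Proof.
move=> hx; rewrite /npot cre_cintegral.
under eq_Rintegral do rewrite nkernel_i mulrC cre_rCM mulr0.
by rewrite integral_cstT mul0r.
Qed.

End NevanlinnaPotential.

(** * The measure dt/(1+t^2) *)

Section CauchyMeasure.
Variable R : realType.
Local Notation leb := (@lebesgue_measure R).

Definition cauchym (A : set (measurableTypeR R)) : \bar R :=
  (\int[leb]_(t in A) (oneDsqr t)^-1%:E)%E.


Let w_cont : continuous (fun t : R => (oneDsqr t)^-1).
Proof. by move=> t; exact: (@continuous_oneDsqrV R t). Qed.

Let w_meas : measurable_fun setT (fun t : R => (oneDsqr t)^-1).
Proof. by apply: continuous_measurable_fun; exact: w_cont. Qed.

Lemma cauchym_setT : cauchym setT = (pi : R)%:E.
Proof.
rewrite /cauchym ge0_symfun_integralT //.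
- by rewrite -set_itvcy integral0y_oneDsqr -EFinM; congr EFin; field.
- by move=> t /=; rewrite /oneDsqr sqrrN.
Qed.

Lemma integrable_oneDsqrV : leb.-integrable setT (fun t => (oneDsqr t)^-1%:E).
Proof.
apply/integrableP; split; first exact/measurable_EFinP.
under eq_integral do rewrite gee0_abs ?lee_fin //.
by have := cauchym_setT; rewrite /cauchym => ->; rewrite ltry.
Qed.

Let cauchym0 : cauchym set0 = 0%E.
Proof. by rewrite /cauchym integral_set0. Qed.

Let cauchym_ge0 A : (0 <= cauchym A)%E.
Proof. by apply: integral_ge0 => t _; rewrite lee_fin. Qed.

Let cauchym_sigma_additive : semi_sigma_additive cauchym.
Proof.
move=> /= A mA tA mUA.
rewrite /cauchym /= integral_bigcup //=; last first.
  by apply: (integrableS _ _ (subsetT _)) => //; exact: integrable_oneDsqrV.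
apply: is_cvg_ereal_nneg_natsum_cond => n _ _.
by apply: integral_ge0 => /= t _; rewrite lee_fin.
Qed.

HB.instance Definition _ := isMeasure.Build _ _ _
  cauchym cauchym0 cauchym_ge0 cauchym_sigma_additive.

Let cauchym_fin : fin_num_fun cauchym.
Proof.
apply: lty_fin_num_fun; rewrite [X in (X < _)%E](_ : _ = cauchym setT) //.
by rewrite cauchym_setT ltry.
Qed.

HB.instance Definition _ := @Measure_isFinite.Build _ _ _ cauchym cauchym_fin.

Lemma cauchym_dominates : cauchym `<< leb.
Proof.
apply/null_content_dominatesP => A mA A0; rewrite /cauchym.
apply: null_set_integral => //.
by apply: measurable_funTS; exact/measurable_EFinP.
Qed.

(** Change of variables holds for the Radon-Nikodym derivative of [cauchym], which agrees almost
    everywhere with 1/(1+t^2) since both have the same integral over every measurable set. *)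
Lemma integral_cauchym (f : measurableTypeR R -> R) : bmf f ->
  \int[cauchym]_t f t = \int[leb]_t (f t * (oneDsqr t)^-1).
Proof.
move=> hf; rewrite /Rintegral; congr fine.
rewrite -(Radon_Nikodym_change_of_variables cauchym_dominates) //=; last first.
  exact: (@bmf_integrable _ _ _ cauchym).
apply: ae_eq_integral => //.
- apply: emeasurable_funM => //; first by apply/measurable_EFinP; case: hf.
  apply: (measurable_int leb); apply: Radon_Nikodym_integrable.
  exact: cauchym_dominates.
- by apply/measurable_EFinP; apply: measurable_funM => //; case: hf.
- under [X in ae_eq _ _ _ X]eq_fun do rewrite EFinM.
  apply: ae_eqe_mul2l => /=.
  rewrite Radon_NikodymE//=; first exact: cauchym_dominates.
  move=> abmu; case: cid => /= h [h1 h2 h3].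
  apply: integral_ae_eq => //=.
  + exact/measurable_EFinP.
  + by move=> E _ mE; rewrite -h3.
Qed.

End CauchyMeasure.

(** * Dominated convergence for uniformly bounded sequences *)

Section Dominated.
Context d (T : measurableType d) (R : realType).
Variable mu : {finite_measure set T -> \bar R}.

Lemma bmf_dominated (f_ : nat -> T -> R) (f : T -> R) (M : R) :
  (forall n, bmf (f_ n)) -> bmf f -> (forall n t, `|f_ n t| <= M) ->
  (forall t, f_ n t @[n --> \oo] --> f t) ->
  \int[mu]_t f_ n t @[n --> \oo] --> \int[mu]_t f t.
Proof.
move=> hf_ hf fM cf; apply: fine_cvg.
rewrite -[X in _ --> X]/(fine _)%:E fineK; last first.
  by apply: integrable_fin_num => //; exact: bmf_integrable.
apply: (@dominated_cvg _ _ _ mu setT measurableT (fun n => EFin \o f_ n) (EFin \o f) (cst M%:E)) => //.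
- by move=> n; apply/measurable_EFinP; case: (hf_ n).
- by move=> t _; apply: cvg_EFin; [exact: nearW | exact: cf].
- by apply: bmf_integrable => //; exact: bmf_cst.
- by move=> n t _; rewrite /= lee_fin.
Qed.

End Dominated.

(** * Potentials of half-lines and of the whole line in closed form *)

Section HalfLines.
Context {R : realType}.
Local Notation leb := (@lebesgue_measure R).

Lemma cauchym_FTC (g F : R -> R) (a b : R) : a < b -> continuous g -> bmf g ->
  (forall t : R, is_derive t 1 F (g t * (oneDsqr t)^-1)) ->
  \int[@cauchym R]_t (g t * \1_`[a, b] t) = F b - F a.
Proof.
move=> ab cg bg dF.
have cF : continuous F.
  by move=> t; apply/differentiable_continuous/derivable1_diffP; exact: ex_derive.
rewrite integral_cauchym; last by apply: bmfM => //; exact: bmf_indic.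
transitivity (\int[leb]_(t in `[a, b]) (g t * (oneDsqr t)^-1)).
  rewrite [RHS]Rintegral_mkcond; apply: eq_Rintegral => t _.
  by rewrite patchE indicE; case: ifP => _; rewrite ?mulr1 // mulr0 mul0r.
rewrite /Rintegral (continuous_FTC2 ab (F := F)) //.
- apply: continuous_subspaceT => t; apply: cvgM; first exact: cg.
  exact: (@continuous_oneDsqrV R t).
- split.
  + by move=> t _; exact: ex_derive.
  + by apply: cvg_at_right_filter; exact: cF.
  + by apply: cvg_at_left_filter; exact: cF.
- by move=> t _; rewrite derive1E; exact: derive_val.
Qed.

(** Improper version of the fundamental theorem: the compact intervals eventually decide membership
    in [D] correctly at each point, so dominated convergence applies to their indicators. *)
Lemma cauchym_FTC_lim (g F : R -> R) (a_ b_ : nat -> R) (D : set R) (l l' : R) :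
  continuous g -> bmf g -> measurable D ->
  (forall t : R, is_derive t 1 F (g t * (oneDsqr t)^-1)) ->
  (\forall n \near \oo, a_ n < b_ n) ->
  (forall t, \forall n \near \oo, `[a_ n, b_ n]%classic t <-> D t) ->
  F (a_ n) @[n --> \oo] --> l -> F (b_ n) @[n --> \oo] --> l' ->
  \int[@cauchym R]_t (g t * \1_D t) = l' - l.
Proof.
move=> cg bg mD dF ab hD Fa Fb.
have [_ [M hM]] := bg.
have h1 : \int[@cauchym R]_t (g t * \1_`[a_ n, b_ n] t) @[n --> \oo] -->
    \int[@cauchym R]_t (g t * \1_D t).
  apply: (@bmf_dominated _ _ _ _ _ _ M).
  - by move=> n; apply: bmfM => //; exact: bmf_indic.
  - by apply: bmfM => //; exact: bmf_indic.
  - move=> n t; rewrite normrM (le_trans _ (hM t)) // ler_piMr // indicE.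
    by case: (_ \in _); rewrite ?normr1 ?normr0.
  - move=> t; apply: cvg_near_cst; near=> n.
    have hn : `[a_ n, b_ n]%classic t <-> D t by near: n; exact: hD.
    rewrite !indicE (_ : (t \in `[a_ n, b_ n]%classic) = (t \in D)) //.
    by apply/idP/idP; rewrite !inE => /hn.
have h2 : \int[@cauchym R]_t (g t * \1_`[a_ n, b_ n] t) @[n --> \oo] --> l' - l.
  have h3 : (F (b_ n) - F (a_ n)) @[n --> \oo] --> l' - l by exact: cvgB.
  apply: cvg_trans h3; apply: near_eq_cvg; near=> n.
  by rewrite (cauchym_FTC (F := F)) //; near: n.
by apply: cvg_unique h1 h2.
Unshelve. all: by end_near. Qed.

Variable z : R[i].
Hypothesis hz : UHP z.
Local Notation x := (cre z).
Local Notation y := (cim z).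

Let y0 : 0 < y. Proof. exact: hz. Qed.

Let q (t : R) := (t - x) ^+ 2 + y ^+ 2.

Let q_gt0 t : 0 < q t.
Proof. by rewrite /q ltr_wpDl ?sqr_ge0 // exprn_gt0. Qed.

Let w_gt0 (t : R) : 0 < oneDsqr t.
Proof. by rewrite (lt_le_trans ltr01) // oneDsqr_ge1. Qed.

Let is_derive_q (t : R) : is_derive t 1 q (2 * (t - x)).
Proof.
have -> : q = (fun t => (t - x) ^+ 2) + cst (y ^+ 2) by apply/funext.
have -> : (fun t : R => (t - x) ^+ 2) = (id - cst x) ^+ 2 by apply/funext.
apply: is_derive_eq; rewrite /= !addr0 subr0.
by rewrite /GRing.scale /= fctE /= expr1 mulr1.
Qed.

Let is_derive_w (t : R) : is_derive t 1 (@oneDsqr R) (2 * t).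
Proof.
have -> : @oneDsqr R = cst 1 + id ^+ 2 by apply/funext.
apply: is_derive_eq; rewrite /= add0r.
by rewrite /GRing.scale /= expr1 mulr1.
Qed.

(** Antiderivatives of the real and imaginary parts of n(z,t)/(1+t^2): [reprim t] is
    ln(|t-z|/|t-i|), and [improm t + pi/2] is the argument of z - t in (0, pi). *)
Definition reprim (t : R) : R := (ln ((t - x) ^+ 2 + y ^+ 2) - ln (oneDsqr t)) / 2.
Definition improm (t : R) : R := atan ((t - x) / y).

Let cre_nkernelE t : cre (nkernel z t) = ((t - x) * oneDsqr t - t * q t) / q t.
Proof.
have := lt0r_neq0 (q_gt0 t); rewrite /q => q0.
by rewrite /nkernel /oneDsqr /q !creimE; field.
Qed.

Lemma continuous_nkernel : continuous (fun t => cre (nkernel z t)) /\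
  continuous (fun t => cim (nkernel z t)).
Proof.
have cq : continuous q.
  by move=> t; apply/differentiable_continuous/derivable1_diffP; exact: ex_derive.
have cw : continuous (@oneDsqr R) by exact: continuous_oneDsqr.
have cV t : (q s)^-1 @[s --> t] --> (q t)^-1.
  by apply: cvgV; [rewrite gt_eqF | exact: cq].
split=> t.
  rewrite /continuous_at cre_nkernelE; under eq_cvg do rewrite cre_nkernelE.
  apply: cvgM; last exact: cV.
  apply: cvgB; apply: cvgM; [|exact: cw|exact: cvg_id|exact: cq].
  by apply: cvgB; [exact: cvg_id | exact: cvg_cst].
rewrite /continuous_at cim_nkernel //; under eq_cvg do rewrite cim_nkernel //.
apply: cvgM; last exact: cV.
by apply: cvgM; [exact: cvg_cst | exact: cw].
Qed.

Let is_derive_reprim (t : R) :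
  is_derive t 1 reprim (cre (nkernel z t) * (oneDsqr t)^-1).
Proof.
have d1 := is_derive1_comp (is_derive1_ln (q_gt0 t)) (is_derive_q t).
have d2 := is_derive1_comp (is_derive1_ln (w_gt0 t)) (is_derive_w t).
have -> : reprim = 2^-1 \*: ((@ln R \o q) - (@ln R \o @oneDsqr R)).
  by apply/funext => s; rewrite /reprim mulrC.
apply: is_derive_eq.
rewrite cre_nkernelE /GRing.scale /=; field.
by rewrite !lt0r_neq0.
Qed.

Let is_derive_improm (t : R) :
  is_derive t 1 improm (cim (nkernel z t) * (oneDsqr t)^-1).
Proof.
have d0 : is_derive t 1 (y^-1 \*: (id - cst x)) y^-1.
  by apply: is_derive_eq; rewrite /GRing.scale /= subr0 mulr1.
have d1 := is_derive1_comp (is_derive1_atan _) d0.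
have -> : improm = atan \o (y^-1 \*: (id - cst x)).
  by apply/funext => s; rewrite /improm /= mulrC.
apply: is_derive_eq.
have := q_gt0 t; have := w_gt0 t; rewrite cim_nkernel // /oneDsqr /q => h1 h2.
rewrite /= /GRing.scale /= !fctE; field.
by rewrite !gt_eqF //= exprMn addrC.
Qed.

(** Right endpoints strictly below [a], so that closed intervals exhaust the open half-line. *)
Let b0 (a : R) (n : nat) := a - n.+1%:R^-1.

Let b0_cvg a : b0 a n @[n --> \oo] --> a.
Proof.
rewrite -[X in _ --> X]subr0; apply: cvgB; first exact: cvg_cst.
exact: cvg_harmonic.
Qed.

Let itv_left (a t : R) : \forall n \near \oo, `[- n%:R, b0 a n]%classic t <-> `]-oo, a[%classic t.
Proof.
have h0 : \forall n \near \oo, - t <= n%:R by exact: nbhs_infty_ger.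
have [ta|ta] := ltP t a.
  have h1 : \forall n \near \oo, t < b0 a n by move/cvgr_gt: (@b0_cvg a) => /(_ _ ta).
  near=> n; rewrite /= !in_itv /= ta; split => // _.
  rewrite lerNl (near h0 n) //=; apply/ltW.
  by near: n.
near=> n; rewrite /= !in_itv /= ltNge ta; split => // /andP[_].
rewrite /b0; have : (0 : R) < n.+1%:R^-1 by rewrite invr_gt0 ltr0n.
by move: (n.+1%:R^-1) => r r0 h; exfalso; lra.
Unshelve. all: by end_near. Qed.

Let itv_all (t : R) : \forall n \near \oo, `[- n%:R, n%:R]%classic t <-> [set: R] t.
Proof.
have h0 : \forall n \near \oo, - t <= n%:R by exact: nbhs_infty_ger.
have h1 : \forall n \near \oo, t <= n%:R by exact: nbhs_infty_ger.
near=> n; rewrite /= in_itv /=; split=> // _.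
by rewrite lerNl (near h0 n) // (near h1 n).
Unshelve. all: by end_near. Qed.

Let cvg_improm_y : improm n%:R @[n --> \oo] --> pi / 2.
Proof.
apply: (cvg_comp (fun n : nat => (n%:R - x) / y)) (cvgy_atan (R := R)).
apply/cvgryPge => A; near=> n.
rewrite ler_pdivlMr // lerBrDr.
by near: n; exact: nbhs_infty_ger.
Unshelve. all: by end_near. Qed.

Let cvg_improm_Ny : improm (- n%:R) @[n --> \oo] --> - (pi / 2).
Proof.
rewrite (_ : (fun n : nat => improm (- n%:R)) = fun n : nat => - atan ((n%:R + x) / y)).
  apply: cvgN.
  apply: (cvg_comp (fun n : nat => (n%:R + x) / y)) (cvgy_atan (R := R)).
  apply/cvgryPge => A; near=> n.
  rewrite ler_pdivlMr // -lerBlDr.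
  by near: n; exact: nbhs_infty_ger.
by apply/funext => n; rewrite /improm -opprD mulNr atanN.
Unshelve. all: by end_near. Qed.

(** The sign [e] treats both ends of the line together: |t-z|/|t-i| tends to 1 at either of them. *)
Let cvg_reprim (e : R) : `|e| = 1 -> reprim (e * n%:R) @[n --> \oo] --> 0.
Proof.
move=> he.
have e2 : e ^+ 2 = 1 by rewrite -real_normK ?num_real // he expr1n.
have -> : (fun n : nat => reprim (e * n%:R)) =
    fun n : nat => ln (q (e * n%:R) / oneDsqr (e * n%:R)) / 2.
  by apply/funext => n; rewrite /reprim ln_div ?posrE.
rewrite -[X in _ --> X](mul0r 2^-1); apply: cvgMr_tmp.
rewrite -[X in _ --> X](ln1 R).
have cl : ln u @[u --> (1 : R)] --> ln 1 by apply: continuous_ln.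
apply: (cvg_comp (fun n : nat => q (e * n%:R) / oneDsqr (e * n%:R))) cl.
(* For n >= 1 the numerator of the difference below is at most C n, against a denominator 1 +
   n^2. *)
pose C := 2 * `|x| + (x ^+ 2 + y ^+ 2 + 1).
apply/cvgrPdist_le => eps eps0; near=> n.
have n1 : (1 : R) <= n%:R by near: n; exact: nbhs_infty_ger.
have nC : C / eps <= n%:R by near: n; exact: nbhs_infty_ger.
have n2 : 0 < 1 + (n%:R : R) ^+ 2 by rewrite ltr_wpDr ?sqr_ge0.
have -> : 1 - q (e * n%:R) / oneDsqr (e * n%:R) =
   (2 * x * e * n%:R + (1 - (x ^+ 2 + y ^+ 2))) / (1 + n%:R ^+ 2).
  have w2 : oneDsqr (e * n%:R) = 1 + n%:R ^+ 2 by rewrite /oneDsqr exprMn e2 mul1r.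
  rewrite w2; apply: (mulIf (lt0r_neq0 n2)); rewrite mulrBl !divfK ?lt0r_neq0 //.
  by rewrite mul1r -w2 /q /oneDsqr; ring.
rewrite normrM normfV (gtr0_norm n2) ler_pdivrMr //.
apply: le_trans (ler_normD _ _) _.
rewrite !normrM he mulr1 !normr_nat.
have l1 : `|1 - (x ^+ 2 + y ^+ 2)| <= (x ^+ 2 + y ^+ 2 + 1).
  by have := sqr_ge0 x; have := sqr_ge0 y; rewrite ler_norml; lra.
have l2 : x ^+ 2 + y ^+ 2 + 1 <= (x ^+ 2 + y ^+ 2 + 1) * n%:R.
  by rewrite ler_peMr // !addr_ge0 ?sqr_ge0.
apply: le_trans (_ : C * n%:R <= _); first by rewrite /C mulrDl; lra.
move: nC; rewrite ler_pdivrMr // => nC.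
apply: le_trans (_ : eps * n%:R ^+ 2 <= _); last by rewrite ler_pM2l //; lra.
by rewrite expr2 mulrA ler_wpM2r //; lra.
Unshelve. all: by end_near. Qed.

(** At minus infinity the two antiderivatives tend to 0 and -pi/2, so the potential is the logarithm
    of (z-a)/|i-a| with argument in (0, pi). *)
Lemma npot_halfline a : npot (@cauchym R) (\1_`]-oo, a[) z =
  Complex (reprim a) (improm a + pi / 2).
Proof.
have [b1 b2] := cbmf_nkernel hz; have [c1 c2] := continuous_nkernel.
have ab : \forall n \near \oo, - n%:R < b0 a n.
  have h1 : \forall n \near \oo, a - 1 < b0 a n.
    by move/cvgr_gt: (@b0_cvg a) => /(_ (a - 1)); apply; lra.
  near=> n; have h2 : 1 - a <= n%:R by near: n; exact: nbhs_infty_ger.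
  have h3 : a - 1 < b0 a n by near: n.
  by lra.
apply: complex_eqP.
  transitivity (\int[@cauchym R]_t (cre (nkernel z t) * \1_`]-oo, a[ t)).
    by apply: eq_Rintegral => t _; rewrite mulrC cre_rCM mulrC.
  rewrite (cauchym_FTC_lim (F := reprim) (l := 0) (l' := reprim a) c1 b1 _ _ ab (itv_left a)) ?subr0 //.
  - by have := @cvg_reprim (-1) (normrN1 _); under eq_fun do rewrite mulN1r.
  - apply: continuous_cvg (@b0_cvg a).
    by apply/differentiable_continuous/derivable1_diffP; exact: ex_derive.
transitivity (\int[@cauchym R]_t (cim (nkernel z t) * \1_`]-oo, a[ t)).
  by apply: eq_Rintegral => t _; rewrite mulrC cim_rCM mulrC.
rewrite (cauchym_FTC_lim (F := improm) (l := - (pi / 2)) (l' := improm a) c2 b2 _ _ ab (itv_left a)) ?opprK //.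
apply: continuous_cvg (@b0_cvg a).
by apply/differentiable_continuous/derivable1_diffP; exact: ex_derive.
Unshelve. all: by end_near. Qed.

Lemma npot_line : npot (@cauchym R) (cst 1) z = Complex 0 pi.
Proof.
have [b1 b2] := cbmf_nkernel hz; have [c1 c2] := continuous_nkernel.
have ab : \forall n \near \oo, - n%:R < (n%:R : R).
  near=> n; have : (1 : R) <= n%:R by near: n; exact: nbhs_infty_ger.
  by lra.
apply: complex_eqP.
  transitivity (\int[@cauchym R]_t (cre (nkernel z t) * \1_setT t)).
    by apply: eq_Rintegral => t _; rewrite mulrC cre_rCM mulrC indicT.
  rewrite (cauchym_FTC_lim (F := reprim) (l := 0) (l' := 0) c1 b1 _ _ ab itv_all) ?subr0 //.
  - by have := @cvg_reprim (-1) (normrN1 _); under eq_fun do rewrite mulN1r.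
  - by have := @cvg_reprim 1 (normr1 _); under eq_fun do rewrite mul1r.
transitivity (\int[@cauchym R]_t (cim (nkernel z t) * \1_setT t)).
  by apply: eq_Rintegral => t _; rewrite mulrC cim_rCM mulrC indicT.
rewrite (cauchym_FTC_lim (F := improm) (l := - (pi / 2)) (l' := pi / 2) c2 b2 _ _ ab itv_all) //.
by rewrite opprK /cim /=; field.
Unshelve. all: by end_near. Qed.

Lemma cexp_halfline a : z - rC a =
  rC (cmod (iC - rC a)) * cexp (npot (@cauchym R) (\1_`]-oo, a[) z).
Proof.
set m := cmod (z - rC a).
have m0 : 0 < m by rewrite /m cmodBC cmod_gt0 UHP_neq_real.
have m2 : m ^+ 2 = q a by rewrite sqr_cmod creB cimB cre_rC cim_rC subr0 /q; ring.
have n2 : cmod (iC - rC a) ^+ 2 = oneDsqr a.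
  by rewrite sqr_cmod creB cimB cre_rC cim_rC /cre /cim /= /oneDsqr; ring.
have n0 : 0 < cmod (iC - rC a).
  by rewrite lt_neqAle cmod_ge0 andbT eq_sym -sqrf_eq0 n2 gt_eqF.
have er : cmod (iC - rC a) * expR (reprim a) = m.
  rewrite /reprim -[(a - x) ^+ 2 + y ^+ 2]m2 -n2 !lnXn //.
  have -> : (ln m *+ 2 - ln (cmod (iC - rC a)) *+ 2) / 2 = ln m - ln (cmod (iC - rC a)).
    by rewrite !mulr2n; field.
  by rewrite expRB !lnK ?posrE // mulrCA divff ?mulr1 // gt_eqF.
have ca : cos (improm a) = y / m.
  rewrite /improm cos_atan.
  have -> : 1 + ((a - x) / y) ^+ 2 = (m / y) ^+ 2.
    by rewrite [RHS]exprMn m2 /q exprVn; field; rewrite gt_eqF.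
  by rewrite sqrtr_sqr ger0_norm ?divr_ge0 ?(ltW m0) ?(ltW y0) // invf_div.
have sa : sin (improm a) = (a - x) / m.
  have c0 : cos (improm a) != 0 by rewrite ca mulf_neq0 ?invr_eq0 ?gt_eqF.
  have := atanK ((a - x) / y); rewrite -/(improm a) /tan => h.
  have -> : sin (improm a) = (sin (improm a) / cos (improm a)) * cos (improm a).
    by rewrite divfK.
  by rewrite h ca; field; rewrite !gt_eqF.
rewrite npot_halfline; apply: complex_eqP.
  rewrite cre_rCM -[cre (cexp _)]/(expR (reprim a) * cos (improm a + pi / 2)).
  by rewrite mulrA er cosDpihalf sa creB cre_rC; field; rewrite gt_eqF.
rewrite cim_rCM -[cim (cexp _)]/(expR (reprim a) * sin (improm a + pi / 2)).
by rewrite mulrA er sinDpihalf ca cimB cim_rC; field; rewrite gt_eqF.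
Qed.

End HalfLines.

(** * Connected components of open subsets of the extended line *)

Section Components.
Context {R : realType}.
Implicit Types (O : set (option R)) (t a b s : R) (l r : option R).

(** The infimum of the missing points is itself missing: if it lay in [O], a neighbourhood of it
    would too. *)
Lemma first_missing O (lo : R) : ext_open O ->
  (exists2 s, lo <= s & ~ O (Some s)) ->
  exists b, [/\ lo <= b, ~ O (Some b) & forall s, lo <= s < b -> O (Some s)].
Proof.
move=> [Oo _] [s0 los0 nOs0].
pose A := [set s : R | lo <= s /\ ~ O (Some s)].
have hA : has_inf A by split; [exists s0 | exists lo => s []].
have loA : lo <= inf A by apply: lb_le_inf; [exists s0 | move=> s []].
exists (inf A); split => //.
- move=> /Oo [e e0 he].
  have [s [los nOs] sA] := inf_adherent e0 hA.
  apply/nOs/he; have : inf A <= s by apply: ge_inf => //; exact: hA.2.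
  by move=> h; rewrite ger0_norm; lra.
- move=> s /andP[los sA]; apply: contrapT => nOs.
  have : inf A <= s by apply: ge_inf => //; exact: hA.2.
  by rewrite leNgt sA.
Qed.

(* [r] is the first point outside [O] met when moving right from [t],
   possibly after passing through [oo]. *)
Definition rend O t r : Prop := ~ O r /\
  match r with
  | None => forall s, t <= s -> O (Some s)
  | Some b => (t < b /\ forall s, t <= s < b -> O (Some s)) \/
      [/\ b < t, O None, forall s, t <= s -> O (Some s) &
          forall s, s < b -> O (Some s)]
  end.

Definition lend O t l : Prop := ~ O l /\
  match l with
  | None => forall s, s <= t -> O (Some s)
  | Some a => (a < t /\ forall s, a < s <= t -> O (Some s)) \/
      [/\ t < a, O None, forall s, s <= t -> O (Some s) &
          forall s, a < s -> O (Some s)]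
  end.

(** Of two different candidates, the one met earlier on the way from [t] would have to lie in
    [O]. *)
Lemma rend_uniq O t r r' : rend O t r -> rend O t r' -> r = r'.
Proof.
case: r => [b|] [n1 h1]; case: r' => [b'|] [n2 h2] //.
- congr Some; apply/eqP; rewrite eq_le !leNgt; apply/andP; split; apply/negP => bb.
    case: h1 => [[tb h]|[bt ON h h']]; last first.
      case: h2 => [[tb' h2]|[bt' _ _ h2]]; last by apply: n2; apply: h'.
      by apply: n2; apply: h; lra.
    case: h2 => [[tb' h2]|[bt' _ h2 _]]; last by apply: n1; apply: h2; lra.
    by apply: n2; apply: h; lra.
  case: h2 => [[tb h]|[bt ON h h']]; last first.
    case: h1 => [[tb' h1]|[bt' _ _ h1]]; last by apply: n1; apply: h'.
    by apply: n1; apply: h; lra.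
  case: h1 => [[tb' h1]|[bt' _ h1 _]]; last by apply: n2; apply: h1; lra.
  by apply: n1; apply: h; lra.
- exfalso; case: h1 => [[tb _]|[_ ON _ _]]; last exact: n2.
  by apply: n1; apply: h2; lra.
- exfalso; case: h2 => [[tb _]|[_ ON _ _]]; last exact: n1.
  by apply: n2; apply: h1; lra.
Qed.

Lemma rend_ex O t : ext_open O -> O (Some t) -> O <> setT -> exists r, rend O t r.
Proof.
move=> Oo Ot OT.
have [h|h] := pselect (exists2 s, t <= s & ~ O (Some s)).
  have [b [tb nOb hb]] := first_missing Oo h.
  exists (Some b); split => //; left; split => //.
  by rewrite lt_neqAle tb andbT; apply: contra_notN nOb => /eqP <-.
have ht s : t <= s -> O (Some s) by move=> ts; apply: contrapT => n; apply: h; exists s.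
have [ON|nON] := pselect (O None); last by exists None.
have [M hM] := Oo.2 ON.
have [s0 nOs0] : exists s, ~ O (Some s).
  apply: contrapT => n; apply: OT; apply/seteqP; split => // -[s|] _ //.
  by apply: contrapT => n'; apply: n; exists s.
have hs0 s : ~ O (Some s) -> `|s| <= M.
  by move=> nO; rewrite leNgt; apply/negP => /hM.
have Ms0 : - `|M| <= s0.
  by have := hs0 _ nOs0; rewrite ler_norml => /andP[h1 _]; apply: le_trans h1; rewrite lerN2 ler_norm.
(* Everything from [t] to the right, and infinity, lies in [O]: the search restarts at [- |M|], to
   the left of which openness at infinity leaves no missing point. *)
have [b [_ nOb hb]] := first_missing Oo (ex_intro2 _ _ s0 Ms0 nOs0).
exists (Some b); split => //; right; split => //.
  by rewrite ltNge; apply: contra_notN nOb => /ht.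
move=> s sb; have [sM|sM] := ltP s (- `|M|); last by apply: hb; rewrite sM.
apply: hM; apply: le_lt_trans (ler_norm M) _.
by have := ler_norm (- s); rewrite normrN; lra.
Qed.

(** The reflection t -> -t exchanges left and right ends, which transfers existence and uniqueness
    from one to the other. *)
Definition orefl O : set (option R) := fun x => O (omap (fun t => - t) x).

Lemma ext_open_orefl O : ext_open O -> ext_open (orefl O).
Proof.
move=> [h1 h2]; split.
  move=> t /h1 [e e0 he]; exists e => // s st; apply: he.
  by rewrite -opprD normrN.
by move=> /h2 [M hM]; exists M => s sM; apply: hM; rewrite normrN.
Qed.

Lemma lend_orefl O t l : lend O t l <-> rend (orefl O) (- t) (omap (fun t => - t) l).
Proof.
rewrite /lend /rend /orefl.
case: l => [a|] /=; rewrite ?opprK; split=> -[n h]; split => //.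
- case: h => [[h1 h2]|[h1 h2 h3 h4]]; [left|right]; split => //; try lra.
  + by move=> s hs; apply: h2; lra.
  + by move=> s hs; apply: h3; lra.
  + by move=> s hs; apply: h4; lra.
- case: h => [[h1 h2]|[h1 h2 h3 h4]]; [left|right]; split => //; try lra.
  + by move=> s hs; rewrite -(opprK s); apply: h2; lra.
  + by move=> s hs; rewrite -(opprK s); apply: h3; lra.
  + by move=> s hs; rewrite -(opprK s); apply: h4; lra.
- by move=> s hs; apply: h; lra.
- by move=> s hs; rewrite -(opprK s); apply: h; lra.
Qed.

Lemma lend_uniq O t l l' : lend O t l -> lend O t l' -> l = l'.
Proof.
move=> /lend_orefl h /lend_orefl /(rend_uniq h).
by case: l {h} => [a|]; case: l' => [a'|] //= [] /oppr_inj ->.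
Qed.

Lemma lend_ex O t : ext_open O -> O (Some t) -> O <> setT -> exists l, lend O t l.
Proof.
move=> Oo Ot OT.
have [||r hr] := @rend_ex (orefl O) (- t) (ext_open_orefl Oo).
- by rewrite /orefl /= opprK.
- move=> h; apply: OT; apply/seteqP; split => // x _.
  have : orefl O (omap (fun t => - t) x) by rewrite h.
  by rewrite /orefl; case: x => //= s; rewrite opprK.
exists (omap (fun t => - t) r); apply/lend_orefl.
by case: r hr => //= b; rewrite opprK.
Qed.

(** Existence and uniqueness of the component through [t] reduce to those of its two ends. The ends
    cannot both be reached through infinity, for then everything on either side of [t] would lie in
    [O], the ends included. *)
Lemma component_ends O t l r :
  (component O (Some (l, r)) /\ Defs.arc l r (Some t)) <-> (lend O t l /\ rend O t r).
Proof.
rewrite /component /lend /rend /Defs.arc; split.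
  move=> [[nl [nr sub]]]; case: l nl sub => [a|] nl; case: r nr => [b|] nr /=.
  - case: ifPn => [ab sub [_ [<-] /andP[h1 h2]]|].
      split; split => //; left; split => //.
        by move=> s hs; apply: sub; exists s => //; lra.
      by move=> s hs; apply: sub; exists s => //; lra.
    rewrite -leNgt => ba sub [//|[_ [<-] []]] ht; split; split => //.
    + by left; split => // s hs; apply: sub; right; exists s => //; left; lra.
    + right; split; [lra | by apply: sub; left | |] => s hs; apply: sub; right; exists s => //.
        by left; lra.
      by right.
    + right; split; [lra | by apply: sub; left | |] => s hs; apply: sub; right; exists s => //.
        by right; lra.
      by left.
    + by left; split => // s hs; apply: sub; right; exists s => //; right; lra.
  - move=> sub [_ [<-] ht]; split; split => //.
      by left; split => // s hs; apply: sub; exists s => //; lra.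
    by move=> s hs; apply: sub; exists s => //; lra.
  - move=> sub [_ [<-] ht]; split; split => //.
      by move=> s hs; apply: sub; exists s => //; lra.
    by left; split => // s hs; apply: sub; exists s => //; lra.
  - by move=> sub _; split; split => // s _; apply: sub; exists s.
move=> [[nl hl] [nr hr]].
have Ot : O (Some t).
  case: l nl hl => [a|] nl; last by apply.
  by case=> [[h1 h2]|[h1 h2 h3 h4]]; [apply: h2; lra | apply: h3].
case: l nl hl => [a|] nl hl; case: r nr hr => [b|] nr hr /=.
- case: hl => [[at_ hl]|[ta ON hl hl']]; case: hr => [[tb hr]|[bt ON' hr hr']].
  + have ab : a < b by lra.
    rewrite /Defs.arc ab; split; last by exists t => //; lra.
    split=> //; split=> // _ [s -> hs].
    by have [st|st] := leP s t; [apply: hl | apply: hr]; lra.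
  + have ba : b <= a by rewrite leNgt; apply/negP => /hr'.
    rewrite /Defs.arc ltNge ba /=; split; last by right; exists t => //; left.
    split=> //; split=> // _ [->//|[s -> [hs|hs]]]; last exact: hr'.
    by have [st|st] := leP s t; [apply: hl | apply: hr]; lra.
  + have ba : b <= a by rewrite leNgt; apply/negP => ab; apply: nl; apply: hr; lra.
    rewrite /Defs.arc ltNge ba /=; split; last by right; exists t => //; right.
    split=> //; split=> // _ [->//|[s -> [hs|hs]]]; first exact: hl'.
    by have [st|st] := leP s t; [apply: hl | apply: hr]; lra.
  + by exfalso; apply: nl; apply: hr; lra.
- case: hl => [[at_ hl]|[ta ON hl hl']] //.
  split; last by exists t.
  split=> //; split=> // _ [s -> hs].
  by have [st|st] := leP s t; [apply: hl | apply: hr]; lra.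
- case: hr => [[tb hr]|[bt ON' hr hr']] //.
  split; last by exists t.
  split=> //; split=> // _ [s -> hs].
  by have [st|st] := leP s t; [apply: hl | apply: hr]; lra.
- split; last by exists t.
  split=> //; split=> // _ [s ->].
  by have [st|/ltW st] := leP s t; [apply: hl | apply: hr].
Qed.

(** The finite points of an arc; only these enter the integrals. *)
Definition jreal (J : arcdesc R) : set R :=
  if J is Some (l, r) then [set t | Defs.arc l r (Some t)] else setT.

Lemma jreal_sub O J t : component O J -> jreal J t -> O (Some t).
Proof. by case: J => [[l r]|] /=; [move=> [_ [_ h]] /h | move=> ->]. Qed.

Lemma component_uniq O J J' t : component O J -> component O J' ->
  jreal J t -> jreal J' t -> J = J'.
Proof.
case: J => [[l r]|]; case: J' => [[l' r']|] //=.
- move=> h1 h2 t1 t2.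
  have [a1 a2] := (component_ends O t l r).1 (conj h1 t1).
  have [b1 b2] := (component_ends O t l' r').1 (conj h2 t2).
  by rewrite (lend_uniq a1 b1) (rend_uniq a2 b2).
- by move=> [n _] OT; exfalso; apply: n; rewrite OT.
- by move=> OT [n _]; exfalso; apply: n; rewrite OT.
Qed.

Lemma component_ex O t : ext_open O -> O (Some t) ->
  exists2 J, component O J & jreal J t.
Proof.
move=> Oo Ot; have [OT|OT] := pselect (O = setT); first by exists None.
have [l hl] := lend_ex Oo Ot OT; have [r hr] := rend_ex Oo Ot OT.
by have [] := (component_ends O t l r).2 (conj hl hr); exists (Some (l, r)).
Qed.

Lemma jrealE l r : jreal (Some (l, r)) =
  match l, r with
  | Some a, Some b => if a < b then `]a, b[%classic
                      else `]a, +oo[%classic `|` `]-oo, b[%classic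
  | None, Some b => `]-oo, b[%classic
  | Some a, None => `]a, +oo[%classic
  | None, None => setT
  end.
Proof.
apply/seteqP; case: l => [a|]; case: r => [b|]; rewrite /jreal /Defs.arc; try case: ifPn => _;
 split=> t /=; rewrite ?in_itv /= ?andbT //.
- by move=> [_ [<-]].
- by move=> h; exists t.
- by move=> [//|[_ [<-]]].
- by move=> h; right; exists t.
- by move=> [_ [<-]].
- by move=> h; exists t.
- by move=> [_ [<-]].
- by move=> h; exists t.
- by exists t.
Qed.

Lemma measurable_jreal (J : arcdesc R) : measurable (jreal J).
Proof.
case: J => [[l r]|]; last exact: measurableT.
rewrite jrealE; case: l => [a|]; case: r => [b|] //.
by case: ifP => _ //; exact: measurableU.
Qed.

Lemma open_jreal (J : arcdesc R) : open (jreal J).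
Proof.
case: J => [[l r]|]; last exact: openT.
rewrite jrealE; case: l => [a|]; case: r => [b|]; try exact: interval_open; last exact: openT.
by case: ifP => _; [exact: interval_open | apply: openU; exact: interval_open].
Qed.

End Components.

(** * Krein products as exponentials of potentials *)

Section KreinProduct.
Context {R : realType}.
Local Notation leb := (@lebesgue_measure R).
Local Notation cau := (@cauchym R).
Implicit Types (O : set (option R)) (z : R[i]) (xi : R -> R).

Lemma eq_npot_ae xi1 xi2 z : UHP z -> bmf xi1 -> bmf xi2 ->
  {ae leb, forall t, xi1 t = xi2 t} -> npot cau xi1 z = npot cau xi2 z.
Proof.
move=> hz h1 h2 h12.
have [b1 b2] := cbmf_nkernel hz.
have key (k : R -> R) : bmf k ->
    \int[cau]_t (k t * xi1 t) = \int[cau]_t (k t * xi2 t).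
  move=> bk; have [k1 _] := bmfM bk h1; have [k2 _] := bmfM bk h2.
  have mw : measurable_fun setT (fun t : R => (oneDsqr t)^-1).
    by apply/measurable_EFinP; exact: measurable_int (integrable_oneDsqrV R).
  rewrite !integral_cauchym; try exact: bmfM.
  rewrite /Rintegral; congr fine; apply: ae_eq_integral => //.
  - by apply/measurable_EFinP; apply: measurable_funM.
  - by apply/measurable_EFinP; apply: measurable_funM.
  - by move: h12; apply: negligibleS => t /= h h'; apply: h => _; rewrite h'.
apply: complex_eqP; rewrite /npot ?cre_cintegral ?cim_cintegral.
- under eq_Rintegral do rewrite mulrC cre_rCM mulrC.
  under [RHS]eq_Rintegral do rewrite mulrC cre_rCM mulrC.
  exact: key.
- under eq_Rintegral do rewrite mulrC cim_rCM mulrC.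
  under [RHS]eq_Rintegral do rewrite mulrC cim_rCM mulrC.
  exact: key.
Qed.

Lemma ae_neq (a : R) (P : R -> Prop) : (forall t, t != a -> P t) -> {ae leb, forall t, P t}.
Proof.
move=> h; exists [set a]; split; first exact: measurable_set1.
  exact: lebesgue_measure_set1.
by move=> t /= nP; apply/eqP; apply: contrapT => /negP /h.
Qed.

Lemma cexp_npot_halfline a z : UHP z ->
  cexp (npot cau (\1_`]-oo, a[) z) = (z - rC a) / rC (cmod (iC - rC a)).
Proof.
move=> hz; rewrite (cexp_halfline hz a) mulrAC divff ?mul1r //.
by rewrite rC_eq0 cmod_eq0 -oppr_eq0 opprB UHP_neq_real // /UHP /cim /=.
Qed.

Lemma cmod_i_sub_neq0 a : rC (cmod (iC - rC a)) != 0 :> R[i].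
Proof. by rewrite rC_eq0 cmod_eq0 -oppr_eq0 opprB UHP_neq_real // /UHP /cim /=. Qed.

(** Up to one point the indicator of [J] is a signed sum of indicators of half-lines and the
    constant 1. Half-lines contribute the linear factors and the constant contributes -1. The
    degenerate arcs agree with the whole line almost everywhere, which matches their conventional
    value -1. *)
Lemma pJ_cexp (J : arcdesc R) z : UHP z -> pJ J z = cexp (npot cau (\1_(jreal J)) z).
Proof.
move=> hz.
have b1 : bmf (cst 1 : R -> R) by exact: bmf_cst.
have bh a : bmf (\1_`]-oo, a[ : R -> R) by exact: bmf_indic.
have b0 : bmf (fun _ : R => 0 : R) by exact: bmf_cst.
have bJ : bmf (\1_(jreal J) : R -> R) by apply: bmf_indic; exact: measurable_jreal.
have e1 : cexp (npot cau (cst 1) z) = -1 by rewrite npot_line // cexp_ipi.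
have zn a : z - rC a != 0 by rewrite -oppr_eq0 opprB UHP_neq_real.
have nn := cmod_i_sub_neq0.
have whole : {ae leb, forall t, \1_(jreal J) t = cst 1 t :> R} ->
    cexp (npot cau (\1_(jreal J)) z) = -1.
  by move=> h; rewrite (eq_npot_ae hz _ b1 h).
case: J bJ whole => [[l r]|] bJ whole; last first.
  by rewrite [pJ _ _]/= whole //; apply: aeW => t; rewrite indicT.
have JE := jrealE l r.
case: l r bJ whole JE => [a|] [b|] bJ whole JE; rewrite [pJ _ _]/=.
- case: ifPn => [ab|nab].
    rewrite (@eq_npot_ae _ (fun t => \1_`]-oo, b[ t - \1_`]-oo, a[ t)) //; last 2 first.
    + exact: bmfB.
    + apply: (@ae_neq a) => t ta; rewrite JE ab !indicE !mem_setE !in_itv /=.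
      case: (ltgtP t a) ta => // ta _; last by rewrite subr0.
      by rewrite (lt_trans ta ab) subrr.
    rewrite (npotB cau (bh b) (bh a) hz) cexpD cexpN !cexp_npot_halfline // rCM rCV.
    by field; rewrite !nn zn.
  case: ifPn => [ba|nba].
    rewrite (@eq_npot_ae _ (fun t => (cst 1 t - \1_`]-oo, a[ t) + \1_`]-oo, b[ t)) //; last 2 first.
    + by apply: bmfD => //; exact: bmfB.
    + apply: (@ae_neq a) => t ta; rewrite JE (negbTE nab) !indicE in_setU !mem_setE !in_itv /= andbT.
      case: (ltgtP t a) ta => // ta _; first by rewrite subrr add0r.
      by rewrite [t < b]ltNge (ltW (lt_trans ba ta)) subr0 addr0.
    rewrite (npotD cau (bmfB b1 (bh a)) (bh b) hz) (npotB cau b1 (bh a) hz).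
    rewrite !cexpD cexpN e1 !cexp_npot_halfline // rCM rCV.
    by field; rewrite !nn zn.
  have ab : a = b by apply/eqP; rewrite eq_le !leNgt nab nba.
  rewrite whole //; apply: (@ae_neq a) => t ta.
  rewrite JE (negbTE nab) !indicE in_setU !mem_setE !in_itv /= andbT -ab.
  by case: (ltgtP t a) ta.
- rewrite (@eq_npot_ae _ (fun t => cst 1 t - \1_`]-oo, a[ t)) //; last 2 first.
  + exact: bmfB.
  + apply: (@ae_neq a) => t ta; rewrite JE !indicE !mem_setE !in_itv /= andbT.
    by case: (ltgtP t a) ta => // ta _; rewrite /= ?subrr ?subr0.
  rewrite (npotB cau b1 (bh a) hz) cexpD cexpN e1 cexp_npot_halfline //.
  by field; rewrite nn zn.
- by rewrite JE cexp_npot_halfline.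
- by rewrite whole //; apply: aeW => t; rewrite JE indicT.
Qed.

Lemma cexp_cont (v : R[i]) (e : R) : 0 < e -> exists2 d : R, 0 < d &
  forall u, cmod (u - v) < d -> cmod (cexp u - cexp v) < e.
Proof.
move=> e0; set C := cmod (cexp v).
have C0 : 0 < C by rewrite /C cmod_gt0 cexp_neq0.
(* For m = |u-v| <= 1/2 the expansion gives |e^(u-v) - 1| <= 10 m^2 + m <= 6 m. *)
exists (Num.min (1/2) (e / (6 * C))); first by rewrite lt_min !divr_gt0 // mulr_gt0.
move=> u; rewrite lt_min => /andP[h1 h2].
have -> : cexp u - cexp v = cexp v * ((cexp (u - v) - 1 - (u - v)) + (u - v)).
  by rewrite cexpD cexpN; field; exact: cexp_neq0.
rewrite cmodM -/C.
set m := cmod (u - v) in h1 h2 *.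
have m0 : 0 <= m by exact: cmod_ge0.
apply: le_lt_trans (_ : C * (6 * m) < _); last first.
  by move: h2; rewrite ltr_pdivlMr ?mulr_gt0 // (_ : m * (6 * C) = C * (6 * m)) //; ring.
rewrite ler_pM2l //; apply: le_trans (cmodD _ _) _.
have := cexp_expand (ltW h1); rewrite -/m => h.
have : m ^+ 2 <= m * (1 / 2) by rewrite expr2 ler_wpM2l // ltW.
by rewrite -/m; lra.
Qed.

(** Bounds the potential by the total mass of the density instead of its supremum, so that leaving
    out components of small total mass changes the exponent little. *)
Lemma npot_bound (mu : {finite_measure set (measurableTypeR R) -> \bar R}) xi z M :
  UHP z -> bmf xi -> (forall t, 0 <= xi t) -> (forall t, cmod (nkernel z t) <= M) ->
  cmod (npot mu xi z) <= 2 * M * \int[mu]_t xi t.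
Proof.
move=> hz bx x0 hM.
have [c1 c2] := cbmf_npot bx hz.
apply: le_trans (cmod_le_reim _) _.
have key (k : R -> R) : (forall t, `|k t| <= cmod (nkernel z t) * xi t) -> bmf k ->
    `|\int[mu]_t k t| <= M * \int[mu]_t xi t.
  move=> hk bk; rewrite -bmf_integralZ //.
  apply: le_trans (le_normr_Rintegral _ _) _ => //; first exact: bmf_integrable.
  apply: bmf_le_integral; last 2 first.
  - by apply: bmfM => //; exact: bmf_cst.
  - by move=> t; apply: le_trans (hk t) _; rewrite ler_wpM2r.
  case: bk => mk [N hN]; split; first exact: measurableT_comp.
  by exists N => t; rewrite normr_id.
rewrite -mulrA mulr_natl mulr2n lerD //; apply: key => // t.
- by rewrite (mulrC (nkernel z t)) cre_rCM normrM mulrC (ger0_norm (x0 t)) ler_wpM2r // cre_le_cmod.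
- by rewrite (mulrC (nkernel z t)) cim_rCM normrM mulrC (ger0_norm (x0 t)) ler_wpM2r // cim_le_cmod.
Qed.

Definition oreal O : set R := [set t | O (Some t)].

Lemma open_oreal O : ext_open O -> open (oreal O).
Proof.
move=> [h _]; rewrite openE => t /h [e e0 he].
exists e => //= s; rewrite /ball /= distrC; exact: he.
Qed.

Lemma measurable_oreal O : ext_open O -> measurable (oreal O).
Proof. by move=> /open_oreal /open_measurable. Qed.

Definition covered (s : seq (arcdesc R)) t : R :=
  \sum_(J <- s) \1_(jreal J) t.

Lemma coveredE O s t : uniq s -> (forall J, J \in s -> component O J) ->
  covered s t = (has (fun J => t \in jreal J) s)%:R.
Proof.
rewrite /covered; elim: s => [|J s IH]; first by rewrite big_nil.
rewrite cons_uniq big_cons => /andP[Js us] hs.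
rewrite IH //; last by move=> J' J's; apply: hs; rewrite inE J's orbT.
rewrite /= indicE; case: (boolP (t \in jreal J)) => tJ; last by rewrite add0r.
case: (boolP (has _ s)) => [/hasP[J' J's tJ']|_]; last by rewrite addr0.
suff JJ' : J = J' by rewrite JJ' J's in Js.
apply: (component_uniq (O := O) (t := t)).
- by apply: hs; rewrite inE eqxx.
- by apply: hs; rewrite inE J's orbT.
- exact: set_mem.
- exact: set_mem.
Qed.

(** [covered s] is the density belonging to the partial product over [s]. *)
Lemma bmf_covered s : bmf (covered s).
Proof.
rewrite /covered; elim: s => [|J s IH].
  by under [X in bmf X]eq_fun do rewrite big_nil; exact: bmf_cst.
under [X in bmf X]eq_fun do rewrite big_cons.
by apply: bmfD => //; apply: bmf_indic; exact: measurable_jreal.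
Qed.

Lemma prod_pJ s z : UHP z -> \prod_(J <- s) pJ J z = cexp (npot cau (covered s) z).
Proof.
move=> hz; elim: s => [|J s IH].
  rewrite big_nil /covered /npot; set h := fun t => _.
  have -> : cintegral cau setT h = 0; last by rewrite cexp0.
  rewrite -[RHS](mul0r (cintegral cau setT (fun=> 1))) -cintegralZ; last exact: cbmf_cst.
  by apply: eq_cintegral => t _; rewrite /h big_nil rC0 mulr0 mul0r.
have -> : covered (J :: s) = fun t => \1_(jreal J) t + covered s t.
  by apply/funext => t; rewrite /covered big_cons.
rewrite big_cons IH pJ_cexp // -cexpD -npotD //.
- by apply: bmf_indic; exact: measurable_jreal.
- exact: bmf_covered.
Qed.

(* Each component contains a rational, so countably many of them exhaust [O]. *)
Lemma component_seq O : ext_open O -> exists s : nat -> seq (arcdesc R),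
  [/\ forall n, uniq (s n), forall n J, J \in s n -> component O J &
      forall t, O (Some t) -> \forall n \near \oo, has (fun J => t \in jreal J) (s n)].
Proof.
move=> Oo.
have /choice[c hc] (q : rat) : exists J : arcdesc R,
    O (Some (ratr q)) -> component O J /\ jreal J (ratr q).
  have [h|h] := pselect (O (Some (ratr q))); last by exists None.
  by have [J h1 h2] := component_ex Oo h; exists J.
pose g (n : nat) : seq (arcdesc R) :=
  if unpickle n is Some q then (if `[< O (Some (ratr q)) >] then [:: c q] else [::]) else [::].
exists (fun n => undup (flatten [seq g i | i <- iota 0 n])); split.
- by move=> n; exact: undup_uniq.
- move=> n J; rewrite mem_undup => /flattenP[_ /mapP[i _ ->]].
  rewrite /g; case: unpickle => // q; case: asboolP => // h.
  by rewrite inE => /eqP ->; exact: (hc q h).1.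
- move=> t Ot; have [J cJ tJ] := component_ex Oo Ot.
  have : nbhs t (jreal J) by apply: open_nbhs_nbhs; split => //; exact: open_jreal.
  rewrite nbhsE => -[/= U [oU tU] UJ].
  have [q' [/UJ qJ [q _ qE]]] := dense_rat (ex_intro _ t tU) oU.
  have Oq : O (Some (ratr q)) by rewrite qE; exact: jreal_sub qJ.
  have [cq1 cq2] := hc q Oq.
  have cqJ : c q = J by apply: component_uniq cq1 cJ cq2 _; rewrite qE.
  exists (pickle q).+1 => //= n /= qn; apply/hasP; exists J; last exact: mem_set.
  rewrite mem_undup; apply/flattenP; exists (g (pickle q)).
    by apply: map_f; rewrite mem_iota.
  by rewrite /g pickleK; case: asboolP => // _; rewrite cqJ inE.
Qed.

(** The defect [\1_O - covered s] is nonnegative and decreases as [s] grows. Once its integral is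
    small for one finite family, it is at most as large for every larger family; this is what turns
    dominated convergence along a sequence into unconditional convergence. *)
Lemma krein_to_cexp O z : ext_open O -> UHP z ->
  krein_to O z (cexp (npot cau (\1_(oreal O)) z)).
Proof.
move=> Oo hz e e0.
have bO : bmf (\1_(oreal O) : R -> R) by apply: bmf_indic; exact: measurable_oreal.
have [d d0 hd] := cexp_cont (npot cau (\1_(oreal O)) z) e0.
have [M M0 hM] := cbmf_bound (cbmf_nkernel hz).
have [s [us cs hs]] := component_seq Oo.
have has_oreal (s' : seq (arcdesc R)) t : (forall J, J \in s' -> component O J) ->
    has (fun J => t \in jreal J) s' -> t \in oreal O.
  by move=> cs' /hasP[J /cs' cJ /set_mem tJ]; apply: mem_set; exact: jreal_sub tJ.
have diff01 (s' : seq (arcdesc R)) t : uniq s' -> (forall J, J \in s' -> component O J) ->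
    0 <= \1_(oreal O) t - covered s' t <= 1.
  move=> us' cs'; rewrite (coveredE t us' cs') indicE.
  by case: (boolP (has _ _)) => [/(has_oreal _ _ cs') ->|_]; rewrite ?subrr ?lexx ?ler01 // subr0;
    case: (t \in oreal O); rewrite ?lexx ?ler01.
have lim : \int[cau]_t (\1_(oreal O) t - covered (s n) t) @[n --> \oo] --> (0 : R).
  have -> : (0 : R) = \int[cau]_t (fun=> 0) t by rewrite integral_cstT mul0r.
  apply: (@bmf_dominated _ _ _ _ _ _ 1).
  - by move=> n; apply: bmfB => //; exact: bmf_covered.
  - exact: bmf_cst.
  - by move=> n t; case/andP: (diff01 (s n) t (us n) (cs n)) => h1 h2; rewrite ger0_norm.
  - move=> t; apply: cvg_near_cst.
    have [Ot|nOt] := pselect (O (Some t)).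
      apply: filterS (hs t Ot) => n h; rewrite (coveredE t (us n) (cs n)) h indicE.
      by rewrite mem_set // subrr.
    apply: nearW => n; rewrite (coveredE t (us n) (cs n)) indicE memNset //.
    case: (boolP (has _ _)) => [/(has_oreal _ _ (cs n))|_]; last by rewrite subrr.
    by move=> /set_mem.
(* The factor 2 M comes from [npot_bound]; adding 1 keeps the denominator positive. *)
have K0 : 0 < d / (2 * M + 1) by rewrite divr_gt0 //; lra.
have [n hn] : exists n, \int[cau]_t (\1_(oreal O) t - covered (s n) t) < d / (2 * M + 1).
  move/cvgrPdist_lt: lim => /(_ _ K0) [n _ /(_ n (leqnn n))].
  rewrite /= sub0r normrN => h; exists n; exact: le_lt_trans (ler_norm _) h.
exists (s n); first exact: cs.
move=> s' us' cs' sub; rewrite prod_pJ //; apply: hd.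
rewrite cmodBC -npotB //; last exact: bmf_covered.
apply: le_lt_trans (npot_bound _ hz _ _ hM) _.
- by apply: bmfB => //; exact: bmf_covered.
- by move=> t; case/andP: (diff01 s' t us' cs').
have le1 : \int[cau]_t (\1_(oreal O) t - covered s' t) <=
    \int[cau]_t (\1_(oreal O) t - covered (s n) t).
  apply: bmf_le_integral; try by apply: bmfB => //; exact: bmf_covered.
  move=> t; rewrite lerD2l lerN2 (coveredE t us' cs') (coveredE t (us n) (cs n)).
  case: (boolP (has _ (s n))) => [/hasP[J /sub Js tJ]|_]; last by [].
  by have -> : has (fun J => t \in jreal J) s' by apply/hasP; exists J.
have i0 : 0 <= \int[cau]_t (\1_(oreal O) t - covered s' t).
  by apply: Rintegral_ge0 => t _; case/andP: (diff01 s' t us' cs').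
apply: le_lt_trans (_ : (2 * M + 1) * \int[cau]_t (\1_(oreal O) t - covered (s n) t) < _).
  by apply: ler_pM => //; [rewrite mulr_ge0 | rewrite lerDl].
by rewrite mulrC -ltr_pdivlMr // ltr_wpDl // mulr_ge0.
Qed.

(** The union of the two finite families makes the product close to both limits. *)
Lemma krein_to_uniq O z w w' : krein_to O z w -> krein_to O z w' -> w = w'.
Proof.
move=> h h'; apply/eqP; rewrite -subr_eq0 -cmod_eq0; apply/negPn/negP => n0.
have m0 : 0 < cmod (w - w') / 2 by rewrite divr_gt0 // lt_neqAle eq_sym n0 cmod_ge0.
have [s0 c0 hs0] := h _ m0; have [s1 c1 hs1] := h' _ m0.
pose s := undup (s0 ++ s1).
have cs J : J \in s -> component O J.
  by rewrite mem_undup mem_cat => /orP[/c0|/c1].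
have b1 : {subset s1 <= s} by move=> J Js; rewrite mem_undup mem_cat Js orbT.
have b0 : {subset s0 <= s} by move=> J Js; rewrite mem_undup mem_cat Js.
move: (hs0 s (undup_uniq _) cs b0) (hs1 s (undup_uniq _) cs b1).
have := cmod_triangle (\prod_(J <- s) pJ J z) w w'.
by rewrite (cmodBC w (\prod_(J <- s) pJ J z)); lra.
Qed.

Lemma kO_cexp O z : ext_open O -> UHP z -> kO O z = cexp (npot cau (\1_(oreal O)) z).
Proof.
move=> Oo hz; have h := krein_to_cexp Oo hz.
apply: (krein_to_uniq _ h); rewrite /kO; case: xgetP => [w -> //|].
by move=> /(_ _ h).
Qed.

End KreinProduct.

(** * Locally negligible sets *)

Section LocallyNull.
Context {R : realType}.

(** Each point of [V] has a neighbourhood with rational endpoints on which [N] is negligible, and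
    there are only countably many such intervals. *)
Lemma locally_negligible (mu : {measure set (measurableTypeR R) -> \bar R}) (N V : set R) :
  (forall t, V t -> exists2 e : R, 0 < e & mu.-negligible (N `&` `]t - e, t + e[%classic)) ->
  mu.-negligible (N `&` V).
Proof.
move=> h.
pose I (pq : rat * rat) : set R := N `&` `]ratr pq.1, ratr pq.2[%classic.
pose A (n : nat) : set R := if unpickle n is Some pq
  then (if `[< mu.-negligible (I pq) >] then I pq else set0) else set0.
have hA : mu.-negligible (\bigcup_n A n).
  apply: negligible_bigcup => n; rewrite /A.
  case: unpickle => [pq|]; last exact: negligible_set0.
  by case: asboolP => // _; exact: negligible_set0.
apply: negligibleS hA => t [Nt /h [e e0 he]].
have [p /[!in_itv]/= /andP[p1 p2]] := @rat_in_itvoo R (t - e) t ltac:(lra).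
have [q /[!in_itv]/= /andP[q1 q2]] := @rat_in_itvoo R t (t + e) ltac:(lra).
exists (pickle (p, q)); [exact: Logic.I | rewrite /A pickleK].
case: asboolP => [_|[]]; first by split => //=; rewrite in_itv /= p2 q1.
apply: negligibleS he => s [Ns] /=; rewrite in_itv /= => /andP[s1 s2].
by split => //=; rewrite in_itv /=; lra.
Qed.

End LocallyNull.

(** * Vanishing of a density whose Poisson integral is O(y) *)

Section PoissonZero.
Context {R : realType}.
Local Notation leb := (@lebesgue_measure R).
Local Notation cau := (@cauchym R).

(* The Poisson kernel at height [y] is at least [1/(2y)] on [[x-y, x+y]]; covering
   [[a, b]] by short intervals bounds the mass of [zeta]. *)
Lemma poisson_zero (zeta : R -> R) (a b C d : R) : a < b -> 0 < d ->
  bmf zeta -> (forall t, 0 <= zeta t) ->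
  (forall x y, a <= x <= b -> 0 < y < d -> cim (npot cau zeta (Complex x y)) <= C * y) ->
  leb.-negligible ([set t | zeta t <> 0] `&` `]a, b[%classic).
Proof.
move=> ab d0 bz z0 hC.
(* The weight cancels the density of [cauchym] on [a, b], so integrals of [g] are Lebesgue integrals
   of [zeta]; the indicator keeps [w] bounded. *)
pose w (t : R) : R := oneDsqr t * \1_`[a, b] t.
have bw : bmf w.
  split.
    apply: measurable_funM; last exact: measurable_indic.
    by apply: continuous_measurable_fun; exact: continuous_oneDsqr.
  exists (1 + (`|a| + `|b|) ^+ 2) => t; rewrite /w indicE.
  case: (boolP (t \in _)) => [|_]; last first.
    by rewrite mulr0 normr0 addr_ge0 // sqr_ge0.
  rewrite inE /= in_itv /= mulr1 => /andP[h1 h2].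
  rewrite ger0_norm; last by rewrite (le_trans ler01) // oneDsqr_ge1.
  rewrite lerD2l -real_normK ?num_real // lerXn2r ?nnegrE // ?addr_ge0 //.
  rewrite ler_norml; have := ler_norm b; have := ler_norm (- a); rewrite normrN.
  by have := normr_ge0 a; have := normr_ge0 b; lra.
have w0 t : 0 <= w t.
  by rewrite mulr_ge0 ?indicE // (le_trans ler01) // oneDsqr_ge1.
pose g t := w t * zeta t.
have bg : bmf g by exact: bmfM.
have g0 t : 0 <= g t by rewrite mulr_ge0.
(* The evaluation point lies above the midpoint at height h/2; there h times the Poisson kernel is
   at least 1 on the whole interval, and C y is C h / 2. *)
have step c h : a <= c -> 0 < h -> h / 2 < d -> c + h / 2 <= b ->
    \int[cau]_t (g t * \1_`[c, c + h[ t) <= C * (h ^+ 2 / 2).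
  move=> ac h0 hd hb; set x := c + h / 2; set y := h / 2.
  have y0 : 0 < y by rewrite divr_gt0.
  have hz : UHP (Complex x y : R[i]) by [].
  have [n1 n2] := cbmf_npot bz hz.
  have le1 : cim (npot cau zeta (Complex x y)) <= C * y.
    by apply: hC; rewrite /x /y; lra.
  apply: le_trans (_ : h * (C * y) <= _); last by rewrite /y; lra.
  apply: le_trans (_ : h * cim (npot cau zeta (Complex x y)) <= _); last by rewrite ler_pM2l.
  rewrite /npot cim_cintegral -bmf_integralZ //.
  apply: bmf_le_integral; [by apply: bmfM => //; exact: bmf_indic | by apply: bmfM => //; exact: bmf_cst|].
  move=> t; rewrite (mulrC (nkernel _ _)) cim_rCM indicE.
  have k0 := cim_nkernel_gt0 t hz.
  have r0 : 0 <= h * (zeta t * cim (nkernel (Complex x y) t)).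
    by rewrite !mulr_ge0 // ltW.
  case: (boolP (t \in _)) => [tI|_]; last by rewrite mulr0.
  have /andP[t1 t2] : c <= t < c + h by move: tI; rewrite inE /= in_itv.
  have kE : cim (nkernel (Complex x y) t) =
    y * (1 + t ^+ 2) / ((t - x) ^+ 2 + y ^+ 2) := cim_nkernel t hz.
  rewrite mulr1 kE mulrCA /g mulrC ler_wpM2l //.
  have q0 : 0 < (t - x) ^+ 2 + y ^+ 2 by rewrite ltr_wpDl ?sqr_ge0 // exprn_gt0.
  have q1 : (t - x) ^+ 2 + y ^+ 2 <= h * y.
    have : (t - x) ^+ 2 <= y ^+ 2.
      rewrite -(real_normK (num_real (t - x))) lerXn2r ?nnegrE ?(ltW y0) //.
      by rewrite ler_norml /x /y; lra.
    have -> : h = y + y by rewrite /y; lra.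
    by rewrite mulrDl -!expr2; lra.
  rewrite mulrA ler_pdivlMr //.
  apply: le_trans (_ : (1 + t ^+ 2) * (h * y) <= _); last first.
    by rewrite (_ : h * (y * (1 + t ^+ 2)) = (1 + t ^+ 2) * (h * y)) //; ring.
  apply: ler_pM => //; first exact: ltW.
  rewrite /w indicE /oneDsqr; case: (_ \in _); rewrite ?mulr1 // mulr0.
  by rewrite addr_ge0 // sqr_ge0.
(* Summing C h^2 / 2 over the n+1 intervals of length h = (b-a)/(n+1) leaves a factor 1/(n+1). *)
have total n : (b - a) / n.+1%:R / 2 < d ->
    \int[cau]_t (g t * \1_`[a, b[ t) <= C * (b - a) ^+ 2 / 2 / n.+1%:R.
  move=> hn; set h := (b - a) / n.+1%:R in hn.
  have n0 : (0 : R) < n.+1%:R by rewrite ltr0n.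
  have h0 : 0 < h by rewrite divr_gt0 //; lra.
  have hnb : n.+1%:R * h = b - a by rewrite /h mulrC divfK // gt_eqF.
  have ind k : (k <= n.+1)%N ->
      \int[cau]_t (g t * \1_`[a, a + k%:R * h[ t) <= k%:R * (C * (h ^+ 2 / 2)).
    elim: k => [_|k IH kn].
      rewrite !mul0r addr0; under eq_Rintegral do rewrite set_itvco0 indic0 mulr0.
      by rewrite integral_cstT mul0r.
    have kh : a + k%:R * h + h = a + k.+1%:R * h by rewrite -natr1; ring.
    have kn1 : k.+1%:R * h <= b - a.
      by rewrite -hnb ler_pM2r // ler_nat.
    have k0 : 0 <= k%:R * h by rewrite mulr_ge0 // ltW.
    rewrite -kh -[in leRHS]natr1 [leRHS]mulrDl mul1r.
    apply: le_trans (_ : \int[cau]_t (g t * \1_`[a, a + k%:R * h[ t) +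
        \int[cau]_t (g t * \1_`[a + k%:R * h, a + k%:R * h + h[ t) <= _).
      rewrite -bmf_integralD; try by apply: bmfM => //; exact: bmf_indic.
      apply: bmf_le_integral.
      - by apply: bmfM => //; exact: bmf_indic.
      - by apply: bmfD; apply: bmfM => //; exact: bmf_indic.
      move=> t; rewrite -mulrDr ler_wpM2l // !indicE !mem_setE !in_itv /=.
      case: (leP a t) => at_ /=; last by rewrite addr_ge0.
      case: (ltP t (a + k%:R * h)) => tk /=; last by rewrite add0r.
      by rewrite (lt_trans tk) ?ltrDl //= lerDl.
    apply: lerD; first by apply: IH; exact: ltnW.
    by apply: step => //; lra.
  have := ind n.+1 (leqnn _); rewrite hnb addrC subrK => /le_trans; apply.
  rewrite le_eqVlt; apply/orP; left; apply/eqP; rewrite /h.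
  by move: (lt0r_neq0 n0); move: (n.+1%:R : R) => N N0; field.
have I0 : \int[cau]_t (g t * \1_`[a, b[ t) = 0.
  have i0 : 0 <= \int[cau]_t (g t * \1_`[a, b[ t).
    by apply: Rintegral_ge0 => t _; rewrite mulr_ge0 // indicE.
  apply/eqP; rewrite eq_le i0 andbT; apply/ler_addgt0Pl => e e0; rewrite addr0.
  pose K := `|C * (b - a) ^+ 2 / 2|.
  have [n hn] : exists n, (b - a) / 2 / d < n.+1%:R /\ K / e < (n.+1%:R : R).
    pose m := Num.max ((b - a) / 2 / d) (K / e).
    exists (Num.truncn m); have := truncnS_gt m; rewrite /m gt_max => /andP[].
    by [].
  case: hn => n1 n2; have n0 : (0 : R) < n.+1%:R by rewrite ltr0n.
  apply: le_trans (total n _) _.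
    rewrite mulrAC ltr_pdivrMr //; move: n1; rewrite ltr_pdivrMr //.
    by rewrite [d * _]mulrC.
  rewrite ler_pdivrMr //; apply: le_trans (ler_norm _) _.
  by move: n2; rewrite ltr_pdivrMr // mulrC => /ltW.
move: I0; rewrite integral_cauchym; last by apply: bmfM => //; exact: bmf_indic.
pose F t := g t * \1_`[a, b[ t * (oneDsqr t)^-1.
have wg (t : R) : 0 < oneDsqr t by rewrite (lt_le_trans ltr01) // oneDsqr_ge1.
have F0 t : 0 <= F t by rewrite !mulr_ge0 // ?indicE // invr_ge0 ltW.
have mw : measurable_fun setT (fun t : R => (oneDsqr t)^-1).
  by apply/measurable_EFinP; exact: measurable_int (integrable_oneDsqrV R).
have bgi : bmf (fun t => g t * \1_`[a, b[ t) by apply: bmfM => //; exact: bmf_indic.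
have mF : measurable_fun setT (EFin \o F).
  by apply/measurable_EFinP; apply: measurable_funM => //; case: bgi.
rewrite /Rintegral => I0.
have {}I0 : (\int[leb]_t `|(EFin \o F) t| = 0)%E.
  rewrite -[RHS]/(0%:E) -I0 fineK.
    by apply: eq_integral => t _; rewrite gee0_abs // lee_fin.
  apply: integrable_fin_num => //.
  have [_ [B hB]] := bgi.
  pose g2 (t : measurableTypeR R) : \bar R := (B%:E * (oneDsqr t)^-1%:E)%E.
  apply: (@le_integrable _ (measurableTypeR R) R leb setT measurableT (EFin \o F) g2) => //.
    move=> t _; rewrite lee_fin /F [leLHS]normrM [leRHS]normrM ler_wpM2r //.
    by apply: le_trans (hB t) (ler_norm _).
  by apply: integrableZl => //; exact: integrable_oneDsqrV.
have /ae_eq_integral_abs := I0; move=> /(_ measurableT mF) [N [mN N0 sub]].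
exists N; split => //; apply: subset_trans sub => t [zt] /=.
rewrite in_itv /= => /andP[h1 h2]; apply/not_implyP; split => // -[].
apply/eqP; rewrite !mulf_neq0 //.
- by rewrite indicE mem_set ?oner_eq0 //= in_itv /= !ltW.
- by apply/eqP.
- by rewrite indicE mem_set ?oner_eq0 //= in_itv /= h2 ltW.
Qed.

End PoissonZero.

(** * Continuation of a Nevanlinna function across gaps of the support *)

Section BoundaryValues.
Context {R : realType}.
Local Notation T := (measurableTypeR R).
Implicit Types (w z : R[i]) (s t : R).

Lemma measurable_inv_pos (f : T -> R) : measurable_fun setT f -> (forall t, 0 < f t) ->
  measurable_fun setT (fun t => (f t)^-1).
Proof.
move=> mf f0; rewrite (_ : (fun t => (f t)^-1) = (fun t => (f t) `^ (-1))).
  by apply: (@measurableT_comp _ _ _ _ _ _ (fun u : R => u `^ (-1)) _ f) => //; exact: measurable_powR.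
by apply/funext => t; rewrite powR_inv1 // ltW.
Qed.

Lemma bmf_integral_null (mu : {finite_measure set T -> \bar R}) (f g : T -> R) (N : set R) :
  bmf f -> bmf g -> measurable N -> mu N = 0%E -> (forall t, ~ N t -> f t = g t) ->
  \int[mu]_t f t = \int[mu]_t g t.
Proof.
move=> [mf _] [mg _] mN N0 fg; rewrite /Rintegral; congr fine.
apply: ae_eq_integral => //; try exact/measurable_EFinP.
exists N; split => //.
by move=> t /= /not_implyP [_ nfg]; apply: contrapT => /fg h; apply: nfg; rewrite h.
Qed.

Variables (rho : {finite_measure set T -> \bar R}) (alpha beta : R) (f : R[i] -> R[i]).
Hypothesis frep : nev_rep f alpha beta rho.

Section Near.
Variables (x e : R).
Hypothesis e0 : 0 < e.
Hypothesis rho0 : rho `]x - e, x + e[%classic = 0%E.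

Let D : set T := ~` `]x - e, x + e[%classic.

Let mD : measurable D. Proof. exact: measurableC. Qed.

Let farP t : D t -> e <= `|t - x|.
Proof.
rewrite /D /= in_itv /= => h; rewrite leNgt; apply/negP; rewrite ltr_norml => h'.
by apply: h; lra.
Qed.

Let dist_ge w t : cmod (w - rC x) < e / 2 -> D t -> `|t - x| / 2 <= cmod (rC t - w).
Proof.
move=> hw /farP ht; have := cmod_triangle w (rC t) (rC x).
by rewrite -rCB cmod_rC; lra.
Qed.

Let dist_gt0 w t : cmod (w - rC x) < e / 2 -> D t -> rC t - w != 0.
Proof.
move=> hw Dt; rewrite -cmod_gt0; apply: lt_le_trans (dist_ge hw Dt).
by rewrite divr_gt0 // (lt_le_trans e0) // farP.
Qed.

Let cbmf_resD w : cmod (w - rC x) < e / 2 ->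
  cbmf (fun t => (rC t - w)^-1 * rC (\1_D t)).
Proof.
move=> hw; pose q (t : T) : R := (t - cre w) ^+ 2 + cim w ^+ 2.
(* Replacing [q] by 1 off [D] gives a denominator that is positive everywhere, hence a measurable
   reciprocal, without changing the product with the indicator. *)
pose qq (t : T) : R := q t * \1_D t + (1 - \1_D t).
have mi : measurable_fun setT (\1_D : T -> R) by exact: measurable_indic.
have mt : measurable_fun setT (fun t : T => t - cre w).
  by apply: measurable_funB => //; exact: measurable_cst.
have mq : measurable_fun setT q.
  by apply: measurable_funD => //; exact: measurable_funX.
have mqq : measurable_fun setT qq.
  apply: measurable_funD; first exact: measurable_funM.
  by apply: measurable_funB => //; exact: measurable_cst.
have qq0 t : 0 < qq t.
  rewrite /qq indicE; case: (boolP (t \in D)) => [/set_mem Dt|_]; last by rewrite mulr0 subr0 add0r.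
  rewrite mulr1 subrr addr0 /q.
  have := dist_gt0 hw Dt; rewrite -cmod_gt0 => /(exprn_gt0 2).
  by rewrite sqr_cmod creB cimB cre_rC cim_rC sub0r sqrrN.
have mV := measurable_inv_pos mqq qq0.
have qE t : t \in D -> qq t = (cre (rC t - w)) ^+ 2 + (cim (rC t - w)) ^+ 2.
  by move=> tD; rewrite /qq indicE tD mulr1 subrr addr0 creB cimB cre_rC cim_rC sub0r sqrrN.
have creE t : cre ((rC t - w)^-1 * rC (\1_D t)) = (t - cre w) * (qq t)^-1 * \1_D t.
  rewrite mulrC cre_rCM mulrC !indicE; case: (boolP (t \in D)) => tD; last by rewrite !mulr0.
  by rewrite creV -qE // creB cre_rC.
have cimE t : cim ((rC t - w)^-1 * rC (\1_D t)) = cim w * (qq t)^-1 * \1_D t.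
  rewrite mulrC cim_rCM mulrC !indicE; case: (boolP (t \in D)) => tD; last by rewrite !mulr0.
  by rewrite cimV -qE // cimB cim_rC sub0r -[- (_ / _)]mulNr opprK.
have bd t : cmod ((rC t - w)^-1 * rC (\1_D t)) <= 2 / e.
  rewrite cmodM cmodV cmod_rC !indicE; case: (boolP (t \in D)) => [/set_mem tD|_]; last first.
    by rewrite normr0 mulr0 divr_ge0 // ltW.
  rewrite normr1 mulr1 -[2 / e]invf_div lef_pV2 ?posrE ?divr_gt0 ?cmod_gt0 ?dist_gt0 //.
  by have := dist_ge hw tD; have := farP tD; lra.
split; split.
- under [X in measurable_fun _ X]eq_fun do rewrite creE.
  by apply: measurable_funM => //; exact: measurable_funM.
- by exists (2 / e) => t; apply: le_trans (bd t); exact: cre_le_cmod.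
- under [X in measurable_fun _ X]eq_fun do rewrite cimE.
  by apply: measurable_funM => //; apply: measurable_funM => //; exact: measurable_cst.
- by exists (2 / e) => t; apply: le_trans (bd t); exact: cim_le_cmod.
Qed.

(** Cutting the kernel off on the null interval makes it well behaved for all [w] in a full disc
    around [x], real points included. *)
Let kD w t : R[i] := nkernel w t * rC (\1_D t).

Let kDE w t : cmod (w - rC x) < e / 2 ->
  kD w t = w * rC (\1_D t) + (1 + w ^+ 2) * ((rC t - w)^-1 * rC (\1_D t)).
Proof.
move=> hw; rewrite /kD indicE; case: (boolP (t \in D)) => [/set_mem tD|_]; last by rewrite rC0 !mulr0 addr0.
by rewrite /nkernel rC1; field; exact: dist_gt0.
Qed.

Let cbmf_kD w : cmod (w - rC x) < e / 2 -> cbmf (kD w).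
Proof.
move=> hw; rewrite (_ : kD w = fun t => w * rC (\1_D t) + (1 + w ^+ 2) * ((rC t - w)^-1 * rC (\1_D t))).
  apply: cbmfD; apply: cbmfM; try exact: cbmf_cst; last exact: cbmf_resD.
  by apply: cbmf_rC; exact: bmf_indic.
by apply/funext => t; exact: kDE.
Qed.

(** Bounds (1+t^2)/(|t-x|/2)^2 on [D]: from 1 + t^2 <= 1 + 2 x^2 + 2 (t-x)^2 and (t-x)^2 >= e^2. *)
Let K : R := 4 * ((1 + 2 * x ^+ 2) / e ^+ 2 + 2).

Let K_ge0 : 0 <= K.
Proof.
by rewrite /K mulr_ge0 // addr_ge0 // divr_ge0 ?sqr_ge0 // addr_ge0 // mulr_ge0 // sqr_ge0.
Qed.

Let K_bound t : D t -> 1 + t ^+ 2 <= K * (`|t - x| / 2) ^+ 2.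
Proof.
move=> Dt; have h := farP Dt.
have h2 : e ^+ 2 <= (t - x) ^+ 2.
  by rewrite -(real_normK (num_real (t - x))) lerXn2r ?nnegrE // ltW.
have -> : K * (`|t - x| / 2) ^+ 2 = ((1 + 2 * x ^+ 2) / e ^+ 2 + 2) * (t - x) ^+ 2.
  by rewrite /K expr_div_n real_normK ?num_real //; field; rewrite gt_eqF.
rewrite mulrDl.
have h3 : 1 + 2 * x ^+ 2 <= (1 + 2 * x ^+ 2) / e ^+ 2 * (t - x) ^+ 2.
  by rewrite mulrAC ler_pdivlMr ?exprn_gt0 // ler_wpM2l // addr_ge0 // mulr_ge0 // sqr_ge0.
have h4 : 0 <= (t - 2 * x) ^+ 2 by exact: sqr_ge0.
have : 2 * (t - x) ^+ 2 + 2 * x ^+ 2 - t ^+ 2 = (t - 2 * x) ^+ 2 by ring.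
by lra.
Qed.

Let kD_lip w w' t : cmod (w - rC x) < e / 2 -> cmod (w' - rC x) < e / 2 ->
  cmod (kD w t - kD w' t) <= K * cmod (w - w').
Proof.
move=> hw hw'; rewrite /kD indicE; case: (boolP (t \in D)) => [/set_mem tD|_]; last first.
  by rewrite rC0 !mulr0 subrr cmod0 mulr_ge0 ?cmod_ge0.
rewrite rC1 !mulr1.
have n1 := dist_gt0 hw tD; have n2 := dist_gt0 hw' tD.
have -> : nkernel w t - nkernel w' t = (1 + rC t ^+ 2) / ((rC t - w) * (rC t - w')) * (w - w').
  by rewrite /nkernel; field; rewrite n1 n2.
rewrite cmodM ler_wpM2r ?cmod_ge0 // cmodM cmodV cmodM ler_pdivrMr ?mulr_gt0 ?cmod_gt0 //.
have -> : 1 + rC t ^+ 2 = rC (1 + t ^+ 2) :> R[i] by rewrite rCD rC1 expr2 rCM.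
rewrite cmod_rC ger0_norm ?addr_ge0 ?sqr_ge0 //.
apply: le_trans (K_bound tD) _.
by rewrite ler_wpM2l // expr2 ler_pM ?divr_ge0 ?dist_ge.
Qed.

(** The continuation of [f] across the gap; it agrees with [f] on C^+ because the removed interval
    is null for [rho]. *)
Let G w : R[i] := rC alpha * w + rC beta + cintegral rho setT (kD w).

Let G_f z : UHP z -> f z = G z.
Proof.
move=> hz; rewrite frep.2 // /G; congr (_ + _).
have [b1 b2] := cbmf_nkernel hz.
have [c1 c2] : cbmf (kD z) by apply: cbmfM; [exact: cbmf_nkernel|apply: cbmf_rC; exact: bmf_indic].
have h t : ~ `]x - e, x + e[%classic t -> nkernel z t = kD z t.
  by move=> tD; rewrite /kD indicE mem_set // rC1 mulr1.
apply: complex_eqP; rewrite ?cre_cintegral ?cim_cintegral.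
- by apply: bmf_integral_null rho0 _ => // t /h ->.
- by apply: bmf_integral_null rho0 _ => // t /h ->.
Qed.

Let mass := fine (rho setT).

Let G_lip w w' : cmod (w - rC x) < e / 2 -> cmod (w' - rC x) < e / 2 ->
  cmod (G w - G w') <= (alpha + 2 * K * mass) * cmod (w - w').
Proof.
move=> hw hw'.
have -> : G w - G w' = rC alpha * (w - w') + cintegral rho setT (fun t => kD w t - kD w' t).
  by rewrite cintegralB; [rewrite /G; ring | exact: cbmf_kD | exact: cbmf_kD].
apply: le_trans (cmodD _ _) _; rewrite cmodM cmod_rC ger0_norm; last exact: frep.1.
rewrite mulrDl lerD2l.
have -> : 2 * K * mass * cmod (w - w') = 2 * (K * cmod (w - w')) * mass by ring.
apply: cmod_cintegral; first by apply: cbmfD; [|apply: cbmfN]; exact: cbmf_kD.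
by move=> t; exact: kD_lip.
Qed.

Let near_real s : `|s - x| < e / 2 -> cmod (rC s - rC x) < e / 2.
Proof. by rewrite -rCB cmod_rC. Qed.

Let kD_real s t : kD (rC s) t = rC ((1 + s * t) / (t - s) * \1_D t).
Proof. by rewrite /kD /nkernel !rCM rCV rCB rCD rCM rC1. Qed.

Let c s := cre (G (rC s)).

Let G_real s : G (rC s) = rC (c s).
Proof.
rewrite /c; apply: complex_eqP => //; rewrite cim_rC /G !cimD cim_rCM !cim_rC mulr0 !add0r.
rewrite cim_cintegral; under eq_Rintegral do rewrite kD_real cim_rC.
by rewrite integral_cstT mul0r.
Qed.

(** The difference quotient is alpha plus the integral of (1+t^2)/((t-s)(t-s')), where s and s' lie
    on the same side of every t in [D]; a positive lower bound of this integrand gives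
    strictness. *)
Let c_incr s s' : 0 < alpha \/ 0 < mass -> `|s - x| < e / 2 -> `|s' - x| < e / 2 ->
  s < s' -> c s < c s'.
Proof.
move=> nonconst hs hs' ss'.
have [b1 _] := cbmf_kD (near_real hs); have [b2 _] := cbmf_kD (near_real hs').
have cE u : c u = alpha * u + beta + \int[rho]_t cre (kD (rC u) t).
  by rewrite /c /G !creD cre_rCM !cre_rC cre_cintegral.
rewrite -subr_gt0 !cE.
have -> : alpha * s' + beta + \int[rho]_t cre (kD (rC s') t) -
    (alpha * s + beta + \int[rho]_t cre (kD (rC s) t)) =
    alpha * (s' - s) + \int[rho]_t (cre (kD (rC s') t) - cre (kD (rC s) t)).
  by rewrite (bmf_integralB rho b2 b1); ring.
(* Since |t-s| and |t-s'| are at most 2|t-x| and (t-x)^2 <= 2 (1+t^2)(1+x^2), the integrand is at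
   least 1/(8(1+x^2)). *)
pose dl := (8 * (1 + x ^+ 2))^-1.
have x20 := sqr_ge0 x.
have dl0 : 0 < dl by rewrite invr_gt0 mulr_gt0 // ltr_wpDr.
have bi : bmf (\1_D : T -> R) by exact: bmf_indic.
have mE : mass = \int[rho]_t (\1_D t : R).
  rewrite /mass -[fine _]mul1r -integral_cstT.
  apply: (bmf_integral_null _ _ _ rho0) => //; first exact: bmf_cst.
  by move=> t tD; rewrite indicE mem_set.
have lb : (s' - s) * dl * mass <= \int[rho]_t (cre (kD (rC s') t) - cre (kD (rC s) t)).
  rewrite mE -bmf_integralZ //; apply: bmf_le_integral.
  - by apply: bmfM => //; exact: bmf_cst.
  - exact: bmfB.
  move=> t; rewrite !kD_real !cre_rC indicE; case: (boolP (t \in D)) => [/set_mem tD|_]; last first.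
    by rewrite !mulr0 subrr.
  rewrite !mulr1; have ht := farP tD.
  have pos : 0 < (t - s) * (t - s') <= (2 * `|t - x|) ^+ 2.
    move: hs hs'; rewrite !ltr_norml => /andP[a1 a2] /andP[a3 a4].
    rewrite expr2; case: (leP 0 (t - x)) ht => tx; [rewrite ger0_norm // => ht|rewrite ltr0_norm // => ht].
      have h1 : 0 < t - s by lra.
      have h2 : 0 < t - s' by lra.
      by rewrite mulr_gt0 //= ler_pM ?ltW //; lra.
    have h1 : 0 < s - t by lra.
    have h2 : 0 < s' - t by lra.
    rewrite -mulrNN !opprB mulr_gt0 //= ler_pM ?ltW //; lra.
  case/andP: pos => p0 p1.
  have n1 : t - s != 0 by apply: contraTneq p0 => ->; rewrite mul0r ltxx.
  have n2 : t - s' != 0 by apply: contraTneq p0 => ->; rewrite mulr0 ltxx.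
  have -> : (1 + s' * t) / (t - s') - (1 + s * t) / (t - s) =
     (s' - s) * ((1 + t ^+ 2) / ((t - s) * (t - s'))) by field; rewrite n1 n2.
  apply: ler_wpM2l; first by rewrite subr_ge0 ltW.
  rewrite ler_pdivlMr //.
  apply: le_trans (_ : dl * (2 * `|t - x|) ^+ 2 <= _); first by rewrite ler_pM2l.
  rewrite exprMn real_normK ?num_real // /dl mulrC ler_pdivrMr ?mulr_gt0 ?ltr_wpDr //.
  have h4 : 0 <= (t + x) ^+ 2 by exact: sqr_ge0.
  have h5 : (t + x) ^+ 2 = t ^+ 2 + 2 * (t * x) + x ^+ 2 by ring.
  have h6 : (t - x) ^+ 2 = t ^+ 2 - 2 * (t * x) + x ^+ 2 by ring.
  have h7 : 0 <= t ^+ 2 * x ^+ 2 by rewrite mulr_ge0 ?sqr_ge0.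
  have -> : (1 + t ^+ 2) * (8 * (1 + x ^+ 2)) = 8 + 8 * t ^+ 2 + 8 * x ^+ 2 + 8 * (t ^+ 2 * x ^+ 2) by ring.
  by rewrite -natrX; lra.
have a0 := frep.1; have m0 : 0 <= mass by exact: mass_ge0.
have ss0 : 0 < s' - s by rewrite subr_gt0.
case: nonconst => h.
- apply: lt_le_trans (_ : alpha * (s' - s) <= _); first exact: mulr_gt0.
  by rewrite lerDl; apply: le_trans lb; rewrite !mulr_ge0 // ltW.
- apply: lt_le_trans (_ : (s' - s) * dl * mass <= _); first by rewrite !mulr_gt0.
  by apply: le_trans lb _; rewrite lerDr mulr_ge0 // ltW.
Qed.

(** Letting [z] approach [rC s] gives the boundary value; taking [z] vertically above [s] gives Im f
    <= C Im z, as [c s] is real. *)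
Lemma near_boundary : exists (c : R -> R) (d C : R), [/\ 0 < d, 0 <= C,
  forall z s, UHP z -> cmod (z - rC x) < d -> `|s - x| < d ->
    cmod (f z - rC (c s)) <= C * cmod (z - rC s),
  forall s s', `|s - x| < d -> `|s' - x| < d -> `|c s - c s'| <= C * `|s - s'| &
  (0 < alpha \/ 0 < fine (rho setT)) ->
    forall s s', `|s - x| < d -> `|s' - x| < d -> s < s' -> c s < c s'].
Proof.
exists c, (e / 2), (alpha + 2 * K * mass); split.
- by rewrite divr_gt0.
- apply: addr_ge0; first exact: frep.1.
  by apply: mulr_ge0; [rewrite mulr_ge0 | exact: mass_ge0].
- move=> z s hz zx sx; rewrite G_f // -G_real.
  by apply: G_lip => //; exact: near_real.
- move=> s s' hs hs'; have := G_lip (near_real hs) (near_real hs').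
  by rewrite !G_real -!rCB !cmod_rC.
- by move=> h s s' hs hs' ss'; exact: c_incr.
Qed.

End Near.

Lemma msupport_open t : ~ msupport rho t ->
  exists2 e, 0 < e & rho `]t - e, t + e[%classic = 0%E.
Proof.
move=> /existsNP[e /not_implyP[e0 /negP h]]; exists e => //.
by apply/eqP; rewrite -measure_le0 leNgt.
Qed.

Lemma measurable_Nmsupport_null (V : set R) : measurable V ->
  (forall t, V t -> ~ msupport rho t) -> rho V = 0%E.
Proof.
move=> mV hV.
have : rho.-negligible (setT `&` V).
  apply: locally_negligible => t /hV /msupport_open [e e0 re]; exists e => //.
  by rewrite setTI; apply/negligibleP.
by rewrite setTI => /negligibleP; apply.
Qed.

(** Here alpha = 0 and the support is bounded, so f(z) - c is the integral of (1+t^2)/(t-z) with c =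
    beta minus the integral of t, and it tends to 0. To the right of the support this integrand has
    negative real part, whence the one-sided bound. *)
Lemma infinity_boundary : Omegaf alpha rho None -> exists (c M : R),
  [/\ 0 <= M, forall s, M < `|s| -> ~ msupport rho s, bvalue f None c &
   forall z, UHP z -> M < cre z -> cre (f z) <= c].
Proof.
move=> /not_orP [na /contrapT [M0 hM0]].
have a0 : alpha = 0.
  by apply/eqP; rewrite eq_le frep.1 andbT leNgt; apply/negP.
pose M := `|M0|; have M_ge0 : 0 <= M by exact: normr_ge0.
have hM s : M < `|s| -> ~ msupport rho s.
  by move=> Ms /hM0 sM; have := ler_norm M0; rewrite -/M; lra.
pose D : set T := `[- M, M]%classic.
have mD : measurable D by exact: measurable_itv.
have rD : rho (~` D) = 0%E.
  apply: measurable_Nmsupport_null; first exact: measurableC.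
  move=> t; rewrite /D /= in_itv /= => h; apply: hM; rewrite ltNge; apply/negP.
  by rewrite ler_norml.
have DP t : D t -> `|t| <= M by rewrite /D /= in_itv /= ler_norml.
have bi : bmf (\1_D : T -> R) by exact: bmf_indic.
have bt : bmf (fun t : T => t * \1_D t).
  split; first by apply: measurable_funM => //; exact: measurable_indic.
  exists M => t; rewrite indicE; case: (boolP (t \in D)) => [/set_mem/DP tM|_].
    by rewrite mulr1.
  by rewrite mulr0 normr0.
pose c := beta - \int[rho]_t (t * \1_D t).
(* On [D] this is (1+t^2)/(t-z), since n(z,t) + t has that form. *)
pose L z (t : T) : R[i] := (nkernel z t + rC t) * rC (\1_D t).
have LE z t : UHP z -> L z t = rC ((1 + t ^+ 2) * \1_D t) * (rC t - z)^-1.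
  move=> hz; rewrite /L rCM rCD expr2 rCM rC1 /nkernel; field; exact: UHP_neq_real.
have cL z : UHP z -> cbmf (L z).
  move=> hz; rewrite (_ : L z = fun t => nkernel z t * rC (\1_D t) + rC (t * \1_D t)).
    by apply: cbmfD; [apply: cbmfM; [exact: cbmf_nkernel|]|]; exact: cbmf_rC.
  by apply/funext => t; rewrite /L mulrDl rCM.
have fE z : UHP z -> f z - rC c = cintegral rho setT (L z).
  move=> hz; rewrite frep.2 // a0 rC0 mul0r add0r /c rCB.
  have -> : cintegral rho setT (nkernel z) =
      cintegral rho setT (fun t => nkernel z t * rC (\1_D t)).
    have [b1 b2] := cbmf_nkernel hz; have [b3 b4] := cbmf_npot bi hz.
    have h t : ~ (~` D) t -> nkernel z t = nkernel z t * rC (\1_D t).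
      by move=> /contrapT tD; rewrite indicE mem_set // rC1 mulr1.
    apply: complex_eqP; rewrite ?cre_cintegral ?cim_cintegral.
      by apply: bmf_integral_null rD _ => // [|t /h <-//]; exact: measurableC.
    by apply: bmf_integral_null rD _ => // [|t /h <-//]; exact: measurableC.
  have -> : rC (\int[rho]_t (t * \1_D t)) = cintegral rho setT (fun t => rC (t * \1_D t)).
    apply: complex_eqP => //; rewrite cim_rC cim_cintegral.
    by under eq_Rintegral do rewrite cim_rC; rewrite integral_cstT mul0r.
  have -> : rC beta + cintegral rho setT (fun t => nkernel z t * rC (\1_D t)) -
     (rC beta - cintegral rho setT (fun t => rC (t * \1_D t))) =
     cintegral rho setT (fun t => nkernel z t * rC (\1_D t)) +
     cintegral rho setT (fun t => rC (t * \1_D t)) by ring.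
  rewrite -cintegralD; [|exact: cbmf_npot|exact: cbmf_rC].
  by apply: eq_cintegral => t _; rewrite /L mulrDl rCM.
exists c, M; split => //.
- move=> e e0; pose m := fine (rho setT); have m0 : 0 <= m by exact: mass_ge0.
  (* As |t-z| >= |z| - M on [D], the integral is at most B/(|z| - M). *)
  pose B := 2 * (1 + M ^+ 2) * m; have B0 : 0 <= B.
    by rewrite !mulr_ge0 // addr_ge0 // sqr_ge0.
  exists (M + (B + 1) / e) => z hz zM.
  have zM0 : (B + 1) / e < cmod z - M by lra.
  have p0 : 0 < cmod z - M by apply: lt_trans zM0; rewrite divr_gt0 //; lra.
  rewrite fE //; apply: le_lt_trans (_ : 2 * ((1 + M ^+ 2) / (cmod z - M)) * m < _).
    apply: cmod_cintegral; first exact: cL.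
    move=> t; rewrite LE // cmodM cmodV cmod_rC indicE.
    case: (boolP (t \in D)) => [/set_mem/DP tM|_]; last first.
      by rewrite mulr0 normr0 mul0r divr_ge0 ?ltW // ltr_wpDr // sqr_ge0.
    have t2 : t ^+ 2 <= M ^+ 2.
      by rewrite -(real_normK (num_real t)) lerXn2r ?nnegrE.
    rewrite mulr1 ger0_norm ?addr_ge0 ?sqr_ge0 //.
    apply: ler_pM; rewrite ?addr_ge0 ?sqr_ge0 ?invr_ge0 ?cmod_ge0 ?lerD2l //.
    rewrite lef_pV2 ?posrE ?cmod_gt0 ?UHP_neq_real //.
    have := cmod_triangle (rC t) z 0; rewrite !subr0 cmod_rC (cmodBC z); lra.
  have -> : 2 * ((1 + M ^+ 2) / (cmod z - M)) * m = B / (cmod z - M).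
    by rewrite /B; ring.
  rewrite ltr_pdivrMr //; move: zM0; rewrite ltr_pdivrMr // mulrC; lra.
- move=> z hz Mz; rewrite -subr_le0 -(cre_rC c) -creB fE // cre_cintegral.
  rewrite -oppr_ge0 -[- _]mulN1r -bmf_integralZ; last by case: (cL z hz).
  apply: Rintegral_ge0 => t _; rewrite mulN1r LE // cre_rCM creV creB cre_rC indicE.
  case: (boolP (t \in D)) => [/set_mem/DP tM|_]; last by rewrite mulr0 mul0r oppr0.
  rewrite mulr1 -mulrN -mulNr opprB mulr_ge0 ?addr_ge0 ?sqr_ge0 //.
  apply: divr_ge0; last by rewrite addr_ge0 ?sqr_ge0.
  by rewrite subr_ge0; have := ler_norm t; lra.
Qed.

Lemma bvalue_uniq x (c c' : R) : bvalue f x c -> bvalue f x c' -> c = c'.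
Proof.
move=> h h'; apply/eqP; rewrite -subr_eq0 -normr_eq0; apply/negPn/negP => n0.
have m0 : 0 < `|c - c'| / 2 by rewrite divr_gt0 // lt_neqAle eq_sym n0 normr_ge0.
suff [z h1 h2] : exists2 z, cmod (f z - rC c) < `|c - c'| / 2 & cmod (f z - rC c') < `|c - c'| / 2.
  have := cmod_triangle (f z) (rC c) (rC c'); rewrite -rCB cmod_rC (cmodBC (rC c)).
  by lra.
case: x h h' => [t|] /= /(_ _ m0) h /(_ _ m0) h'.
- case: h => d d0 h; case: h' => d' d'0 h'.
  pose y := Num.min d d' / 2.
  have y0 : 0 < y by rewrite divr_gt0 // lt_min d0.
  have hz : UHP (Complex t y : R[i]) by [].
  have zt : cmod (Complex t y - rC t) = y.
    have -> : Complex t y - rC t = Complex 0 y :> R[i].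
      by apply: complex_eqP; rewrite ?creB ?cimB /cre /cim /= ?subrr ?subr0.
    by rewrite /cmod /cre /cim /= expr0n add0r sqrtr_sqr gtr0_norm.
  have yd : y < d /\ y < d'.
    rewrite /y !ltr_pdivrMr //; split; apply: le_lt_trans (_ : Num.min d d' < _).
    + by [].
    + by rewrite gt_min; apply/orP; left; lra.
    + by [].
    + by rewrite gt_min; apply/orP; right; lra.
  by exists (Complex t y); [apply: h | apply: h'] => //; rewrite zt; case: yd.
- case: h => M h; case: h' => M' h'.
  pose y := `|M| + `|M'| + 1.
  have y0 : 0 < y by rewrite ltr_wpDl // addr_ge0.
  have hz : UHP (Complex 0 y : R[i]) by [].
  have zt : cmod (Complex 0 y : R[i]) = y.
    by rewrite /cmod /cre /cim /= expr0n add0r sqrtr_sqr gtr0_norm.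
  have := ler_norm M; have := ler_norm M'; have := normr_ge0 M; have := normr_ge0 M'.
  by exists (Complex 0 y); [apply: h | apply: h'] => //; rewrite zt /y; lra.
Qed.

End BoundaryValues.

(** * Products of real linear factors and their step densities *)

Section StepPotentials.
Context {R : realType}.
Local Notation cau := (@cauchym R).
Implicit Types (s : seq R) (z : R[i]) (t a : R).

(** The density whose potential is a logarithm of the product of the factors (z-a)/|i-a|. *)
Definition hl s t : R := \sum_(a <- s) \1_`]-oo, a[ t.

Lemma bmf_hl s : bmf (hl s).
Proof.
rewrite /hl; elim: s => [|a s IH].
  by under [X in bmf X]eq_fun do rewrite big_nil; exact: bmf_cst.
under [X in bmf X]eq_fun do rewrite big_cons.
by apply: bmfD => //; exact: bmf_indic.
Qed.

Lemma npot0 z : npot cau (fun=> 0) z = 0.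
Proof.
rewrite /npot -[RHS](mul0r (cintegral cau setT (fun=> 1))) -cintegralZ; last exact: cbmf_cst.
by apply: eq_cintegral => t _; rewrite rC0 mulr0 mul0r.
Qed.

Lemma npot_hl_cons a s z : UHP z ->
  npot cau (hl (a :: s)) z = npot cau (\1_`]-oo, a[) z + npot cau (hl s) z.
Proof.
move=> hz; rewrite -npotD //; [|exact: bmf_indic|exact: bmf_hl].
have -> // : hl (a :: s) = fun t => \1_`]-oo, a[ t + hl s t.
by apply/funext => t; rewrite /hl big_cons.
Qed.

Lemma npot_hl_nil z : npot cau (hl [::]) z = 0.
Proof.
have -> : hl [::] = fun=> 0 by apply/funext => t; rewrite /hl big_nil.
exact: npot0.
Qed.

Lemma prod_hl s z : UHP z -> \prod_(a <- s) (z - rC a) =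
  rC (\prod_(a <- s) cmod (iC - rC a)) * cexp (npot cau (hl s) z).
Proof.
move=> hz; elim: s => [|a s IH]; first by rewrite !big_nil npot_hl_nil cexp0 rC1 mulr1.
rewrite !big_cons IH npot_hl_cons // cexpD {1}(cexp_halfline hz a) rCM.
by ring.
Qed.

(** A continuous branch of the argument of the product of the z - a, each summand being the argument
    of one factor in (0, pi). *)
Definition theta s z : R := \sum_(a <- s) (atan ((a - cre z) / cim z) + pi / 2).

Lemma cim_npot_hl s z : UHP z -> cim (npot cau (hl s) z) = theta s z.
Proof.
move=> hz; rewrite /theta; elim: s => [|a s IH].
  by rewrite npot_hl_nil big_nil.
by rewrite npot_hl_cons // cimD IH big_cons npot_halfline.
Qed.

Lemma segment_gt0 (p q u : R) : 0 < p -> 0 < q -> 0 <= u <= 1 -> 0 < p + u * (q - p).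
Proof.
move=> p0 q0 /andP[u0 u1].
have -> : p + u * (q - p) = (1 - u) * p + u * q by ring.
have [->|u0'] := eqVneq u 0; first by rewrite subr0 mul1r mul0r addr0.
apply: ltr_wpDl; first by apply: mulr_ge0; [rewrite subr_ge0 | exact: ltW].
by apply: mulr_gt0 => //; rewrite lt_neqAle eq_sym u0' u0.
Qed.

Lemma theta_cont s (x0 x1 y0 y1 u : R) : 0 < y0 -> 0 < y1 -> 0 <= u <= 1 ->
  {for u, continuous (fun v : R => theta s (Complex (x0 + v * (x1 - x0)) (y0 + v * (y1 - y0))))}.
Proof.
move=> hy0 hy1 /andP[u0 u1]; rewrite /prop_for /continuous_at /theta /cre /cim /=.
have lin (p q : R) : p + v * q @[v --> u] --> p + u * q.
  by apply: cvgD; [exact: cvg_cst | apply: cvgM; [exact: cvg_id | exact: cvg_cst]].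
have pos : 0 < y0 + u * (y1 - y0) by apply: segment_gt0 => //; rewrite u0.
elim: s => [|a s IH].
  by rewrite big_nil; under eq_cvg do rewrite big_nil; exact: cvg_cst.
rewrite big_cons; under eq_cvg do rewrite big_cons.
apply: cvgD => //; apply: cvgD; last exact: cvg_cst.
have inner : (a - (x0 + v * (x1 - x0))) / (y0 + v * (y1 - y0)) @[v --> u] -->
    (a - (x0 + u * (x1 - x0))) / (y0 + u * (y1 - y0)).
  apply: cvgM; first by apply: cvgB; [exact: cvg_cst | exact: lin].
  by apply: cvgV; [rewrite gt_eqF | exact: lin].
by apply: cvg_comp inner _; exact: continuous_atan.
Qed.

Lemma theta_far s : theta s (Complex n%:R 1) @[n --> \oo] --> (0 : R).
Proof.
elim: s => [|a s IH].
  rewrite (_ : (fun n : nat => _) = fun=> 0); first exact: cvg_cst.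
  by apply/funext => n; rewrite /theta big_nil.
rewrite (_ : (fun n : nat => _) =
    fun n : nat => (- atan (n%:R - a) + pi / 2) + theta s (Complex n%:R 1)); last first.
  by apply/funext => n; rewrite /theta big_cons {1}/cre {1}/cim /= divr1 -atanN opprB.
rewrite -[X in _ --> X]addr0; apply: cvgD => //.
rewrite -[X in _ --> X](addNr (pi / 2)); apply: cvgD; last exact: cvg_cst.
apply: cvgN; apply: (cvg_comp (fun n : nat => n%:R - a)) (cvgy_atan (R := R)).
apply/cvgryPge => A; near=> n; rewrite lerBrDr.
by near: n; exact: nbhs_infty_ger.
Unshelve. all: by end_near. Qed.

(** Above [t] the argument of z - a tends to pi if t < a and to 0 if t > a. *)
Lemma theta_boundary s t : t \notin s ->
  theta s (Complex t n.+1%:R^-1) @[n --> \oo] --> pi * hl s t.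
Proof.
rewrite /theta /hl /cre /cim /=; elim: s => [|a s IH].
  by rewrite big_nil mulr0; under eq_cvg do rewrite big_nil; move=> _; exact: cvg_cst.
rewrite in_cons negb_or => /andP[ta ts].
rewrite big_cons mulrDr; under eq_cvg do rewrite big_cons.
apply: cvgD; last exact: IH.
rewrite indicE mem_setE in_itv /=; case: (ltgtP t a) ta => // ta _.
- rewrite mulr1; have {2}-> : pi = pi / 2 + pi / 2 :> R by field.
  apply: cvgD; last exact: cvg_cst.
  under eq_cvg do rewrite invrK.
  apply: (cvg_comp (fun n : nat => (a - t) * n.+1%:R)) (cvgy_atan (R := R)).
  apply/cvgryPge => A; near=> n.
  rewrite mulrC -ler_pdivrMr ?subr_gt0 // (@le_trans _ _ n%:R) //; last by rewrite ler_nat.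
  by near: n; exact: nbhs_infty_ger.
- rewrite mulr0 -[X in _ --> X](addNr (pi / 2)); apply: cvgD; last exact: cvg_cst.
  under eq_cvg => n do rewrite invrK -opprB mulNr atanN.
  apply: cvgN; apply: (cvg_comp (fun n : nat => (t - a) * n.+1%:R)) (cvgy_atan (R := R)).
  apply/cvgryPge => A; near=> n.
  rewrite mulrC -ler_pdivrMr ?subr_gt0 // (@le_trans _ _ n%:R) //; last by rewrite ler_nat.
  by near: n; exact: nbhs_infty_ger.
Unshelve. all: by end_near. Qed.

(* The argument [Theta] of the product is continuous and [sin Theta > 0], so it stays
   in [(0, pi)] once it is there for [z] far to the right; its boundary values bound the
   step function. *)
Lemma step_in01 (ra rb : seq R) (b : bool) :
  (forall z, UHP z -> 0 < sin (theta ra z - theta rb z + b%:R * pi)) ->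
  forall t, t \notin ra ++ rb -> 0 <= hl ra t - hl rb t + b%:R <= 1.
Proof.
move=> hsin; pose Th z := theta ra z - theta rb z + b%:R * pi.
have pi0 := pi_gt0 R.
have hsin' z : UHP z -> 0 < sin (Th z) by exact: hsin.
have [z0 hz0 Th0] : exists2 z0, UHP z0 & 0 < Th z0 < pi.
  have lim : Th (Complex n%:R 1) @[n --> \oo] --> b%:R * pi.
    rewrite -[X in _ --> X]add0r; apply: cvgD; last exact: cvg_cst.
    by rewrite -[X in _ --> X](subrr 0); apply: cvgB; exact: theta_far.
  have p2 : 0 < pi / 2 :> R by rewrite divr_gt0.
  move/cvgrPdist_lt: lim => /(_ _ p2) [n _ /(_ n (leqnn n))] /=.
  have hz : UHP (Complex n%:R 1 : R[i]) by rewrite /UHP /cim /=.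
  have hs := hsin' _ hz; rewrite ltr_norml => /andP[h1 h2].
  exists (Complex n%:R 1) => //.
  (* Far to the right the angle is within pi/2 of 0 or of pi; positivity of the sine decides on
     which side of that value it lies. *)
  move: (Th _) hs h1 h2 => th hs; case: (b) => /= h1 h2.
    rewrite mul1r in h1 h2; apply/andP; split; first lra.
    rewrite ltNge; apply/negP => pth.
    have : 0 <= sin (th - pi) by apply: sin_ge0_pi; lra.
    rewrite sinB cospi sinpi; lra.
  rewrite mul0r in h1 h2; apply/andP; split; last lra.
  rewrite ltNge; apply/negP => pth.
  have : 0 <= sin (- th) by apply: sin_ge0_pi; lra.
  by rewrite sinN; lra.
have inside z : UHP z -> 0 < Th z < pi.
  move=> hz; pose g u := Th (Complex (cre z0 + u * (cre z - cre z0)) (cim z0 + u * (cim z - cim z0))).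
  have g0 : g 0 = Th z0.
    by rewrite /g !mul0r !addr0; congr Th; case: (z0).
  have g1 : g 1 = Th z.
    by rewrite /g !mul1r !subrKC; congr Th; case: (z).
  have cg : {within `[0, 1], continuous g}.
    apply: continuous_in_subspaceT => u; rewrite inE /= in_itv /= => hu.
    apply: cvgD; last exact: cvg_cst.
    by apply: cvgB; exact: theta_cont.
  (* A zero of the sine between the values at the endpoints would be attained on the segment, which
     stays in C^+. *)
  have bad (v : R) : sin v = 0 -> (g 0 <= v <= g 1) || (g 1 <= v <= g 0) -> False.
    move=> sv hv; have [|u /[!in_itv]/= /andP[u0 u1] gu] := @IVT R g 0 1 v ler01 cg.
      by rewrite ge_min le_max; case/orP: hv => /andP[-> ->] //; rewrite !orbT.
    have : 0 < sin (g u); last by rewrite gu sv ltxx.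
    by apply: hsin'; rewrite /UHP /=; apply: segment_gt0 => //; rewrite u0.
  case/andP: Th0 => a1 a2; apply/andP; split; rewrite ltNge; apply/negP => h.
    apply: (bad 0 (sin0 R)); rewrite g0 g1; apply/orP; right; lra.
  apply: (bad pi (sinpi R)); rewrite g0 g1; apply/orP; left; lra.
move=> t; rewrite mem_cat negb_or => /andP[tra trb].
have lim : Th (Complex t n.+1%:R^-1) @[n --> \oo] --> pi * hl ra t - pi * hl rb t + b%:R * pi.
  by apply: cvgD; [apply: cvgB; exact: theta_boundary | exact: cvg_cst].
have hin n : 0 < Th (Complex t n.+1%:R^-1) < pi.
  by apply: inside; rewrite /UHP /cim /= invr_gt0 ltr0n.
have E : pi * hl ra t - pi * hl rb t + b%:R * pi = pi * (hl ra t - hl rb t + b%:R) by ring.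
rewrite E in lim; apply/andP; split.
- rewrite -(pmulr_rge0 _ pi0).
  by apply: (ler_cvg_to (cvg_cst 0) lim); apply: nearW => n; case/andP: (hin n) => /ltW.
- rewrite -(ler_pM2l pi0) mulr1.
  by apply: (ler_cvg_to lim (cvg_cst pi)); apply: nearW => n; case/andP: (hin n) => _ /ltW.
Qed.

Lemma ae_notin_seq (s : seq R) (P : R -> Prop) : (forall t, t \notin s -> P t) ->
  {ae (@lebesgue_measure R), forall t, P t}.
Proof.
move=> h; exists [set` s]; split.
- by apply: countable_measurable; try exact: measurable_set1; apply: finite_set_countable; exact: finite_seq.
- by apply: countable_lebesgue_measure0; apply: finite_set_countable; exact: finite_seq.
- move=> t /= nP; apply: contrapT => /negP ts; exact/nP/h.
Qed.

End StepPotentials.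

(** * Nevanlinna functions with finitely many atoms *)

Section AtomicMeasures.
Context {R : realType}.
Local Notation cau := (@cauchym R).
Implicit Types (alpha beta : R) (s : seq (R * R)) (z : R[i]).

(** The list holds pairs of a mass and its position. *)
Definition atomic (alpha beta : R) (s : seq (R * R)) (z : R[i]) : R[i] :=
  rC alpha * z + rC beta + \sum_(p <- s) rC p.1 * nkernel z p.2.

Let toC (p : {poly R}) : {poly R[i]} := map_poly (real_complex R) p.

Let toCM p q z : (toC (p * q)).[z] = (toC p).[z] * (toC q).[z].
Proof. by rewrite /toC rmorphM hornerM. Qed.
Let toCD p q z : (toC (p + q)).[z] = (toC p).[z] + (toC q).[z].
Proof. by rewrite /toC rmorphD hornerD. Qed.
Let toCN p z : (toC (- p)).[z] = - (toC p).[z].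
Proof. by rewrite /toC rmorphN hornerN. Qed.
Let toCC a z : (toC a%:P).[z] = rC a.
Proof. by rewrite /toC map_polyC hornerC. Qed.
Let toCX z : (toC 'X).[z] = z.
Proof. by rewrite /toC map_polyX hornerX. Qed.
Let toC1 z : (toC 1).[z] = 1.
Proof. by rewrite /toC rmorph1 hornerC. Qed.

(** Numerator and denominator over the common denominator. Keeping them as real polynomials makes
    the complex roots closed under conjugation. *)
Fixpoint atomic_frac (alpha beta : R) (s : seq (R * R)) : {poly R} * {poly R} :=
  if s is (m, t) :: s' then
    let PQ := atomic_frac alpha beta s' in
    (PQ.1 * (t%:P - 'X) + m%:P * (1 + t%:P * 'X) * PQ.2, PQ.2 * (t%:P - 'X))
  else (alpha%:P * 'X + beta%:P, 1).

Lemma atomic_denom alpha beta s z :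
  (toC (atomic_frac alpha beta s).2).[z] = \prod_(p <- s) (rC p.2 - z).
Proof.
elim: s => [|[m t] s IH] /=; first by rewrite toC1 big_nil.
by rewrite big_cons -IH !(toCM, toCD, toCN, toCC, toCX) mulrC.
Qed.

Lemma atomic_denom_neq0 alpha beta s z : UHP z ->
  (toC (atomic_frac alpha beta s).2).[z] != 0.
Proof.
move=> hz; rewrite atomic_denom prodf_seq_neq0; apply/allP => p _ /=.
exact: UHP_neq_real.
Qed.

Lemma atomic_fracE alpha beta s z : UHP z ->
  atomic alpha beta s z * (toC (atomic_frac alpha beta s).2).[z] =
  (toC (atomic_frac alpha beta s).1).[z].
Proof.
move=> hz; rewrite /atomic; elim: s => [|[m t] s IH] /=.
  by rewrite big_nil !(toCM, toCD, toCC, toCX, toC1) mulr1 addr0.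
rewrite big_cons /= !(toCM, toCD, toCN, toCC, toCX, toC1) -IH [nkernel z t]/nkernel.
by field; exact: UHP_neq_real.
Qed.

(** Strictness excludes zeros in C^+ and keeps the sine of the argument positive. *)
Lemma cim_atomic_gt0 alpha beta s z : UHP z -> 0 <= alpha ->
  all (fun p => 0 <= p.1) s -> 0 < alpha \/ 0 < \sum_(p <- s) p.1 ->
  0 < cim (atomic alpha beta s z).
Proof.
move=> hz a0 s0 pos.
have -> : cim (atomic alpha beta s z) =
    alpha * cim z + \sum_(p <- s) p.1 * cim (nkernel z p.2).
  rewrite /atomic !cimD cim_rCM cim_rC addr0; congr (_ + _).
  elim: (s) => [|p s' IH]; first by rewrite !big_nil.
  by rewrite !big_cons cimD IH cim_rCM.
have sum_ge0 : 0 <= \sum_(p <- s) p.1 * cim (nkernel z p.2).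
  rewrite big_seq sumr_ge0 // => p ps.
  by apply: mulr_ge0; [exact: (allP s0) | exact/ltW/cim_nkernel_gt0].
case: pos => pos; first by rewrite ltr_wpDr // mulr_gt0.
rewrite ltr_wpDl ?mulr_ge0 ?(ltW hz) // lt_neqAle sum_ge0 andbT eq_sym.
apply: contraTneq pos; rewrite big_seq => /eqP.
rewrite psumr_eq0 => [/allP h|p ps]; last first.
  by apply: mulr_ge0; [exact: (allP s0) | exact/ltW/cim_nkernel_gt0].
rewrite big_seq big1 ?ltxx // => p ps.
have := h p ps; rewrite ps /= mulf_eq0 (gt_eqF (cim_nkernel_gt0 _ hz)) orbF.
by move/eqP.
Qed.

(** The numerator splits over the complex numbers. It has no root in C^+, where the function has
    positive imaginary part, and none in the lower half-plane by conjugation, so all roots are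
    real. *)
Lemma atomic_factor alpha beta s : 0 <= alpha ->
  all (fun p => 0 <= p.1) s -> 0 < alpha \/ 0 < \sum_(p <- s) p.1 ->
  exists (c : R) (ra rb : seq R), forall z, UHP z ->
    atomic alpha beta s z =
    rC c * \prod_(a <- ra) (z - rC a) / \prod_(a <- rb) (z - rC a).
Proof.
move=> a0 s0 pos.
set P := (atomic_frac alpha beta s).1; set Q := (atomic_frac alpha beta s).2.
have gn0 z : UHP z -> atomic alpha beta s z != 0.
  move=> hz; have := cim_atomic_gt0 beta hz a0 s0 pos; apply: contraTneq => ->.
  by rewrite cim0 ltxx.
have Pn0 z : UHP z -> (toC P).[z] != 0.
  by move=> hz; rewrite -atomic_fracE // mulf_neq0 ?gn0 // atomic_denom_neq0.
have Pconj z : (toC P).[conjc z] = conjc (toC P).[z].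
  have E : map_poly (@conjc R) (toC P) = toC P.
    rewrite /toC -map_poly_comp; apply: eq_map_poly => x /=.
    by apply: complex_eqP; rewrite /cre /cim /= ?oppr0.
  by rewrite -{1}E horner_map.
have [r rE] := closed_field_poly_normal (toC P).
have rreal a : a \in r -> a = rC (cre a).
  move=> ar; have Pa : (toC P).[a] = 0.
    by rewrite rE hornerZ; apply/eqP; rewrite mulf_eq0; apply/orP; right;
       have := root_prod_XsubC r a; rewrite ar => /rootP ->.
  apply: complex_eqP => //; rewrite cim_rC; apply/eqP; apply/negPn/negP => n0.
  have [lt|gt|c0] := ltgtP (cim a) 0; last by move: n0; rewrite c0 eqxx.
    have hz : UHP (conjc a).
      by move: lt; rewrite /UHP /cim; case: (a) => u v /=; rewrite oppr_gt0.
    by have := Pn0 _ hz; rewrite Pconj Pa /conjc /= oppr0 eqxx.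
  by have := Pn0 _ gt; rewrite Pa eqxx.
(* The sign converts the denominators t - z into factors z - t. *)
exists ((-1) ^+ size s * lead_coef P), (map cre r), (map snd s) => z hz.
have lc : lead_coef (toC P) = rC (lead_coef P) by rewrite /toC lead_coef_map.
have -> : \prod_(a <- map cre r) (z - rC a) = \prod_(a <- r) (z - a).
  by rewrite big_map big_seq [RHS]big_seq; apply: eq_bigr => a /rreal <-.
have QE : (toC Q).[z] = (-1) ^+ size s * \prod_(a <- map snd s) (z - rC a).
  rewrite atomic_denom big_map; elim: (s) => [|p s' IH]; first by rewrite !big_nil mulr1.
  by rewrite !big_cons IH /= exprS; ring.
have PE : (toC P).[z] = rC (lead_coef P) * \prod_(a <- r) (z - a).
  rewrite rE hornerZ lc horner_prod; congr (_ * _).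
  by apply: eq_bigr => a _; rewrite hornerXsubC.
have Qn0 := atomic_denom_neq0 alpha beta s hz.
have := atomic_fracE alpha beta s hz; rewrite -/P -/Q in Qn0 * => h.
apply: (mulIf Qn0); rewrite h PE QE.
have sg : (-1) ^+ size s * (-1) ^+ size s = 1 :> R[i].
  by rewrite -exprD addnn -mul2n exprM sqrrN expr1n expr1n.
have pr : \prod_(a <- map snd s) (z - rC a) != 0.
  by apply: contraTneq Qn0 => h0; rewrite QE h0 mulr0 eqxx.
have -> : rC ((-1) ^+ size s * lead_coef P) = (-1) ^+ size s * rC (lead_coef P) :> R[i].
  by rewrite !rCE rmorphM rmorphXn rmorphN1.
rewrite [RHS](_ : _ = ((-1) ^+ size s * (-1) ^+ size s) * (rC (lead_coef P) * \prod_(a <- r) (z - a))).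
  by rewrite sg mul1r.
by field.
Qed.

Lemma cexp_npot_line z : UHP z -> cexp (npot cau (cst 1) z) = -1.
Proof. by move=> hz; rewrite npot_line // cexp_ipi. Qed.

(** The potential is purely imaginary at i, so the exponential has modulus 1 there. *)
Lemma cmod_exp_rep (g : R[i] -> R[i]) (k : R) (xi : R -> R) : 0 <= k -> bmf xi ->
  (forall z, UHP z -> g z = rC k * cexp (npot cau xi z)) -> k = cmod (g iC).
Proof.
move=> k0 bx ->; last by rewrite /UHP /cim /=.
by rewrite cmodM cmod_cexp npot_i // expR0 mulr1 cmod_rC ger0_norm.
Qed.

Lemma atomic_exp_rep alpha beta s : 0 <= alpha ->
  all (fun p => 0 <= p.1) s -> 0 < alpha \/ 0 < \sum_(p <- s) p.1 ->
  exists xi : R -> R, [/\ measurable_fun setT xi, forall t, 0 <= xi t <= 1 &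
    forall z, UHP z -> atomic alpha beta s z =
      rC (cmod (atomic alpha beta s iC)) * cexp (npot cau xi z)].
Proof.
move=> a0 s0 pos; have [c [ra [rb facE]]] := atomic_factor beta a0 s0 pos.
set g := atomic alpha beta s in facE *.
have gpos z : UHP z -> 0 < cim (g z) by move=> hz; exact: cim_atomic_gt0.
(* A negative constant is |c| e^(i pi), so it adds the constant density 1. *)
pose b := c < 0.
pose n t := hl ra t - hl rb t + b%:R.
have bra := bmf_hl ra; have brb := bmf_hl rb.
have bn : bmf n by apply: bmfD; [exact: bmfB | exact: bmf_cst].
pose K := `|c| * (\prod_(a <- ra) cmod (iC - rC a)) / (\prod_(a <- rb) cmod (iC - rC a)).
have nE z : UHP z -> npot cau n z = npot cau (hl ra) z - npot cau (hl rb) z + rC b%:R * npot cau (cst 1) z.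
  move=> hz; rewrite -npotB // -npotZ //; last exact: bmf_cst.
  rewrite -npotD //; [|exact: bmfB|by apply: bmfM; exact: bmf_cst].
  by congr npot; apply/funext => t; rewrite /n mulr1.
have gE z : UHP z -> g z = rC K * cexp (npot cau n z).
  move=> hz; rewrite facE // !prod_hl // nE // !cexpD cexpN /K !rCM rCV.
  have cb : rC c = rC `|c| * cexp (rC b%:R * npot cau (cst 1) z).
    rewrite /b; case: (ltP c 0) => c0.
      by rewrite rC1 mul1r cexp_npot_line // ltr0_norm // rCN mulrN mulr1 opprK.
    by rewrite rC0 mul0r cexp0 mulr1 ger0_norm.
  rewrite cb; field; rewrite cexp_neq0 rC_eq0 /=.
  rewrite prodf_seq_neq0; apply/allP => a _ /=.
  by rewrite -rC_eq0 cmod_i_sub_neq0.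
have K0 : 0 <= K.
  by rewrite /K !mulr_ge0 // ?invr_ge0 ?prodr_ge0 // => *; exact: cmod_ge0.
have hin := @step_in01 R ra rb b.
have {}hin : forall t, t \notin ra ++ rb -> 0 <= n t <= 1.
  apply: hin => z hz.
  have := gpos z hz; rewrite gE // cim_rCM.
  rewrite -[cim (cexp _)]/(expR (cre (npot cau n z)) * sin (cim (npot cau n z))).
  have -> : cim (npot cau n z) = theta ra z - theta rb z + b%:R * pi.
    by rewrite nE // cimD cimB !cim_npot_hl // cim_rCM npot_line.
  have [->|Kn0] := eqVneq K 0; first by rewrite mul0r ltxx.
  have Kpos : 0 < K by rewrite lt_neqAle eq_sym Kn0 K0.
  by rewrite (pmulr_rgt0 _ Kpos) pmulr_rgt0 // expR_gt0.
(* The bounds on [n] are known off the finite set of roots and poles; clamping enforces them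
   everywhere and changes [n] on a null set only. *)
pose xi t := Num.max 0 (Num.min 1 (n t)).
have xi01 t : 0 <= xi t <= 1.
  by rewrite /xi le_max lexx /= ge_max ler01 ge_min lexx.
have mxi : measurable_fun setT xi.
  apply: measurable_maxr; first exact: measurable_cst.
  by apply: measurable_minr; [exact: measurable_cst | case: bn].
have bxi : bmf xi by exact: bmf01.
have gE' z : UHP z -> g z = rC K * cexp (npot cau xi z).
  move=> hz; rewrite gE // (eq_npot_ae hz bn bxi) //.
  apply: (@ae_notin_seq R (ra ++ rb)) => t /hin /andP[h0 h1].
  by rewrite /xi min_r // max_r.
exists xi; split => // z hz; rewrite -(cmod_exp_rep K0 bxi gE'); exact: gE'.
Qed.

End AtomicMeasures.

(** * Weak limits of densities along an ultrafilter *)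

Lemma ultra_bounded_cvg (R : realType) (U : set_system nat) (u : nat -> R) (B : R) :
  UltraFilter U -> (forall n, `|u n| <= B) -> cvg (u @ U).
Proof.
move=> UU uB.
have UP : ProperFilter U by exact: ultra_proper.
have cK : compact `[- B, B]%classic by exact: segment_compact.
have [p [_ clp]] : `[- B, B]%classic `&` cluster (u @ U) !=set0.
  apply: cK; rewrite /= /fmap /mkset (_ : _ @^-1` _ = setT); first exact: filterT.
  by apply/seteqP; split => // n _ /=; rewrite in_itv /= -ler_norml.
apply/cvg_ex; exists p => V Vp /=.
(* An ultrafilter contains the preimage of [V] or of its complement, and the latter contradicts that
   [p] is a cluster point. *)
have [//|h] := in_ultra_setVsetC (u @^-1` V) UU.
by have [x [/= nV /nV]] := clp (~` V) V h Vp.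
Qed.

Section WeakLimit.
Context d (T : measurableType d) (R : realType).
Variable mu : {finite_measure set T -> \bar R}.
Variable U : set_system nat.
Variable UU : UltraFilter U.
Variable xi_ : nat -> T -> R.
Hypothesis mxi : forall n, measurable_fun setT (xi_ n).
Hypothesis xi01 : forall n t, 0 <= xi_ n t <= 1.

Let UP : ProperFilter U. Proof. exact: ultra_proper. Qed.

Let bxi n : bmf (xi_ n). Proof. exact: bmf01. Qed.

Definition wint (k : T -> R) (n : nat) : R := \int[mu]_t (k t * xi_ n t).

(** One ultrafilter yields this limit for all bounded [k] simultaneously, hence a linear
    functional. *)
Definition wlim (k : T -> R) : R := lim (wint k @ U).

Lemma wint_bound k n M : bmf k -> (forall t, `|k t| <= M) ->
  `|wint k n| <= M * fine (mu setT).
Proof.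
move=> bk kM; apply: bmf_integral_norm; first exact: bmfM.
move=> t; rewrite normrM; have /andP[x0 x1] := xi01 n t.
by rewrite (le_trans _ (kM t)) // ler_piMr // ger0_norm.
Qed.

Lemma wlimP k : bmf k -> wint k @ U --> wlim k.
Proof.
move=> bk; have [_ [M kM]] := bk.
exact: (ultra_bounded_cvg UU (fun n => wint_bound n bk kM)).
Qed.

Lemma wlim_unique k l : wint k @ U --> l -> wlim k = l.
Proof. by move=> h; exact: (cvg_lim (@Rhausdorff R) h). Qed.

Lemma wintD k k' n : bmf k -> bmf k' -> wint (fun t => k t + k' t) n = wint k n + wint k' n.
Proof.
move=> bk bk'; rewrite /wint -bmf_integralD; try exact: bmfM.
by apply: eq_Rintegral => t _; rewrite mulrDl.
Qed.

Lemma wintZ c k n : bmf k -> wint (fun t => c * k t) n = c * wint k n.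
Proof.
move=> bk; rewrite /wint -bmf_integralZ; last exact: bmfM.
by apply: eq_Rintegral => t _; rewrite mulrA.
Qed.

Lemma wlimD k k' : bmf k -> bmf k' -> wlim (fun t => k t + k' t) = wlim k + wlim k'.
Proof.
move=> bk bk'; apply: wlim_unique.
rewrite (_ : wint _ = fun n => wint k n + wint k' n); last by apply/funext => n; exact: wintD.
by apply: cvgD; exact: wlimP.
Qed.

Lemma wlimZ c k : bmf k -> wlim (fun t => c * k t) = c * wlim k.
Proof.
move=> bk; apply: wlim_unique.
rewrite (_ : wint _ = fun n => c * wint k n); last by apply/funext => n; exact: wintZ.
by apply: cvgM; [exact: cvg_cst | exact: wlimP].
Qed.

Lemma wlim_ge0 k : bmf k -> (forall t, 0 <= k t) -> 0 <= wlim k.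
Proof.
move=> bk k0; apply: (ler_cvg_to (cvg_cst 0) (wlimP bk)); apply: nearW => n.
by apply: Rintegral_ge0 => t _; rewrite mulr_ge0 //; case/andP: (xi01 n t).
Qed.

Lemma wlim_le k : bmf k -> (forall t, 0 <= k t) -> wlim k <= \int[mu]_t k t.
Proof.
move=> bk k0; apply: (ler_cvg_to (wlimP bk) (cvg_cst _)); apply: nearW => n.
apply: bmf_le_integral => //; first exact: bmfM.
by move=> t; rewrite ler_piMr //; case/andP: (xi01 n t).
Qed.

(** The limit functional on indicators; 0 is a default value off the measurable sets. *)
Definition wmeasure (A : set T) : \bar R :=
  if `[< measurable A >] then (wlim (\1_A))%:E else 0%E.

Let wmeasureE A : measurable A -> wmeasure A = (wlim (\1_A))%:E.
Proof. by move=> mA; rewrite /wmeasure asboolT. Qed.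

Let bmf_sum (A : nat -> set T) n : (forall i, measurable (A i)) ->
  bmf (fun t => \sum_(0 <= i < n) \1_(A i) t : R).
Proof.
move=> mA; elim: n => [|n IH].
  by under [X in bmf X]eq_fun do rewrite big_nil; exact: bmf_cst.
under [X in bmf X]eq_fun do rewrite big_nat_recr //=.
by apply: bmfD => //; exact: bmf_indic.
Qed.

Let wlim0 : wlim (fun=> 0) = 0.
Proof.
apply: wlim_unique; rewrite (_ : wint _ = fun=> 0); first exact: cvg_cst.
apply/funext => n; rewrite /wint; under eq_Rintegral do rewrite mul0r.
by rewrite integral_cstT mul0r.
Qed.

Let wmeasure0 : wmeasure set0 = 0%E.
Proof.
rewrite wmeasureE // (_ : \1_set0 = fun=> 0) ?wlim0 //.
by apply/funext => t; rewrite indic0.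
Qed.

Let wmeasure_ge0 A : (0 <= wmeasure A)%E.
Proof.
rewrite /wmeasure; case: asboolP => // mA; rewrite lee_fin.
by apply: wlim_ge0; [exact: bmf_indic | move=> t; rewrite indicE].
Qed.

(* Countable additivity is inherited from the dominating measure [mu]. *)
Let wmeasure_additive : semi_sigma_additive wmeasure.
Proof.
move=> A mA tA mUA; rewrite wmeasureE //.
rewrite (_ : (fun n => _) = fun n => (\sum_(0 <= i < n) wlim (\1_(A i)))%:E); last first.
  by apply/funext => n; rewrite -sumEFin; apply: eq_bigr => i _; rewrite wmeasureE.
apply: cvg_EFin; first exact: nearW.
rewrite /=; pose V := \bigcup_i A i.
have bV : bmf (\1_V : T -> R) by exact: bmf_indic.
have bs n := bmf_sum n mA.
have sumE n : \sum_(0 <= i < n) wlim (\1_(A i)) = wlim (fun t => \sum_(0 <= i < n) \1_(A i) t).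
  elim: n => [|n IH].
    by rewrite big_nil -wlim0; congr wlim; apply/funext => t; rewrite big_nil.
  rewrite big_nat_recr //= IH -wlimD //; last exact: bmf_indic.
  by congr wlim; apply/funext => t; rewrite big_nat_recr.
have inE j t n : A j t -> \sum_(0 <= i < n) \1_(A i) t = (j < n)%N%:R :> R.
  move=> Ajt; elim: n => [|n IH]; first by rewrite big_nil.
  rewrite big_nat_recr //= IH ltnS [in RHS]leq_eqVlt indicE.
  have [nj|nj] := eqVneq j n.
    by rewrite -nj ltnn add0r mem_set.
  rewrite memNset ?addr0 // => Ant.
  have := tA j n I I; move/eqP: nj => nj /(_ _) h; apply: nj; apply: h.
  by exists t.
have outE t n : ~ V t -> \sum_(0 <= i < n) \1_(A i) t = 0 :> R.
  move=> nV; rewrite big1 // => i _; rewrite indicE memNset // => Ait.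
  by apply: nV; exists i.
pose dif n t : R := \1_V t - \sum_(0 <= i < n) \1_(A i) t.
have bdif n : bmf (dif n) by exact: bmfB.
have dif01 n t : 0 <= dif n t <= 1.
  rewrite /dif indicE; have [[j _ Ajt]|nV] := pselect (V t).
    rewrite (inE j) // mem_set; last by exists j.
    by case: (j < n)%N; rewrite ?subrr ?subr0 ?lexx ?ler01.
  by rewrite outE // memNset // subrr lexx ler01.
have lim : \int[mu]_t dif n t @[n --> \oo] --> (0 : R).
  have -> : (0 : R) = \int[mu]_t (fun=> 0) t by rewrite integral_cstT mul0r.
  apply: (@bmf_dominated _ _ _ _ _ _ 1) => //; first exact: bmf_cst.
    by move=> n t; case/andP: (dif01 n t) => h1 h2; rewrite ger0_norm.
  move=> t; apply: cvg_near_cst; rewrite /dif indicE.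
  have [[j _ Ajt]|nV] := pselect (V t).
    exists j.+1 => // n /= jn; rewrite (inE j) // jn mem_set ?subrr //; by exists j.
  by apply: nearW => n; rewrite outE // memNset // subrr.
apply/cvgrPdist_le => e e0; move/cvgrPdist_le: lim => /(_ _ e0).
apply: filterS => n; rewrite sub0r normrN => h.
have -> : wlim (\1_V) - \sum_(0 <= i < n) wlim (\1_(A i)) = wlim (dif n).
  rewrite sumE -[X in _ - X]mul1r -mulNr -wlimZ // -wlimD //; last first.
    by apply: bmfM => //; exact: bmf_cst.
  by congr wlim; apply/funext => t; rewrite /dif mulN1r.
have d0 t : 0 <= dif n t by case/andP: (dif01 n t).
rewrite ger0_norm; last exact: wlim_ge0.
by apply: le_trans (wlim_le (bdif n) d0) _; apply: le_trans (ler_norm _) h.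
Qed.

HB.instance Definition _ := isMeasure.Build _ _ _
  wmeasure wmeasure0 wmeasure_ge0 wmeasure_additive.

Let wmeasure_fin : fin_num_fun wmeasure.
Proof. by move=> A mA; rewrite wmeasureE. Qed.

HB.instance Definition _ := @Measure_isFinite.Build _ _ _ wmeasure wmeasure_fin.

Let fine_mu A : measurable A -> \int[mu]_t \1_A t = fine (mu A).
Proof.
by move=> mA; rewrite /Rintegral integral_indic // setIT.
Qed.

Let wmeasure_le A : measurable A -> (wmeasure A <= mu A)%E.
Proof.
move=> mA; rewrite wmeasureE // -[leRHS]fineK ?fin_num_measure // lee_fin -fine_mu //.
by apply: wlim_le; [exact: bmf_indic | move=> t; rewrite indicE].
Qed.

Let wmeasure_dom : wmeasure `<< mu.
Proof.
apply/null_content_dominatesP => A mA A0.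
by apply/eqP; rewrite eq_le measure_ge0 andbT -A0; exact: wmeasure_le.
Qed.

(** The density is that of [wmeasure] with respect to [mu]. The identity then holds for indicators
    by construction and is carried to bounded functions by dyadic expansion. *)
Lemma weak_limit : exists xi : T -> R, [/\ measurable_fun setT xi,
  forall t, 0 <= xi t <= 1 &
  forall k, bmf k -> wint k @ U --> \int[mu]_t (k t * xi t)].
Proof.
have [g [g0 gfin gint gE]] := radon_nikodym_sigma_finite wmeasure_dom.
pose eta t := fine (g t).
have etaE t : (eta t)%:E = g t by rewrite fineK.
have meta : measurable_fun setT eta.
  by apply/measurable_EFinP; rewrite (_ : _ \o _ = g); [exact: measurable_int gint|apply/funext].
have eta0 t : 0 <= eta t by rewrite fine_ge0.
(* The integral of [eta - 1] over [B] is [wmeasure B - mu B <= 0] although the integrand is positive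
   there, so [B] is null and truncating [eta] at 1 is harmless. *)
pose B := [set t | 1 < eta t].
have mB : measurable B.
  have := @measurable_fun_ltr _ _ _ setT (cst 1) eta (measurable_cst _) meta.
  move=> /(_ measurableT [set true] I); rewrite setTI.
  by rewrite (_ : _ @^-1` _ = B).
have B0 : mu B = 0%E.
  have i1 : mu.-integrable B (fun t => g t - 1%:E)%E.
    apply: integrableB => //; first exact: integrableS gint.
    exact: finite_measure_integrable_cst.
  have I0 : (\int[mu]_(t in B) `|g t - 1%:E| = 0)%E.
    rewrite (eq_integral (fun t => g t - 1%:E)%E); last first.
      move=> t; rewrite inE /B /= => Bt; rewrite gee0_abs // -etaE lee_fin subr_ge0 ltW //.
    apply/eqP; rewrite eq_le; apply/andP; split; last first.
      apply: integral_ge0 => t; rewrite /B /= => Bt.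
      by rewrite -etaE lee_fin subr_ge0 ltW.
    rewrite integralB //; [|exact: integrableS gint|exact: finite_measure_integrable_cst].
    by rewrite -gE // integral_cst // mul1e sube_le0; exact: wmeasure_le.
  have mg : measurable_fun B (fun t => g t - 1%:E)%E by exact: measurable_int i1.
  have /(ae_eq_integral_abs mu mB mg) := I0.
  move=> [N [mN N0 sub]]; apply/eqP; rewrite -measure_le0 -N0; apply: le_measure; rewrite ?inE //.
  move=> t Bt; apply: sub => /= /(_ Bt); rewrite -etaE => -[] /eqP.
  by rewrite subr_eq0 => /eqP h; move: Bt; rewrite /B /= h ltxx.
pose xi t := Num.min 1 (eta t).
have xi01' t : 0 <= xi t <= 1 by rewrite /xi le_min ler01 eta0 ge_min lexx.
have mx : measurable_fun setT xi by apply: measurable_minr => //; exact: measurable_cst.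
have bx : bmf xi by exact: bmf01.
exists xi; split => //.
have base A : measurable A -> wlim (\1_A) = \int[mu]_t (\1_A t * xi t).
  move=> mA; have := wmeasureE mA; rewrite gE // => h.
  apply: EFin_inj; rewrite -h /Rintegral fineK; last first.
    apply: integrable_fin_num => //; apply: (@bmf_integrable _ _ _ mu) => //.
    by apply: bmfM => //; exact: bmf_indic.
  rewrite [LHS]integral_mkcond.
  apply: (@ae_eq_integral _ _ _ mu setT (fun t => (\1_A t * xi t)%:E) (g \_ A)) => //.
  - by apply/(measurable_restrictT _ mA); exact: measurable_funTS (measurable_int _ gint).
  - by apply/measurable_EFinP; apply: measurable_funM => //; exact: measurable_indic.
  exists B; split => // t /= /not_implyP[_ nE]; apply: contrapT => nB; apply: nE.
  rewrite patchE indicE; case: (t \in A); rewrite ?mul0r // mul1r -etaE /xi min_r //.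
  by rewrite leNgt; apply/negP.
(* The defect is linear and vanishes on indicators; halving it repeatedly shows that it vanishes on
   functions with values in [0, 1]. *)
pose La k := wlim k - \int[mu]_t (k t * xi t).
have LaD k k' : bmf k -> bmf k' -> La (fun t => k t + k' t) = La k + La k'.
  move=> bk bk'; rewrite /La wlimD //.
  under eq_Rintegral do rewrite mulrDl.
  by rewrite bmf_integralD; [ring|exact: bmfM|exact: bmfM].
have LaZ c k : bmf k -> La (fun t => c * k t) = c * La k.
  move=> bk; rewrite /La wlimZ //.
  under eq_Rintegral do rewrite -mulrA.
  by rewrite bmf_integralZ; [ring|exact: bmfM].
have La1 A : measurable A -> La (\1_A) = 0 by move=> mA; rewrite /La base // subrr.
pose m := fine (mu setT).
(* [k = (1_A + k') / 2] with [A = {k >= 1/2}] and [k'] again between 0 and 1 *)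
have small (j : nat) : forall k : T -> R, measurable_fun setT k -> (forall t, 0 <= k t <= 1) ->
    `|La k| <= m * (2^-1) ^+ j.
  elim: j => [|j IH] k mk k01.
    have bk : bmf k by exact: bmf01.
    have k0 t : 0 <= k t by case/andP: (k01 t).
    have im : \int[mu]_t k t <= m.
      rewrite /m -[fine _]mul1r -integral_cstT; apply: bmf_le_integral => //; first exact: bmf_cst.
      by move=> t; case/andP: (k01 t).
    have a1 := wlim_ge0 bk k0; have a2 := wlim_le bk k0.
    have a3 : 0 <= \int[mu]_t (k t * xi t).
      by apply: Rintegral_ge0 => t _; rewrite mulr_ge0 //; case/andP: (xi01' t).
    have a4 : \int[mu]_t (k t * xi t) <= \int[mu]_t k t.
      apply: bmf_le_integral => //; first exact: bmfM.
      by move=> t; rewrite ler_piMr //; case/andP: (xi01' t).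
    by rewrite expr0 mulr1 /La ler_norml; lra.
  pose A := [set t | 2^-1 <= k t].
  have mA : measurable A.
    have := @measurable_fun_ler _ _ _ setT (cst 2^-1) k (measurable_cst _) mk.
    move=> /(_ measurableT [set true] I); rewrite setTI.
    by rewrite (_ : _ @^-1` _ = A).
  pose k' t := 2 * k t - \1_A t.
  have mk' : measurable_fun setT k'.
    apply: measurable_funB; last exact: measurable_indic.
    by apply: measurable_funM => //; exact: measurable_cst.
  have k'01 t : 0 <= k' t <= 1.
    rewrite /k' indicE; have /andP[h0 h1] := k01 t.
    have [At|nAt] := pselect (A t).
      by rewrite (mem_set At) /= mulr1n; move: At; rewrite /A /= => h; lra.
    rewrite (memNset nAt) /= subr0; move: nAt; rewrite /A /= => /negP; rewrite -ltNge => h; lra.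
  have bk' : bmf k' by exact: bmf01.
  have bA : bmf (\1_A : T -> R) by exact: bmf_indic.
  have kE : k = fun t => 2^-1 * (\1_A t + k' t) by apply/funext => t; rewrite /k'; field.
  rewrite kE LaZ; last exact: bmfD.
  rewrite LaD // La1 // add0r normrM ger0_norm // exprS mulrCA ler_pM2l //.
  exact: IH.
have La0 (k : T -> R) : measurable_fun setT k -> (forall t, 0 <= k t <= 1) -> La k = 0.
  move=> mk k01; apply/eqP; rewrite -normr_eq0 eq_le normr_ge0 andbT.
  have lim : m * (2^-1) ^+ j @[j --> \oo] --> m * 0.
    apply: cvgM; first exact: cvg_cst.
    by apply: cvg_expr; rewrite ger0_norm // invf_lt1 // ltr1n.
  rewrite mulr0 in lim.
  apply: (ler_cvg_to (cvg_cst _) lim); apply: nearW => j; exact: small.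
move=> k bk; suff -> : \int[mu]_t (k t * xi t) = wlim k by exact: wlimP.
apply/eqP; rewrite eq_sym -subr_eq0 -/(La k); apply/eqP.
have [mk [M kM]] := bk.
(* An affine change of scale maps the range of [k] into [0, 1]; the added 1 makes C positive. *)
pose C : R := `|M| + 1; have C0 : 0 < C by rewrite ltr_wpDl.
pose k1 t : R := (2 * C)^-1 * (k t + C).
have bk1 : bmf k1 by apply: bmfM; [exact: bmf_cst | apply: bmfD => //; exact: bmf_cst].
have k101 t : 0 <= k1 t <= 1.
  have := le_trans (kM t) (ler_norm M); rewrite ler_norml => h.
  rewrite /k1 mulrC divr_ge0 ?ler_pdivrMr ?mulr_gt0 ?mulr_ge0 ?(ltW C0) //=; rewrite /C; lra.
have -> : k = fun t => (2 * C) * k1 t + (- C) * \1_setT t.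
  by apply/funext => t; rewrite /k1 indicT /cst /=; field; rewrite gt_eqF.
rewrite LaD; [|by apply: bmfM => //; exact: bmf_cst|by apply: bmfM; [exact: bmf_cst|exact: bmf_indic]].
have b1 : bmf (\1_setT : T -> R) by exact: bmf_indic.
rewrite (LaZ _ k1) // (LaZ _ (\1_setT)) //.
by rewrite La1 // La0 ?mulr0 ?addr0 //; case: bk1.
Qed.

End WeakLimit.

(** * Approximation of a finite measure by atoms *)

Section Discretization.
Context {R : realType}.
Local Notation T := (measurableTypeR R).
Variable rho : {finite_measure set T -> \bar R}.

(** Mesh 1/(n+1) on [-(n+1), n+1[, hence 2(n+1)^2 cells: the mesh shrinks while the range grows. *)
Definition grid (n i : nat) : R := i%:R / n.+1%:R - n.+1%:R.
Definition gridK (n : nat) : nat := (2 * n.+1 ^ 2)%N.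
Definition cell (n i : nat) : set T := `[grid n i, grid n i.+1[%classic.

Let grid_step n i : grid n i.+1 = grid n i + n.+1%:R^-1.
Proof. by rewrite /grid -natr1 mulrDl mul1r addrAC. Qed.

Let gridE n : grid n (gridK n) = n.+1%:R.
Proof.
rewrite /grid /gridK natrM natrX.
by have : (n.+1%:R : R) != 0 by []; move: (n.+1%:R : R) => N N0; field.
Qed.

(** The mass of each cell sits at its left endpoint; mass outside the grid is dropped. *)
Definition atoms n : seq (R * R) :=
  [seq (fine (rho (cell n i)), grid n i) | i <- iota 0 (gridK n)].

Let discr (g : R -> R) n t : R := \sum_(i <- iota 0 (gridK n)) g (grid n i) * \1_(cell n i) t.

Let measurable_cell n i : measurable (cell n i).
Proof. by rewrite /cell; exact: measurable_itv. Qed.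

Let bmf_cell (c : R) n i : bmf (fun t : T => c * \1_(cell n i) t).
Proof. by apply: bmfM; [exact: bmf_cst | exact: bmf_indic]. Qed.

Let bmf_cells (g : R -> R) n s :
  bmf (fun t : T => \sum_(i <- s) g (grid n i) * \1_(cell n i) t).
Proof.
elim: s => [|i s IH].
  by under [X in bmf X]eq_fun do rewrite big_nil; exact: bmf_cst.
by under [X in bmf X]eq_fun do rewrite big_cons; exact: bmfD.
Qed.

Let bmf_discr g n : bmf (discr g n : T -> R). Proof. exact: bmf_cells. Qed.

Let integral_discr g n : \int[rho]_t discr g n t = \sum_(p <- atoms n) p.1 * g p.2.
Proof.
rewrite /atoms /discr big_map; elim: (iota _ _) => [|i s IH].
  by under eq_Rintegral do rewrite big_nil; rewrite big_nil integral_cstT mul0r.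
under eq_Rintegral do rewrite big_cons.
rewrite big_cons bmf_integralD // IH bmf_integralZ; last exact: bmf_indic.
by rewrite {1}/Rintegral integral_indic // setIT mulrC.
Qed.

Let sum_cells n t : \sum_(i <- iota 0 (gridK n)) \1_(cell n i) t =
  \1_(`[- n.+1%:R, n.+1%:R[%classic : set T) t :> R.
Proof.
have key k : \sum_(i <- iota 0 k) \1_(cell n i) t = \1_(`[- n.+1%:R, grid n k[%classic : set T) t :> R.
  elim: k => [|k IH].
    by rewrite big_nil /grid mul0r sub0r set_itvco0 indic0.
  have n0 : (0 : R) < n.+1%:R^-1 by rewrite invr_gt0 ltr0n.
  have g0 : - n.+1%:R <= grid n k by rewrite /grid lerBrDl subrr divr_ge0.
  rewrite -addn1 iotaD big_cat /= IH big_seq1 add0n !indicE !mem_setE addn1 !in_itv /= grid_step.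
  case: (leP (- n.+1%:R) t) => ht /=; last first.
    by rewrite add0r [grid n k <= t]leNgt (lt_le_trans ht).
  case: (ltP t (grid n k)) => hk /=; last by rewrite add0r.
  by rewrite (lt_trans hk) ?ltrDl // addr0.
by rewrite key gridE.
Qed.

(** The atomic sum is the integral of the step function sampling [g] at left endpoints, which
    converges pointwise by continuity and stays bounded by the bound of [g]. *)
Lemma atoms_cvg (g : R -> R) : continuous g -> bmf (g : T -> R) ->
  \sum_(p <- atoms n) p.1 * g p.2 @[n --> \oo] --> \int[rho]_t g t.
Proof.
move=> cg bg; have [_ [M gM]] := bg.
under eq_cvg do rewrite -integral_discr.
have M0 : 0 <= M by apply: le_trans (gM 0).
apply: (@bmf_dominated _ T _ _ (discr g) g M) => //.
- move=> n t; apply: le_trans (ler_norm_sum _ _ _) _.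
  apply: le_trans (_ : \sum_(i <- iota 0 (gridK n)) M * \1_(cell n i) t <= _).
    apply: ler_sum => i _; rewrite normrM [`|\1__ _|]ger0_norm ?indicE // ler_wpM2r //.
  by rewrite -mulr_sumr sum_cells indicE ler_piMr //; case: (_ \in _).
- move=> t; apply/cvgrPdist_le => e e0.
  have /cvgrPdist_le /(_ _ e0) := cg t.
  rewrite near_simpl => /nbhs_ballP [d d0 hd].
  have nd : \forall n \near \oo, (n.+1%:R : R)^-1 < d.
    have := @cvg_harmonic R; move/cvgrPdist_lt => /(_ _ d0).
    by apply: filterS => n; rewrite sub0r normrN /harmonic ger0_norm // invr_ge0.
  have nt : \forall n \near \oo, `|t| < (n.+1%:R : R).
    have : \forall n \near \oo, `|t| <= (n%:R : R) by exact: nbhs_infty_ger.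
    by apply: filterS => n h; apply: le_lt_trans h _; rewrite ltr_nat.
  near=> n.
  have hn : (n.+1%:R : R)^-1 < d by near: n.
  have tn : `|t| < (n.+1%:R : R) by near: n.
  have s1 : \sum_(i <- iota 0 (gridK n)) \1_(cell n i) t = 1 :> R.
    rewrite sum_cells indicE mem_set //= in_itv /=.
    by move: tn; rewrite ltr_norml => /andP[/ltW -> ->].
  have -> : g t - discr g n t = \sum_(i <- iota 0 (gridK n)) (g t - g (grid n i)) * \1_(cell n i) t.
    rewrite -[g t in LHS]mulr1 -s1 mulr_sumr /discr -sumrB.
    by apply: eq_bigr => i _; rewrite mulrBl.
  apply: le_trans (ler_norm_sum _ _ _) _.
  apply: le_trans (_ : \sum_(i <- iota 0 (gridK n)) e * \1_(cell n i) t <= _).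
    apply: ler_sum => i _; rewrite normrM [`|\1__ _|]ger0_norm ?indicE //.
    case: (boolP (t \in cell n i)) => [|_]; last by rewrite !mulr0.
    rewrite !mulr1 inE /cell /= in_itv /= grid_step => /andP[h1 h2].
    apply: hd; rewrite /ball /= ger0_norm ?subr_ge0 //.
    by apply: lt_trans hn; rewrite ltrBlDl.
  by rewrite -mulr_sumr s1 mulr1.
Unshelve. all: by end_near. Qed.

Lemma atoms_ge0 n : all (fun p => 0 <= p.1) (atoms n).
Proof. by apply/allP => p /mapP[i _ ->] /=; rewrite fine_ge0. Qed.

End Discretization.

(** * Exponential representation of a general Nevanlinna function *)

Section ExpRep.
Context {R : realType}.
Local Notation T := (measurableTypeR R).
Local Notation cau := (@cauchym R).

Lemma nev_rep_const (f : R[i] -> R[i]) beta (rho : {finite_measure set T -> \bar R}) :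
  nev_rep f 0 beta rho -> fine (rho setT) = 0 -> forall z, UHP z -> f z = rC beta.
Proof.
move=> [_ fE] m0 z hz; rewrite fE // rC0 mul0r add0r.
have [M M0 hM] := cbmf_bound (cbmf_nkernel hz).
have := cmod_cintegral rho (cbmf_nkernel hz) hM; rewrite m0 mulr0 => h.
have : cmod (cintegral rho setT (nkernel z)) == 0 by rewrite eq_le h cmod_ge0.
by rewrite cmod_eq0 => /eqP ->; rewrite addr0.
Qed.

(** Real constants have density 0 or 1 according to sign. Otherwise the atomic approximants have
    densities in [0, 1], and a weak limit of these passes through the exponential at each fixed z by
    continuity. *)
Lemma exp_rep (f : R[i] -> R[i]) alpha beta (rho : {finite_measure set T -> \bar R}) :
  nev_rep f alpha beta rho ->
  exists xi : R -> R, [/\ measurable_fun setT xi, forall t, 0 <= xi t <= 1 &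
    forall z, UHP z -> f z = rC (cmod (f iC)) * cexp (npot cau xi z)].
Proof.
move=> frep; have [a0 fE] := frep.
have hi : UHP (iC : R[i]) by rewrite /UHP /cim /=.
have [/andP[/eqP a00 /eqP m0]|nc] := boolP ((alpha == 0) && (fine (rho setT) == 0)).
  subst alpha; have fc := nev_rep_const frep m0.
  have [b0|b0] := ltP beta 0.
    exists (cst 1); split.
    - exact: measurable_cst.
    - by move=> t; rewrite ler01 lexx.
    - move=> z hz; rewrite !fc // cexp_npot_line // cmod_rC ltr0_norm //.
      by rewrite rCN mulrN mulr1 opprK.
  exists (cst 0); split.
  - exact: measurable_cst.
  - by move=> t; rewrite ler01 lexx.
  - by move=> z hz; rewrite !fc // npot0 cexp0 mulr1 cmod_rC ger0_norm.
have nonconst : 0 < alpha \/ 0 < fine (rho setT).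
  move: nc; rewrite negb_and => /orP[h|h]; [left|right]; rewrite lt_neqAle eq_sym h //=.
  exact: mass_ge0.
(* Early grids may miss all the mass; the shift by [n0] keeps every approximant nonconstant. *)
have [n0 hn0] : exists n0, forall n, 0 < alpha \/ 0 < \sum_(p <- atoms rho (n + n0)) p.1.
  case: nonconst => [h|h]; first by exists 0%N => n; left.
  have c1 : continuous (cst 1 : R -> R) by move=> x; exact: cvg_cst.
  have lim := @atoms_cvg R rho (cst 1) c1 (bmf_cst _ 1).
  rewrite integral_cstT mul1r in lim.
  move/cvgrPdist_lt: lim => /(_ _ h) [n0 _ hn]; exists n0 => n; right.
  have := hn (n + n0)%N; rewrite /= leq_addl => /(_ isT).
  under eq_bigr do rewrite mulr1.
  by rewrite ltr_norml; lra.
pose s n := atoms rho (n + n0).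
pose a n := atomic alpha beta (s n).
(* [g] stands for the real or the imaginary part; both are additive and homogeneous over the
   reals. *)
have limre z (g : R[i] -> R) : UHP z -> (forall u v, g (u + v) = g u + g v) ->
    (forall x u, g (rC x * u) = x * g u) ->
    continuous (fun t : R => g (nkernel z t)) -> bmf (fun t => g (nkernel z t)) ->
    g (cintegral rho setT (nkernel z)) = \int[rho]_t g (nkernel z t) ->
    g (a n z) @[n --> \oo] --> g (f z).
  move=> hz gD gZ cg bg gI.
  have g0 : g 0 = 0 by have := gZ 0 0; rewrite mulr0 mul0r.
  have aE n : g (a n z) = g (rC alpha * z + rC beta) + \sum_(p <- s n) p.1 * g (nkernel z p.2).
    rewrite /a /atomic gD; congr (_ + _).
    by elim: (s n) => [|p l IH]; rewrite ?big_nil ?big_cons ?gD ?gZ ?IH.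
  under eq_cvg do rewrite aE.
  rewrite fE // gD gI; apply: cvgD; first exact: cvg_cst.
  have := @atoms_cvg R rho _ cg bg.
  by rewrite -(cvg_shiftn n0).
have cvgre z : UHP z -> cre (a n z) @[n --> \oo] --> cre (f z).
  move=> hz; have [c1 c2] := continuous_nkernel hz; have [b1 b2] := cbmf_nkernel hz.
  by apply: limre => //; [exact: creD | exact: cre_rCM].
have cvgim z : UHP z -> cim (a n z) @[n --> \oo] --> cim (f z).
  move=> hz; have [c1 c2] := continuous_nkernel hz; have [b1 b2] := cbmf_nkernel hz.
  by apply: limre => //; [exact: cimD | exact: cim_rCM].
have /choice[xi_ hxi] n : exists xi : R -> R, [/\ measurable_fun setT xi,
    forall t, 0 <= xi t <= 1 &
    forall z, UHP z -> a n z = rC (cmod (a n iC)) * cexp (npot cau xi z)].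
  exact: (atomic_exp_rep beta a0 (atoms_ge0 rho (n + n0)) (hn0 n)).
(* [U] refines convergence at infinity, so the ordinary limits of the approximants persist along
   [U]. *)
have [U [UU oU]] := ultraFilterLemma (F := nbhs \oo) _.
have UP : ProperFilter U by exact: ultra_proper.
have mxi n : measurable_fun setT (xi_ n : T -> R) by case: (hxi n).
have xi01 n t : 0 <= xi_ n t <= 1 by case: (hxi n).
have [xi [mx x01 wl]] := weak_limit cau UU mxi xi01.
exists xi; split => // z hz.
have toU (u : nat -> R) (l : R) : u n @[n --> \oo] --> l -> u n @[n --> U] --> l.
  by move=> h V /h; exact: oU.
have [b1 b2] := cbmf_nkernel hz.
have creE (eta : R -> R) : cre (npot cau eta z) = \int[cau]_t (cre (nkernel z t) * eta t).
  by apply: eq_Rintegral => t _; rewrite mulrC cre_rCM mulrC.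
have cimE (eta : R -> R) : cim (npot cau eta z) = \int[cau]_t (cim (nkernel z t) * eta t).
  by apply: eq_Rintegral => t _; rewrite mulrC cim_rCM mulrC.
have lre : cre (npot cau (xi_ n) z) @[n --> U] --> cre (npot cau xi z).
  by under eq_cvg do rewrite creE; rewrite creE; exact: (wl _ b1).
have lim_ : cim (npot cau (xi_ n) z) @[n --> U] --> cim (npot cau xi z).
  by under eq_cvg do rewrite cimE; rewrite cimE; exact: (wl _ b2).
have lc : cmod (a n iC) @[n --> U] --> cmod (f iC).
  apply: toU; rewrite /cmod.
  have h : cre (a n iC) ^+ 2 + cim (a n iC) ^+ 2 @[n --> \oo] --> cre (f iC) ^+ 2 + cim (f iC) ^+ 2.
    by apply: cvgD; apply: cvgM; first [exact: cvgre | exact: cvgim].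
  by apply: cvg_comp h _; exact: sqrt_continuous.
have lexp : expR (cre (npot cau (xi_ n) z)) @[n --> U] --> expR (cre (npot cau xi z)).
  by apply: cvg_comp lre _; exact: continuous_expR.
have lcos : cos (cim (npot cau (xi_ n) z)) @[n --> U] --> cos (cim (npot cau xi z)).
  by apply: cvg_comp lim_ _; exact: continuous_cos.
have lsin : sin (cim (npot cau (xi_ n) z)) @[n --> U] --> sin (cim (npot cau xi z)).
  by apply: cvg_comp lim_ _; exact: continuous_sin.
have aE n : a n z = rC (cmod (a n iC)) * cexp (npot cau (xi_ n) z).
  by case: (hxi n) => _ _; apply.
apply: complex_eqP.
- rewrite cre_rCM.
  have h1 := toU _ _ (cvgre z hz).
  have h2 : cre (a n z) @[n --> U] --> cmod (f iC) * cre (cexp (npot cau xi z)).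
    under eq_cvg => n do rewrite aE cre_rCM.
    by apply: cvgM => //; apply: cvgM.
  exact: (cvg_unique (@Rhausdorff R) h1 h2).
- rewrite cim_rCM.
  have h1 := toU _ _ (cvgim z hz).
  have h2 : cim (a n z) @[n --> U] --> cmod (f iC) * cim (cexp (npot cau xi z)).
    under eq_cvg => n do rewrite aE cim_rCM.
    by apply: cvgM => //; apply: cvgM.
  exact: (cvg_unique (@Rhausdorff R) h1 h2).
Qed.

End ExpRep.

(** * The density where the boundary value has a strict sign *)

Section Density.
Context {R : realType}.
Local Notation T := (measurableTypeR R).
Local Notation leb := (@lebesgue_measure R).
Local Notation cau := (@cauchym R).

Lemma cintegral_lebesgueE (psi : R -> R) (sig : set R) z : UHP z ->
  bmf (psi \_ sig : T -> R) -> measurable sig ->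
  cintegral leb sig (fun t => nkernel z t * rC (psi t / (1 + t ^+ 2))) =
  npot cau (psi \_ sig) z.
Proof.
move=> hz bpsi msig; have [b1 b2] := cbmf_npot bpsi hz.
apply: complex_eqP.
- rewrite cre_cintegral /npot cre_cintegral integral_cauchym // [LHS]Rintegral_mkcond.
  apply: eq_Rintegral => t _; rewrite !patchE /oneDsqr.
  by case: (t \in sig); rewrite ![nkernel _ _ * _]mulrC !cre_rCM ?mul0r // mulrAC.
- rewrite cim_cintegral /npot cim_cintegral integral_cauchym // [LHS]Rintegral_mkcond.
  apply: eq_Rintegral => t _; rewrite !patchE /oneDsqr.
  by case: (t \in sig); rewrite ![nkernel _ _ * _]mulrC !cim_rCM ?mul0r // mulrAC.
Qed.

Lemma cim_npot_itv xi z : bmf xi -> (forall t, 0 <= xi t <= 1) -> UHP z ->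
  0 <= cim (npot cau xi z) <= pi.
Proof.
move=> bxi xi01 hz; apply/andP; split.
- have := cim_npot_le cau (bmf_cst _ 0) bxi hz (fun t => proj1 (andP (xi01 t))).
  by rewrite npot0.
- have := cim_npot_le cau bxi (bmf_cst _ 1) hz (fun t => proj2 (andP (xi01 t))).
  by rewrite npot_line.
Qed.

Lemma cre_cexp z : cre (cexp z) = expR (cre z) * cos (cim z) :> R. Proof. by []. Qed.

Lemma cim_cexp z : cim (cexp z) = expR (cre z) * sin (cim z) :> R. Proof. by []. Qed.

Let slope_le (C y m q : R) : 0 <= C -> 0 <= y -> 0 < m -> m / 2 <= q ->
  C * y <= 2 * C / m * y * q.
Proof.
move=> C0 y0 m0 mq; have -> : 2 * C / m * y * q = (C * y) * (q * 2 / m) by ring.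
by rewrite ler_peMr ?mulr_ge0 // ler_pdivlMr // mul1r; lra.
Qed.

(** Boundary data near [x]: boundary function [c], radius [d], and one constant [C] for the
    Lipschitz estimates from inside C^+ and along the real line. *)
Definition local_bvalue (f : R[i] -> R[i]) x (c : R -> R) (d C : R) := [/\ 0 < d, 0 <= C,
  forall z s, UHP z -> cmod (z - rC x) < d -> `|s - x| < d ->
    cmod (f z - rC (c s)) <= C * cmod (z - rC s) &
  forall s s', `|s - x| < d -> `|s' - x| < d -> `|c s - c s'| <= C * `|s - s'|].

Lemma local_bvalueP f x c d C s : local_bvalue f x c d C -> `|s - x| < d ->
  bvalue f (Some s) (c s).
Proof.
move=> [d0 C0 fc _] sx e e0 /=.
have C1 : 0 < C + 1 by rewrite ltr_wpDl.
exists (Num.min (d - `|s - x|) (e / (C + 1))).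
  by rewrite lt_min subr_gt0 sx divr_gt0.
move=> z hz; rewrite lt_min => /andP[z1 z2].
apply: le_lt_trans (fc _ _ hz _ sx) _.
  apply: le_lt_trans (cmod_triangle (rC s) _ _) _.
  by rewrite -rCB cmod_rC -ltrBrDr.
move: z2; rewrite ltr_pdivlMr // => z2; apply: le_lt_trans _ z2.
by rewrite mulrC ler_wpM2l ?cmod_ge0 // lerDl.
Qed.

Lemma local_bvalue_sign f x c d C : local_bvalue f x c d C -> c x != 0 ->
  exists e : R, [/\ 0 < e, 2 * e < d, forall s, `|s - x| < e -> `|c s - c x| < `|c x| &
    forall s y, `|s - x| <= e -> 0 < y < e ->
      `|cre (f (Complex s y)) - c x| <= `|c x| / 2 /\ cim (f (Complex s y)) <= C * y].
Proof.
move=> [d0 C0 fc cl] cx; have m0 : 0 < `|c x| by rewrite normr_gt0.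
have C1 : 0 < C + 1 by rewrite ltr_wpDl.
set m := `|c x|.
(* The first bound keeps s + iy within 2e < d of [x]; the second makes [f] differ from [c x] by at
   most 2 C e <= |c x| / 2. *)
pose e := Num.min (d / 3) (m / (4 * (C + 1))).
have e0 : 0 < e by rewrite lt_min !divr_gt0 // mulr_gt0.
have ed : e <= d / 3 by rewrite ge_min lexx.
have em : e * (4 * (C + 1)) <= m.
  by rewrite -ler_pdivlMr ?mulr_gt0 // ge_min lexx orbT.
have em' : C * e * 4 <= m.
  by apply: le_trans em; rewrite -mulrA mulrC -!mulrA ler_wpM2l ?(ltW e0) //; lra.
have xx : `|x - x| < d by rewrite subrr normr0.
exists e; split => //; first lra.
- move=> s sx; have sd : `|s - x| < d by lra.
  apply: le_lt_trans (cl _ _ sd xx) _.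
  have : C * `|s - x| <= C * e by rewrite ler_wpM2l // ltW.
  move: em' m0; rewrite -/m; lra.
- move=> s y sx /andP[y0 ye].
  have hz : UHP (Complex s y) by [].
  have zs : cmod (Complex s y - rC s) = y.
    rewrite (_ : _ - _ = Complex 0 y); last by apply: complex_eqP; rewrite !creimE /cre /cim /=; ring.
    by rewrite /cmod /cre /cim /= expr0n /= add0r sqrtr_sqr gtr0_norm.
  have zx : cmod (Complex s y - rC x) <= 2 * e.
    apply: le_trans (cmod_triangle (rC s) _ _) _.
    by rewrite zs -rCB cmod_rC; lra.
  have zd : cmod (Complex s y - rC x) < d by lra.
  split.
  - have h1 := fc _ _ hz zd xx.
    have h2 := cre_le_cmod (f (Complex s y) - rC (c x)).
    rewrite creB cre_rC in h2; apply: le_trans h2 _; apply: le_trans h1 _.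
    have : C * cmod (Complex s y - rC x) <= C * (2 * e) by rewrite ler_wpM2l.
    move: em'; lra.
  - have sd : `|s - x| < d by lra.
    have h1 := fc _ _ hz zd sd; rewrite zs in h1.
    have h2 := cim_le_cmod (f (Complex s y) - rC (c s)).
    rewrite cimB cim_rC subr0 in h2.
    by apply: le_trans (ler_norm _) _; apply: le_trans h2 h1.
Qed.

Variables (f : R[i] -> R[i]) (xi : R -> R) (k : R).
Hypotheses (k0 : 0 < k) (bxi : bmf (xi : T -> R)) (xi01 : forall t, 0 <= xi t <= 1).
Hypothesis fE : forall z, UHP z -> f z = rC k * cexp (npot cau xi z).

Lemma density_neg x c d C : local_bvalue f x c d C -> c x < 0 -> exists e : R,
  [/\ 0 < e, e < d, forall s, `|s - x| < e -> c s < 0 &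
   leb.-negligible ([set t | 1 - xi t <> 0] `&` `]x - e, x + e[%classic)].
Proof.
move=> loc cx; have [d0 C0 _ _] := loc.
have cx0 : c x != 0 by rewrite lt_eqF.
have [e [e0 ed cs fs]] := local_bvalue_sign loc cx0.
rewrite (ltr0_norm cx) in cs fs.
exists e; split => //; first lra.
  by move=> s /cs; rewrite ltr_norml; lra.
have b1 : bmf (cst 1 : T -> R) by exact: bmf_cst.
(* The slope is the bound C y for Im f divided by |c x| / 2, a lower bound for |Re f|. *)
apply: (@poisson_zero R _ (x - e) (x + e) (2 * C / - c x) e) => //; first lra.
- exact: bmfB.
- by move=> t; rewrite subr_ge0; case/andP: (xi01 t).
move=> s y sx y0e; have /andP[y0 ye] := y0e.
have hz : UHP (Complex s y) by [].
have sx' : `|s - x| <= e by rewrite ler_norml; lra.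
have [h1 h2] := fs s y sx' y0e.
have th := cim_npot_itv bxi xi01 hz.
rewrite npotB // npot_line // cimB [cim (Complex 0 _)]/cim.
move: h1 h2; rewrite fE // cre_rCM cim_rCM cre_cexp cim_cexp !mulrA.
move: th; set r := k * _; set w := cim _ => th h1 h2.
have r0 : 0 < r by rewrite mulr_gt0 // expR_gt0.
have rc : r * cos w <= c x / 2 by move: h1; rewrite ler_norml; lra.
have rc0 : r * cos w < 0 by lra.
apply: le_trans (angle_le_neg r0 th rc0) _.
have n0 : 0 < - (r * cos w) by lra.
rewrite ler_pdivrMr //; apply: le_trans h2 _.
apply: slope_le => //; [exact: ltW|rewrite oppr_gt0|] => //; lra.
Qed.

Lemma density_pos x c d C : local_bvalue f x c d C -> 0 < c x -> exists e : R,
  [/\ 0 < e, e < d, forall s, `|s - x| < e -> 0 < c s &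
   leb.-negligible ([set t | xi t <> 0] `&` `]x - e, x + e[%classic)].
Proof.
move=> loc cx; have [d0 C0 _ _] := loc.
have cx0 : c x != 0 by rewrite gt_eqF.
have [e [e0 ed cs fs]] := local_bvalue_sign loc cx0.
rewrite (gtr0_norm cx) in cs fs.
exists e; split => //; first lra.
  by move=> s /cs; rewrite ltr_norml; lra.
apply: (@poisson_zero R _ (x - e) (x + e) (2 * C / c x) e) => //; first lra.
- by move=> t; case/andP: (xi01 t).
move=> s y sx y0e; have /andP[y0 ye] := y0e.
have hz : UHP (Complex s y) by [].
have sx' : `|s - x| <= e by rewrite ler_norml; lra.
have [h1 h2] := fs s y sx' y0e.
have th := cim_npot_itv bxi xi01 hz.
move: h1 h2; rewrite fE // cre_rCM cim_rCM cre_cexp cim_cexp !mulrA.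
move: th; set r := k * _; set w := cim _ => th h1 h2.
have r0 : 0 < r by rewrite mulr_gt0 // expR_gt0.
have rc : c x / 2 <= r * cos w by move: h1; rewrite ler_norml; lra.
have rc0 : 0 < r * cos w by lra.
apply: le_trans (angle_le_pos r0 th rc0) _.
rewrite ler_pdivrMr //; apply: le_trans h2 _.
by apply: slope_le => //; exact: ltW.
Qed.

End Density.

(** * Gaps of the support and openness of the negativity set *)

Section SupportGap.
Context {R : realType}.
Local Notation T := (measurableTypeR R).
Variables (f : R[i] -> R[i]) (alpha beta : R) (rho : {finite_measure set T -> \bar R}).
Hypothesis frep : nev_rep f alpha beta rho.

Lemma open_msupportC : open (~` msupport rho).
Proof.
rewrite openE => x /(msupport_open (rho := rho)) [e e0 re].
exists (e / 2) => /=; first by rewrite divr_gt0.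
move=> y /=; rewrite /ball /= => xy /(_ (e / 2)).
have e20 : 0 < e / 2 by rewrite divr_gt0.
move=> /(_ e20); apply/negP; rewrite -leNgt -re; apply: le_measure; rewrite ?inE //.
move=> t /=; rewrite !in_itv /=; move: xy; rewrite ltr_norml; lra.
Qed.

Lemma measurable_msupport : measurable (msupport rho : set T).
Proof.
by rewrite -[X in measurable X]setCK; apply: measurableC; exact: open_measurable open_msupportC.
Qed.

Lemma gap_local_bvalue x : ~ msupport rho x -> exists c d C,
  [/\ local_bvalue f x c d C, forall s, `|s - x| < d -> ~ msupport rho s &
  (0 < alpha \/ 0 < fine (rho setT)) ->
    forall s s', `|s - x| < d -> `|s' - x| < d -> s < s' -> c s < c s'].
Proof.
move=> nx; have [e e0 re] := msupport_open nx.
have [c [d0 [C [d00 C0 fc cl inc]]]] := near_boundary frep e0 re.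
have := open_msupportC; rewrite openE => /(_ _ nx) [e' /= e'0 he'].
pose d := Num.min d0 e'.
have dd s : s < d -> s < d0 by rewrite lt_min => /andP[].
exists c, d, C; split.
- split => //; first by rewrite lt_min d00.
    by move=> z s hz /dd h1 /dd h2; exact: fc.
  by move=> s s' /dd h1 /dd h2; exact: cl.
- move=> s; rewrite lt_min => /andP[_ h]; apply: he'.
  by rewrite /ball /= distrC.
- by move=> pos s s' /dd h1 /dd h2; exact: inc.
Qed.

Lemma nev_rep_dichotomy :
  (forall z, UHP z -> f z = rC beta) \/ (0 < alpha \/ 0 < fine (rho setT)).
Proof.
have [a0 _] := frep; have [ap|an] := ltP 0 alpha; first by right; left.
have [mp|mn] := ltP 0 (fine (rho setT)); first by right; right.
left; have aE : alpha = 0 by apply/eqP; rewrite eq_le an a0.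
apply: (@nev_rep_const R f beta rho); first by rewrite -aE.
by apply/eqP; rewrite eq_le mn mass_ge0.
Qed.

Lemma bvalue_real_approx s c e d : 0 < e -> 0 < d -> bvalue f (Some s) c ->
  exists2 y, 0 < y < d & cmod (f (Complex s y) - rC c) < e.
Proof.
move=> e0 d0 bv; have [del del0 h] := bv _ e0.
exists (Num.min d del / 2).
  have m0 : 0 < Num.min d del by rewrite lt_min d0.
  have m1 : Num.min d del <= d by rewrite ge_min lexx.
  lra.
have m0 : 0 < Num.min d del by rewrite lt_min d0.
have m1 : Num.min d del <= del by rewrite ge_min lexx orbT.
apply: h; first by rewrite /UHP /cim /= divr_gt0.
rewrite (_ : _ - _ = Complex 0 (Num.min d del / 2)); last first.
  by apply: complex_eqP; rewrite !creimE /cre /cim /=; ring.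
rewrite /cmod /cre /cim /= expr0n /= add0r sqrtr_sqr gtr0_norm ?divr_gt0 //; lra.
Qed.

Lemma Gammaf_ext_open : ext_open (Gammaf f alpha rho).
Proof.
split.
- move=> t [nt [c0 c00 bv]].
  have [c [d [C [loc gap _]]]] := gap_local_bvalue nt.
  have [d0 C0 _ cl] := loc.
  have tt : `|t - t| < d by rewrite subrr normr0.
  have cE : c0 = c t := bvalue_uniq bv (local_bvalueP loc tt).
  have ct0 : c t != 0 by rewrite -cE lt_eqF.
  have [e [e0 ed cs _]] := local_bvalue_sign loc ct0.
  exists e => // s se; have sd : `|s - t| < d by lra.
  split; first exact: gap.
  exists (c s); last exact: local_bvalueP loc sd.
  have := cs _ se; rewrite -cE (ltr0_norm c00) ltr_norml; lra.
- move=> [om [c0 c00 bv]].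
  have [c [M [M0 nM bvc _]]] := infinity_boundary frep om.
  have cE : c0 = c := bvalue_uniq bv bvc.
  (* The boundary value at a large [s] is compared with [c0] through a point of C^+ just above [s];
     two errors below |c0| / 2 leave it negative. *)
  have e0 : 0 < - c0 / 2 by rewrite divr_gt0 // oppr_gt0.
  have [M' hM'] := bv _ e0.
  exists (Num.max M M') => s; rewrite gt_max => /andP[sM sM'].
  have ns := nM _ sM; split => //.
  have [cs [d [C [loc _ _]]]] := gap_local_bvalue ns.
  have [d0 _ _ _] := loc.
  have ss : `|s - s| < d by rewrite subrr normr0.
  have bs := local_bvalueP loc ss.
  exists (cs s) => //.
  have [y /andP[y0 _] hy] := bvalue_real_approx e0 ltr01 bs.
  have := hM' (Complex s y); rewrite /UHP {1}/cim /= => /(_ y0).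
  have sz : `|s| <= cmod (Complex s y) by exact: (cre_le_cmod (Complex s y)).
  move=> /(_ (lt_le_trans sM' sz)) h2.
  have := le_lt_trans (cre_le_cmod _) hy; have := le_lt_trans (cre_le_cmod _) h2.
  rewrite !creB !cre_rC !ltr_norml; lra.
Qed.

End SupportGap.

(** * The density off the support, and positivity of boundary values *)

Section ExponentialForm.
Context {R : realType}.
Local Notation T := (measurableTypeR R).
Local Notation leb := (@lebesgue_measure R).
Local Notation cau := (@cauchym R).
Variables (f : R[i] -> R[i]) (alpha beta : R) (rho : {finite_measure set T -> \bar R}).
Hypothesis frep : nev_rep f alpha beta rho.
Variables (xi : R -> R) (k : R).
Hypotheses (k0 : 0 < k) (bxi : bmf (xi : T -> R)) (xi01 : forall t, 0 <= xi t <= 1).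
Hypothesis fE : forall z, UHP z -> f z = rC k * cexp (npot cau xi z).

Lemma const_neq0 : (forall z, UHP z -> f z = rC beta) -> beta != 0.
Proof.
move=> fc; have hi : UHP (iC : R[i]) by rewrite /UHP /cim /=.
rewrite -rC_eq0 -(fc _ hi) fE // mulf_neq0 ?cexp_neq0 // rC_eq0 gt_eqF //.
Qed.

(* Where [c] vanishes [f] is not constant, as it would be zero. *)
Lemma bvalue_zero_isolated x c d C : local_bvalue f x c d C ->
  ((0 < alpha \/ 0 < fine (rho setT)) ->
    forall s s', `|s - x| < d -> `|s' - x| < d -> s < s' -> c s < c s') ->
  c x = 0 -> forall s s', `|s - x| < d -> `|s' - x| < d -> s < s' -> c s < c s'.
Proof.
move=> loc inc cx; apply: inc.
have [fc|//] := nev_rep_dichotomy frep.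
have [d0 _ _ _] := loc.
have xx : `|x - x| < d by rewrite subrr normr0.
have bvb : bvalue f (Some x) beta.
  by move=> e e0; exists 1 => // z hz _; rewrite fc // subrr cmod0.
by have := const_neq0 fc; rewrite (bvalue_uniq bvb (local_bvalueP loc xx)) cx eqxx.
Qed.

Lemma exponent_ae : {ae leb, forall t,
  xi t = \1_(oreal (Gammaf f alpha rho)) t + (xi \_ (msupport rho)) t}.
Proof.
set G := oreal _; set N := [set t | xi t <> \1_G t + (xi \_ (msupport rho)) t].
have NS t : N t -> ~ msupport rho t.
  move=> Nt ms; apply: Nt; rewrite patchE (mem_set ms) indicE memNset ?add0r //.
  by move=> [].
have loc0 x c d C : local_bvalue f x c d C ->
    (forall s, `|s - x| < d -> ~ msupport rho s) -> c x != 0 ->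
    exists2 e : R, 0 < e & leb.-negligible (N `&` `]x - e, x + e[%classic).
  move=> loc gap cx.
  have out s : ~ msupport rho s -> (xi \_ (msupport rho)) s = 0.
    by move=> ns; rewrite patchE memNset.
  have itvP e s : `]x - e, x + e[%classic s -> `|s - x| < e.
    by rewrite /= in_itv /= ltr_norml; lra.
  have [cn|cp|/eqP] := ltgtP (c x) 0; last by rewrite (negbTE cx).
  - have [e [e0 ed cs ng]] := density_neg k0 bxi xi01 fE loc cn.
    exists e => //; apply: negligibleS ng => s [Ns se]; split => // h.
    have sx := itvP _ _ se; have sd := lt_trans sx ed.
    apply: Ns; rewrite out ?addr0; last exact: gap.
    rewrite indicE mem_set; first by apply/eqP; rewrite eq_sym -subr_eq0 h.
    split; first exact: gap.
    by exists (c s); [exact: cs | exact: local_bvalueP loc sd].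
  - have [e [e0 ed cs ng]] := density_pos k0 bxi xi01 fE loc cp.
    exists e => //; apply: negligibleS ng => s [Ns se]; split => // h.
    have sx := itvP _ _ se; have sd := lt_trans sx ed.
    apply: Ns; rewrite out ?addr0; last exact: gap.
    rewrite indicE memNset // => -[_ [c' c'0 bv]].
    have cE := bvalue_uniq bv (local_bvalueP loc sd).
    by have := cs _ sx; rewrite -cE; lra.
suff : leb.-negligible (N `&` ~` msupport rho).
  by apply: negligibleS => t Nt; split => //; exact: NS.
apply: locally_negligible => x nx.
have [c [d [C [loc gap inc]]]] := gap_local_bvalue frep nx.
have [d0 _ _ _] := loc.
have [cx|cx] := eqVneq (c x) 0; last exact: loc0 loc gap cx.
have incr := bvalue_zero_isolated loc inc cx.
exists d => //.
(* By strict monotonicity [c] is nonzero on the punctured interval. The signed case is applied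
   around each such [s] with boundary data centred at [s], which uniqueness of boundary values
   identifies with [c s]. *)
have n1 : leb.-negligible (N `&` (`]x - d, x + d[%classic `\ x)).
  apply: locally_negligible => s [/=]; rewrite in_itv /= => sx nsx.
  have sd : `|s - x| < d by rewrite ltr_norml; lra.
  have ns := gap _ sd.
  have [c' [d' [C' [loc' gap' _]]]] := gap_local_bvalue frep ns.
  have [d'0 _ _ _] := loc'.
  have ss : `|s - s| < d' by rewrite subrr normr0.
  apply: (loc0 _ _ _ _ loc' gap').
  rewrite (bvalue_uniq (local_bvalueP loc' ss) (local_bvalueP loc sd)).
  have xx : `|x - x| < d by rewrite subrr normr0.
  have [lt|lt|eq] := ltgtP s x; last by case: nsx.
  - by rewrite lt_eqF // -cx; exact: incr.
  - by rewrite gt_eqF // -cx; exact: incr.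
have n2 : leb.-negligible [set x].
  by exists [set x]; split => //; exact: lebesgue_measure_set1.
apply: negligibleS (negligibleU n1 n2) => s [Ns sd].
by have [->|/eqP sx] := eqVneq s x; [right|left].
Qed.

(** A negative value would force [xi = 1] almost everywhere on an interval. A zero at a finite point
    is excluded as well, because strict growth would make the values to its left negative. *)
Lemma bvalue_gt0 (x : option R) :
  (forall a b : R, a < b -> ~ {ae leb, forall t, `]a, b[%classic t -> xi t = 1}) ->
  Omegaf alpha rho x -> exists2 c : R, 0 < c & bvalue f x c.
Proof.
move=> xi1.
have nneg t c d C : local_bvalue f t c d C -> 0 <= c t.
  move=> loc; rewrite leNgt; apply/negP => cn.
  have [e [e0 ed cs ng]] := density_neg k0 bxi xi01 fE loc cn.
  apply: (xi1 (t - e) (t + e)); first lra.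
  apply: negligibleS ng => s /= h; split.
    by move=> h1; apply: h => _; apply/eqP; rewrite eq_sym -subr_eq0 h1.
  by apply: contrapT => h1; apply: h => /h1.
have real t : ~ msupport rho t -> exists2 c : R, 0 < c & bvalue f (Some t) c.
  move=> nt; have [c [d [C [loc gap inc]]]] := gap_local_bvalue frep nt.
  have [d0 _ _ _] := loc.
  have tt : `|t - t| < d by rewrite subrr normr0.
  exists (c t); last exact: local_bvalueP loc tt.
  rewrite lt_neqAle (nneg _ _ _ _ loc) andbT; apply/eqP => /esym ct.
  have incr := bvalue_zero_isolated loc inc ct.
  pose s := t - d / 2.
  have sd : `|s - t| < d by rewrite /s ltr_norml; lra.
  have [c' [d' [C' [loc' _ _]]]] := gap_local_bvalue frep (gap _ sd).
  have [d'0 _ _ _] := loc'.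
  have ss : `|s - s| < d' by rewrite subrr normr0.
  have := nneg _ _ _ _ loc'.
  rewrite (bvalue_uniq (local_bvalueP loc' ss) (local_bvalueP loc sd)) leNgt -ct.
  by rewrite incr // /s; lra.
case: x => [t|] om; first exact: real.
have [c [M [M0 nM bvc cle]]] := infinity_boundary frep om.
exists c => //.
(* Right of the support Re f <= c on C^+, so the value at infinity is at least the positive boundary
   value at M + 1. *)
have sM : M < `|M + 1| by rewrite ger0_norm; lra.
have [c' c'0 bv] := real _ (nM _ sM).
apply: lt_le_trans c'0 _; rewrite leNgt; apply/negP => cc'.
have e0 : 0 < c' - c by rewrite subr_gt0.
have [y /andP[y0 _] hy] := bvalue_real_approx e0 ltr01 bv.
have hz : UHP (Complex (M + 1) y) by [].
have := cle _ hz; rewrite {1}/cre /= ltrDl ltr01 => /(_ isT).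
have := le_lt_trans (cre_le_cmod _) hy; rewrite creB cre_rC ltr_norml; lra.
Qed.

End ExponentialForm.

(** * Both directions of the exponential representation *)

Theorem theorem5p1 (R : realType) :
  (* (i) *)
  (forall (f : R[i] -> R[i]) (alpha beta : R)
          (rho : {finite_measure set (measurableTypeR R) -> \bar R}),
     nevanlinna f -> (exists2 z, UHP z & f z != 0) ->
     nev_rep f alpha beta rho ->
     let sig := [set t : R | sigmaf alpha rho (Some t)] in
     exists (gamma : R) (psi : R -> R),
       measurable_fun sig psi /\ (forall t, sig t -> 0 <= psi t <= 1) /\
       let h := fun z : R[i] => rC gamma +
         cintegral lebesgue_measure sig
           (fun t => nkernel z t * rC (psi t / (1 + t ^+ 2))) in
       nevanlinna h /\
       forall z, UHP z ->
         krein_cvg (Gammaf f alpha rho) z /\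
         f z = kO (Gammaf f alpha rho) z * cexp (h z)) /\
  (* (ii) *)
  (forall (sig : set R) (O : set (option R)) (phi : R -> R),
     closed sig -> ext_open O ->
     (forall t, O (Some t) -> ~ sig t) ->
     measurable_fun sig phi -> (forall t, sig t -> 0 <= phi t <= 1) ->
     (forall a b : R, a < b ->
        ~ {ae lebesgue_measure, forall t, `]a, b[%classic t -> sig t /\ phi t = 1}) ->
     let v := fun z : R[i] =>
       cintegral lebesgue_measure sig
         (fun t => nkernel z t * rC (phi t / (1 + t ^+ 2))) in
     (forall z, UHP z -> krein_cvg O z) /\
     nevanlinna (fun z => kO O z * cexp (v z)) /\
     forall (alpha beta : R)
            (rho : {finite_measure set (measurableTypeR R) -> \bar R}),
       nev_rep (fun z => cexp (v z)) alpha beta rho ->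
       Gammaf (fun z => cexp (v z)) alpha rho = set0 /\
       forall x, Omegaf alpha rho x ->
         exists2 c : R, 0 < c & bvalue (fun z => cexp (v z)) x c).
Proof.
split.
- move=> f alpha beta rho _ [z0 hz0 fz0] frep sig.
  have [xi [mxi xi01 fE]] := exp_rep frep.
  set K := cmod (f iC) in fE.
  have K0 : 0 < K.
    rewrite lt_neqAle cmod_ge0 andbT eq_sym; apply: contraNneq fz0 => K0.
    by rewrite fE // K0 rC0 mul0r.
  have bxi : bmf (xi : measurableTypeR R -> R) by exact: bmf01.
  have msig : measurable (sig : set (measurableTypeR R)) by exact: measurable_msupport.
  have bxs : bmf (xi \_ sig : measurableTypeR R -> R).
    apply: (@bmf_restrict _ _ _ _ _ 1) => //; first exact: measurable_funTS.
    by move=> t _; have /andP[x0 x1] := xi01 t; rewrite ger0_norm.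
  have G := Gammaf_ext_open frep.
  (* Off the support the density is the indicator of [Gammaf], which produces the Krein product; its
     restriction to the support is psi, and gamma is ln |f(i)|. *)
  exists (ln K), xi; split; first exact: measurable_funTS.
  split; first by move=> t _; exact: xi01.
  move=> h.
  have hE z : UHP z -> h z = rC (ln K) + npot (@cauchym R) (xi \_ sig) z.
    by move=> hz; rewrite /h cintegral_lebesgueE.
  split; last first.
    move=> z hz; split.
      by exists (cexp (npot (@cauchym R) (\1_(oreal (Gammaf f alpha rho))) z)); exact: krein_to_cexp.
    rewrite kO_cexp // hE // cexpD cexp_rC lnK // fE // mulrCA -cexpD -npotD //; last first.
      by apply: bmf_indic; exact: measurable_oreal.
    congr (_ * cexp _); apply: eq_npot_ae => //; last exact: (exponent_ae frep K0 bxi xi01 fE).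
    by apply: bmfD => //; apply: bmf_indic; exact: measurable_oreal.
  split => z hz.
    apply: qdiff_cdifferentiable.
    apply: (@qdiff_ext _ (fun w => rC (ln K) + npot (@cauchym R) (xi \_ sig) w)) => //.
      by move=> w hw; rewrite hE.
    by apply: qdiff_shift; exact: npot_qdiff.
  rewrite hE // cimD cim_rC add0r.
  have xs01 t : 0 <= (xi \_ sig) t <= 1.
    by rewrite patchE; case: (t \in sig) => //; rewrite lexx ler01.
  by have /andP[] := cim_npot_itv bxs xs01 hz.
- move=> sig O phi csig oO dis mphi phi01 nphi v.
  have msig : measurable (sig : set (measurableTypeR R)) by exact: closed_measurable.
  have bphi : bmf (phi \_ sig : measurableTypeR R -> R).
    apply: (@bmf_restrict _ _ _ _ _ 1) => //.
    by move=> t /phi01 /andP[x0 x1]; rewrite ger0_norm.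
  have p01 t : 0 <= (phi \_ sig) t <= 1.
    rewrite patchE; case: (pselect (sig t)) => st.
      by rewrite (mem_set st); exact: phi01.
    by rewrite (memNset st) lexx ler01.
  have vE z : UHP z -> v z = npot (@cauchym R) (phi \_ sig) z.
    by move=> hz; rewrite /v cintegral_lebesgueE.
  split; first by move=> z hz; exists (cexp (npot (@cauchym R) (\1_(oreal O)) z)); exact: krein_to_cexp.
  split.
    have bO : bmf (\1_(oreal O) : measurableTypeR R -> R).
      by apply: bmf_indic; exact: measurable_oreal.
    (* Since [O] avoids [sig], the sum stays in [0, 1], and the product of [kO O] and e^v is the
       exponential of a single potential with argument in [0, pi]. *)
    pose xi t := \1_(oreal O) t + (phi \_ sig) t.
    have bxi : bmf (xi : measurableTypeR R -> R) by exact: bmfD.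
    have xi01 t : 0 <= xi t <= 1.
      rewrite /xi indicE; case: (pselect (oreal O t)) => Ot.
        by rewrite (mem_set Ot) patchE memNset ?addr0 ?ler01 ?lexx //; exact: dis.
      by rewrite (memNset Ot) add0r.
    have kE z : UHP z -> cexp (npot (@cauchym R) xi z) = kO O z * cexp (v z).
      by move=> hz; rewrite kO_cexp // vE // -cexpD -npotD.
    split => z hz.
      apply: qdiff_cdifferentiable; apply: (qdiff_ext hz kE).
      by apply: qdiff_cexp; exact: npot_qdiff.
    by rewrite -kE //; apply: cim_cexp_ge0; exact: cim_npot_itv.
  move=> alpha beta rho frep.
  have fE z : UHP z -> cexp (v z) = rC 1 * cexp (npot (@cauchym R) (phi \_ sig) z).
    by move=> hz; rewrite vE // rC1 mul1r.
  have pos x : Omegaf alpha rho x -> exists2 c : R, 0 < c & bvalue (fun z => cexp (v z)) x c.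
    apply: (bvalue_gt0 frep ltr01 bphi p01 fE) => a b ab h; apply: (nphi a b ab).
    apply: negligibleS h => t /= nt ht; apply: nt => tab; have := ht tab.
    rewrite patchE; case: (pselect (sig t)) => st; first by rewrite (mem_set st).
    by rewrite (memNset st) => /eqP; rewrite eq_sym oner_eq0.
  split => //; apply/seteqP; split => // x [om [c c0 bv]].
  have [c' c'0 bv'] := pos _ om.
  by have := bvalue_uniq bv bv'; lra.
Qed.
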